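(* The class of all c-regular cyclically ordered abelian groups is the smallest elementary class (in the first order language of cyclically ordered groups) containing all the c-archimedean cyclically ordered groups.
   Context: All groups are abelian, written additively. A cyclically ordered group $(G,R)$ is an abelian group $G$ with a ternary relation $R$ such that: $R(a,b,c)$ implies that $a,b,c$ are pairwise distinct; $R(a,b,c)\Rightarrow R(b,c,a)$; for every $c\in G$, $R(c,\cdot,\cdot)$ is a strict linear order on $G\setminus\{c\}$; $R(a,b,c)\Rightarrow R(a+u,b+u,c+u)$. Let $\mathbb{K}$ be the multiplicative group of complex numbers of modulus $1$, cyclically ordered as follows: for $0\le\theta_1,\theta_2,\theta_3<2\pi$, $R(e^{i\theta_1},e^{i\theta_2},e^{i\theta_3})$ holds iff $\theta_1<\theta_2<\theta_3$ up to cyclic permutation of the indices. A cyclically ordered group is c-archimedean if it is isomorphic, as a cyclically ordered group, to a subgroup of $\mathbb{K}$. $R(x_1,\dots,x_m)$ (with $m\ge3$) means that $R(x_i,x_j,x_k)$ holds for all $1\le i<j<k\le m$. For an integer $n\ge2$, $(G,R)$ is c-$n$-regular if for all $x_1,\dots,x_n\in G$ with $R(0,x_1,\dots,x_n)$ there is $x\in G$ such that ($nx=x_1$ or $nx=x_n$ or $R(x_1,nx,x_n)$) and $R(0,x,2x,\dots,(n-1)x,x_n)$. $G$ is c-regular if it is c-$n$-regular for every $n\ge2$. The language of cyclically ordered groups consists of the language of groups and the ternary predicate $R$. An elementary class is the class of all models of some set of first order sentences. *)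

(* Defs.v *)
From Stdlib Require Import Reals List FinFun.
From Coquelicot Require Import Coquelicot.
Import ListNotations.
Local Open Scope nat_scope.

(** * First-order logic of cyclically ordered groups

    The language has a constant [0], a binary [+], a unary [-] and a ternary
    predicate; equality is a logical symbol. *)

Record structure : Type := Structure {
  carrier :> Type;
  zero : carrier;
  add : carrier -> carrier -> carrier;
  opp : carrier -> carrier;
  cyc : carrier -> carrier -> carrier -> Prop
}.

Arguments zero {s}.
Arguments add {s} _ _.
Arguments opp {s} _.
Arguments cyc {s} _ _ _.

Inductive term : Set :=
| Var (i : nat)
| Zero
| Add (s t : term)
| Opp (t : term).

(** Variables are de Bruijn indices: [All] and [Ex] bind index [0] of their
    body and shift the other indices by one. *)
Inductive formula : Set :=
| Eq (s t : term)
| Cyc (s t u : term)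
| Neg (f : formula)
| And (f g : formula)
| Or (f g : formula)
| Imp (f g : formula)
| All (f : formula)
| Ex (f : formula).

(** [term_below k t] and [formula_below k f]: all free variables have index
    smaller than [k]. *)
Fixpoint term_below (k : nat) (t : term) : Prop :=
  match t with
  | Var i => i < k
  | Zero => True
  | Add s t => term_below k s /\ term_below k t
  | Opp t => term_below k t
  end.

Fixpoint formula_below (k : nat) (f : formula) : Prop :=
  match f with
  | Eq s t => term_below k s /\ term_below k t
  | Cyc s t u => term_below k s /\ term_below k t /\ term_below k u
  | Neg f => formula_below k f
  | And f g | Or f g | Imp f g => formula_below k f /\ formula_below k g
  | All f | Ex f => formula_below (S k) f
  end.

Definition sentence (f : formula) : Prop := formula_below 0 f.

Definition valuation_cons {M : Type} (a : M) (v : nat -> M) : nat -> M :=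
  fun i => match i with 0 => a | S j => v j end.

Fixpoint eval (M : structure) (v : nat -> M) (t : term) : M :=
  match t with
  | Var i => v i
  | Zero => zero
  | Add s t => add (eval M v s) (eval M v t)
  | Opp t => opp (eval M v t)
  end.

Fixpoint sat (M : structure) (v : nat -> M) (f : formula) : Prop :=
  match f with
  | Eq s t => eval M v s = eval M v t
  | Cyc s t u => cyc (eval M v s) (eval M v t) (eval M v u)
  | Neg f => ~ sat M v f
  | And f g => sat M v f /\ sat M v g
  | Or f g => sat M v f \/ sat M v g
  | Imp f g => sat M v f -> sat M v g
  | All f => forall a : M, sat M (valuation_cons a v) f
  | Ex f => exists a : M, sat M (valuation_cons a v) f
  end.

Definition model (T : formula -> Prop) (M : structure) : Prop :=
  forall f, T f -> forall v : nat -> M, sat M v f.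

Definition elementary_class (K : structure -> Prop) : Prop :=
  exists T : formula -> Prop,
    (forall f, T f -> sentence f) /\
    (forall M : structure, K M <-> model T M).

(** * Cyclically ordered abelian groups *)

Definition abelian_group (M : structure) : Prop :=
  (forall a b c : M, add a (add b c) = add (add a b) c) /\
  (forall a b : M, add a b = add b a) /\
  (forall a : M, add a zero = a) /\
  (forall a : M, add a (opp a) = zero).

Definition strict_linear_order_on {A : Type} (P : A -> Prop)
    (r : A -> A -> Prop) : Prop :=
  (forall a, P a -> ~ r a a) /\
  (forall a b c, P a -> P b -> P c -> r a b -> r b c -> r a c) /\
  (forall a b, P a -> P b -> a <> b -> r a b \/ r b a).

Definition cyclically_ordered_group (M : structure) : Prop :=
  abelian_group M /\
  (forall a b c : M, cyc a b c -> a <> b /\ b <> c /\ a <> c) /\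
  (forall a b c : M, cyc a b c -> cyc b c a) /\
  (forall c : M, strict_linear_order_on (fun a => a <> c) (cyc c)) /\
  (forall a b c u : M, cyc a b c -> cyc (add a u) (add b u) (add c u)).

(** * The c-archimedean groups *)

Definition subgroup (M : structure) (H : M -> Prop) : Prop :=
  H zero /\
  (forall a b : M, H a -> H b -> H (add a b)) /\
  (forall a : M, H a -> H (opp a)).

Definition substructure (M : structure) (H : M -> Prop) (HH : subgroup M H) :
    structure :=
  {| carrier := {a : M | H a};
     zero := exist _ zero (proj1 HH);
     add := fun a b =>
       exist _ (add (proj1_sig a) (proj1_sig b))
         (proj1 (proj2 HH) _ _ (proj2_sig a) (proj2_sig b));
     opp := fun a =>
       exist _ (opp (proj1_sig a)) (proj2 (proj2 HH) _ (proj2_sig a));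
     cyc := fun a b c => cyc (proj1_sig a) (proj1_sig b) (proj1_sig c) |}.

Definition isomorphic (M N : structure) : Prop :=
  exists f : M -> N,
    Bijective f /\
    f zero = zero /\
    (forall a b, f (add a b) = add (f a) (f b)) /\
    (forall a, f (opp a) = opp (f a)) /\
    (forall a b c, cyc a b c <-> cyc (f a) (f b) (f c)).

Definition circle : Type := {z : C | Cmod z = 1%R}.

Lemma circle_mul_subproof (x y : circle) :
  Cmod (Cmult (proj1_sig x) (proj1_sig y)) = 1%R.
Proof.
  now rewrite Cmod_mult, (proj2_sig x), (proj2_sig y), Rmult_1_r.
Qed.

Lemma circle_inv_subproof (x : circle) : Cmod (Cinv (proj1_sig x)) = 1%R.
Proof.
  rewrite Cmod_inv, (proj2_sig x); [apply Rinv_1|].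
  apply Cmod_gt_0. rewrite (proj2_sig x). exact Rlt_0_1.
Qed.

(** The complex number [e^(i t)]. *)
Definition cis (t : R) : C := (cos t, sin t).

Definition circle_cyc (x y z : circle) : Prop :=
  exists t1 t2 t3 : R,
    ((0 <= t1 < 2 * PI)%R /\ (0 <= t2 < 2 * PI)%R /\ (0 <= t3 < 2 * PI)%R) /\
    (proj1_sig x = cis t1 /\ proj1_sig y = cis t2 /\ proj1_sig z = cis t3) /\
    ((t1 < t2 < t3)%R \/ (t2 < t3 < t1)%R \/ (t3 < t1 < t2)%R).

(** The multiplicative group of complex numbers of modulus 1, read in the
    additive language. *)
Definition unit_circle : structure :=
  {| carrier := circle;
     zero := exist _ (RtoC 1) Cmod_1;
     add := fun x y =>
       exist _ (Cmult (proj1_sig x) (proj1_sig y)) (circle_mul_subproof x y);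
     opp := fun x => exist _ (Cinv (proj1_sig x)) (circle_inv_subproof x);
     cyc := circle_cyc |}.

Definition c_archimedean (M : structure) : Prop :=
  cyclically_ordered_group M /\
  exists (H : unit_circle -> Prop) (HH : subgroup unit_circle H),
    isomorphic M (substructure unit_circle H HH).

(** * The c-regular groups *)

Fixpoint nmul {M : structure} (n : nat) (x : M) : M :=
  match n with
  | 0 => zero
  | S m => add x (nmul m x)
  end.

(** [R(x_1, ..., x_m)] for the list [x_1; ...; x_m], used only for [m >= 3]. *)
Definition cyc_list {M : structure} (l : list M) : Prop :=
  forall i j k, i < j -> j < k -> k < length l ->
    cyc (nth i l zero) (nth j l zero) (nth k l zero).

(** The list [l] is [x_1; ...; x_n], so that [x_1] and [x_n] are its entries
    of index [0] and [n - 1]. *)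
Definition c_n_regular (n : nat) (M : structure) : Prop :=
  forall l : list M, length l = n -> cyc_list (zero :: l) ->
    let x1 := nth 0 l zero in
    let xn := nth (n - 1) l zero in
    exists x : M,
      (nmul n x = x1 \/ nmul n x = xn \/ cyc x1 (nmul n x) xn) /\
      cyc_list (map (fun k => nmul k x) (seq 0 n) ++ [xn]).

Definition c_regular (M : structure) : Prop :=
  cyclically_ordered_group M /\ forall n, 2 <= n -> c_n_regular n M.

(* Main.v *)
From mathcomp Require choice.
From Stdlib Require Import Reals List FinFun ZArith Lia Lra Cantor.
From Stdlib Require Import Classical ClassicalEpsilon ProofIrrelevance.
From Stdlib Require Import FunctionalExtensionality PropExtensionality.
From Coquelicot Require Import Complex.
Require Import Defs.
Import ListNotations.
Set Bullet Behavior "Strict Subproofs".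

(** A cyclically ordered group M is U / Z z for an ordered abelian group U with
    a positive cofinal element z, and M is read off the interval [0, z) of U.
    If M is c-regular, then U is regular: either every n U is dense in U, or U
    has a least positive element e and U = n U + Z e for all n. In both cases
    a sentence true in M holds in some c-archimedean group A / Z, where
    Z <= A <= R. In the dense case M may be taken countable; then U embeds in R
    as a group, and A is its image, so that U and A differ only by their
    orders. In the discrete case A = (1/m) Z with m large and congruent to z
    modulo a large integer. The comparison is a back and forth on tuples that
    satisfy the same linear inequalities with bounded coefficients and that
    agree modulo D; a new element is found because cosets of D A meet all
    intervals that they should. *)

(** * Ordered abelian groups *)

(* Membership in an elementary class is decided one sentence at a time, so the approximating group
   may depend on the sentence. The price is uniformity: the bound [B] on coefficients and the
   modulus [D] have to be extracted from the sentence before the approximating group exists, since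
   in the discrete case [m] is chosen from them. Hence the back and forth is quantitative and speaks
   of all pairs of groups at once. The passage to [U] turns cyclic order into signs of integer
   combinations, and [z] joins every tuple as a parameter that accounts for winding. In the dense
   case [U] may be non-archimedean and then has no order embedding in the reals. But a dense regular
   group enters the comparison only through its quotients by [D U], the density of each [n U], and
   the sign of [z]; a group embedding with [z] sent to 1 preserves all of this. Countability makes
   the embedding available, because the rank of [U] could otherwise exceed that of the reals. *)
Declare Scope oag_scope.
Delimit Scope oag_scope with oag.

Record oag : Type := Oag {
  ocar :> Type;
  o0 : ocar;
  oadd : ocar -> ocar -> ocar;
  oopp : ocar -> ocar;
  olt : ocar -> ocar -> Prop;
  oaddA : forall a b c, oadd a (oadd b c) = oadd (oadd a b) c;
  oaddC : forall a b, oadd a b = oadd b a;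
  oadd0 : forall a, oadd a o0 = a;
  oaddN : forall a, oadd a (oopp a) = o0;
  olt_irr : forall a, ~ olt a a;
  olt_trans : forall a b c, olt a b -> olt b c -> olt a c;
  olt_total : forall a b, olt a b \/ a = b \/ olt b a;
  olt_add : forall a b c, olt a b -> olt (oadd a c) (oadd b c)
}.

Bind Scope oag_scope with ocar.
Arguments o0 {o}.
Arguments oadd {o} _ _.
Arguments oopp {o} _.
Arguments olt {o} _ _.

Definition ole {U : oag} (a b : U) : Prop := olt a b \/ a = b.

Definition osmul {U : oag} (n : Z) (x : U) : U :=
  match n with
  | Z0 => o0
  | Zpos p => Pos.iter_op oadd p x
  | Zneg p => oopp (Pos.iter_op oadd p x)
  end.

Notation "0" := o0 : oag_scope.
Infix "+" := oadd : oag_scope.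
Notation "- x" := (oopp x) : oag_scope.
Notation "x - y" := (oadd x (oopp y)) : oag_scope.
Infix "<" := olt : oag_scope.
Infix "<=" := ole : oag_scope.
Notation "n *: x" := (osmul n%Z x) (at level 40, left associativity) : oag_scope.

Section GroupLaws.
Variable U : oag.
Implicit Types (a b c x y : U) (m n : Z).
Local Open Scope oag_scope.

Lemma oadd0l x : 0 + x = x.
Proof. now rewrite oaddC, oadd0. Qed.

Lemma oaddNl x : - x + x = 0.
Proof. now rewrite oaddC, oaddN. Qed.

Lemma oadd_cancel x a b : a + x = b + x -> a = b.
Proof.
  intros H. rewrite <- (oadd0 U a), <- (oadd0 U b), <- (oaddN U x).
  now rewrite !oaddA, H.
Qed.

Lemma oopp_unique a b : a + b = 0 -> b = - a.
Proof. intros H. apply (oadd_cancel a). now rewrite oaddNl, oaddC. Qed.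

Lemma oaddACA a b c x : (a + b) + (c + x) = (a + c) + (b + x).
Proof. rewrite <- !oaddA. f_equal. rewrite !oaddA. f_equal. apply oaddC. Qed.

Lemma ooppD a b : - (a + b) = - a + - b.
Proof. symmetry. apply oopp_unique. now rewrite oaddACA, !oaddN, oadd0. Qed.

Lemma oopp0 : - (0 : U) = 0.
Proof. symmetry. apply oopp_unique. apply oadd0. Qed.

Lemma ooppK a : - - a = a.
Proof. symmetry. apply oopp_unique. apply oaddNl. Qed.

Lemma osmul0l x : 0 *: x = 0.
Proof. reflexivity. Qed.

Lemma osmul_succ n x : Z.succ n *: x = n *: x + x.
Proof.
  assert (S : forall p, Pos.iter_op oadd (Pos.succ p) x = Pos.iter_op oadd p x + x).
  { intros p. rewrite Pos.iter_op_succ by apply oaddA. apply oaddC. }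
  destruct n as [|p|p].
  - symmetry. apply oadd0l.
  - change (Z.succ (Z.pos p)) with (Z.pos (p + 1)). rewrite Pos.add_1_r. apply S.
  - destruct (Pos.eq_dec p 1) as [->|H].
    + symmetry. apply oaddNl.
    + assert (E : p = Pos.succ (Pos.pred p)) by (symmetry; now apply Pos.succ_pred).
      set (q := Pos.pred p) in *. clearbody q. subst p.
      replace (Z.succ (Z.neg (Pos.succ q))) with (Z.neg q) by lia.
      simpl. rewrite S, ooppD, <- oaddA, oaddNl. symmetry. apply oadd0.
Qed.

Lemma osmul_pred n x : Z.pred n *: x = n *: x - x.
Proof.
  apply (oadd_cancel x). rewrite <- osmul_succ, Z.succ_pred.
  now rewrite <- oaddA, oaddNl, oadd0.
Qed.

Lemma osmulDl m n x : (m + n) *: x = m *: x + n *: x.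
Proof.
  revert n. apply Z.peano_ind.
  - now rewrite Z.add_0_r, osmul0l, oadd0.
  - intros n IH. now rewrite Z.add_succ_r, !osmul_succ, IH, oaddA.
  - intros n IH. now rewrite Z.add_pred_r, !osmul_pred, IH, oaddA.
Qed.

Lemma osmulNl n x : (- n) *: x = - (n *: x).
Proof. apply oopp_unique. rewrite <- osmulDl, Z.add_opp_diag_r. reflexivity. Qed.

Lemma osmulDr n x y : n *: (x + y) = n *: x + n *: y.
Proof.
  revert n. apply Z.peano_ind.
  - symmetry. apply oadd0.
  - intros n IH. now rewrite !osmul_succ, IH, oaddACA.
  - intros n IH. now rewrite !osmul_pred, IH, ooppD, oaddACA.
Qed.

Lemma osmul0r n : n *: (0 : U) = 0.
Proof. apply (oadd_cancel (n *: 0)). now rewrite <- osmulDr, oadd0l, oadd0l. Qed.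

Lemma osmulNr n x : n *: (- x) = - (n *: x).
Proof. apply oopp_unique. rewrite <- osmulDr, oaddN. apply osmul0r. Qed.

Lemma osmulA m n x : m *: (n *: x) = (m * n) *: x.
Proof.
  revert m. apply Z.peano_ind.
  - reflexivity.
  - intros m IH. now rewrite Z.mul_succ_l, osmulDl, osmul_succ, IH.
  - intros m IH. rewrite Z.mul_pred_l, osmul_pred, IH.
    unfold Z.sub. now rewrite osmulDl, osmulNl.
Qed.

End GroupLaws.

(* Linear identities between elements of an ordered abelian group are
   reduced by reflection to one identity in Z per atom. *)
Inductive mexp : Type :=
| MVar (i : nat)
| MZero
| MAdd (s t : mexp)
| MOpp (t : mexp)
| MScale (n : Z) (t : mexp).

Section Reflection.
Variable U : oag.
Local Open Scope oag_scope.

Fixpoint mden (env : list U) (e : mexp) : U :=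
  match e with
  | MVar i => nth i env 0
  | MZero => 0
  | MAdd s t => mden env s + mden env t
  | MOpp t => - mden env t
  | MScale n t => n *: mden env t
  end.

Fixpoint mcoef (e : mexp) (i : nat) : Z :=
  match e with
  | MVar j => if Nat.eqb i j then 1%Z else 0%Z
  | MZero => 0%Z
  | MAdd s t => (mcoef s i + mcoef t i)%Z
  | MOpp t => (- mcoef t i)%Z
  | MScale n t => (n * mcoef t i)%Z
  end.

Fixpoint msum (f : nat -> Z) (env : list U) : U :=
  match env with
  | [] => 0
  | x :: env => f O *: x + msum (fun i => f (S i)) env
  end.

Lemma msum_ext f g env : (forall i, (i < length env)%nat -> f i = g i) ->
  msum f env = msum g env.
Proof.
  revert f g. induction env as [|x env IH]; intros f g H; simpl; [reflexivity|].
  rewrite H by (simpl; lia). f_equal. apply IH. intros i Hi. apply H. simpl. lia.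
Qed.

Lemma msum0 env : msum (fun _ => 0%Z) env = 0.
Proof. induction env as [|x env IH]; simpl; [reflexivity|]. now rewrite IH, oadd0. Qed.

Lemma msumD f g env : msum (fun i => (f i + g i)%Z) env = msum f env + msum g env.
Proof.
  revert f g. induction env as [|x env IH]; intros f g; simpl.
  - symmetry. apply oadd0.
  - now rewrite (IH (fun i => f (S i))), osmulDl, oaddACA.
Qed.

Lemma msumN f env : msum (fun i => (- f i)%Z) env = - msum f env.
Proof.
  revert f. induction env as [|x env IH]; intros f; simpl.
  - symmetry. apply oopp0.
  - now rewrite (IH (fun i => f (S i))), osmulNl, ooppD.
Qed.

Lemma msumZ n f env : msum (fun i => (n * f i)%Z) env = n *: msum f env.
Proof.
  revert f. induction env as [|x env IH]; intros f; simpl.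
  - symmetry. apply osmul0r.
  - now rewrite (IH (fun i => f (S i))), osmulDr, osmulA.
Qed.

Lemma mden_msum env e : mden env e = msum (mcoef e) env.
Proof.
  induction e as [j| |s IHs t IHt|t IHt|n t IHt]; cbn [mden mcoef].
  - change (nth j env 0 = msum (fun i => if Nat.eqb i j then 1%Z else 0%Z) env).
    revert j. induction env as [|x env IH]; intros [|j]; simpl; try reflexivity.
    + rewrite msum0. symmetry. apply oadd0.
    + rewrite <- IH. symmetry. apply oadd0l.
  - symmetry. apply (msum0 env).
  - rewrite IHs, IHt. symmetry. apply (msumD (mcoef s) (mcoef t)).
  - rewrite IHt. symmetry. apply (msumN (mcoef t)).
  - rewrite IHt. symmetry. apply (msumZ n (mcoef t)).
Qed.

Fixpoint coefs_eq (s t : mexp) (k : nat) : Prop :=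
  match k with
  | O => True
  | S k => mcoef s k = mcoef t k /\ coefs_eq s t k
  end.

Lemma mden_eq env s t : coefs_eq s t (length env) -> mden env s = mden env t.
Proof.
  intros H. rewrite !mden_msum. apply msum_ext. revert H.
  generalize (length env). intros k. induction k as [|k IH]; intros H i Hi; [lia|].
  destruct H as [H1 H2]. destruct (Nat.eq_dec i k) as [->|Hn]; [exact H1|].
  apply IH; [exact H2|lia].
Qed.

End Reflection.

Ltac oag_mem x l :=
  lazymatch l with
  | nil => constr:(false)
  | x :: _ => constr:(true)
  | _ :: ?r => oag_mem x r
  end.

Ltac oag_atoms e l :=
  lazymatch e with
  | o0 => l
  | oadd ?a ?b => let l := oag_atoms a l in oag_atoms b l
  | oopp ?a => oag_atoms a l
  | osmul _ ?a => oag_atoms a l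
  | _ => lazymatch oag_mem e l with true => l | false => constr:(e :: l) end
  end.

Ltac oag_index x l :=
  lazymatch l with
  | x :: _ => constr:(O)
  | _ :: ?r => let i := oag_index x r in constr:(S i)
  end.

Ltac oag_reify e l :=
  lazymatch e with
  | o0 => constr:(MZero)
  | oadd ?a ?b => let s := oag_reify a l in let t := oag_reify b l in constr:(MAdd s t)
  | oopp ?a => let s := oag_reify a l in constr:(MOpp s)
  | osmul ?n ?a => let s := oag_reify a l in constr:(MScale n s)
  | _ => let i := oag_index e l in constr:(MVar i)
  end.

Ltac omod :=
  lazymatch goal with
  | |- @eq _ ?a ?b =>
    let U := lazymatch type of a with ocar ?U => U end in
    let l := oag_atoms a (@nil U) in
    let l := oag_atoms b l in
    let s := oag_reify a l in
    let t := oag_reify b l in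
    change (mden U l s = mden U l t);
    apply mden_eq;
    cbn [length coefs_eq mcoef Nat.eqb];
    repeat split; try ring
  end.

(** * Order and multiples in an ordered abelian group *)

Section OrderLaws.
Variable U : oag.
Implicit Types (a b c d x y : U) (m n : Z).
Local Open Scope oag_scope.

(** The side equation says [y - x = b - a]. Linear inequalities are proved throughout by supplying a
    combination [a < b] of hypotheses and leaving this equation to [omod]. *)
Lemma olt_of a b x y : a < b -> y + a = x + b -> x < y.
Proof.
  intros H E. apply (olt_add _ _ _ (x - a)) in H.
  replace (a + (x - a)) with x in H by omod.
  replace (b + (x - a)) with y in H; [exact H|].
  apply (oadd_cancel _ a). rewrite E. omod.
Qed.

Lemma ole_of a b x y : a <= b -> y + a = x + b -> x <= y.
Proof.
  intros [H| ->] E; [left; now apply (olt_of a b)|right].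
  symmetry. now apply (oadd_cancel _ b).
Qed.

Lemma ole_refl a : a <= a.
Proof. now right. Qed.

Lemma ole_lt_trans a b c : a <= b -> b < c -> a < c.
Proof. intros [H| ->] K; [now apply (olt_trans _ a b)|exact K]. Qed.

Lemma olt_le_trans a b c : a < b -> b <= c -> a < c.
Proof. intros H [K|<-]; [now apply (olt_trans _ a b)|exact H]. Qed.

Lemma ole_trans a b c : a <= b -> b <= c -> a <= c.
Proof. intros [H| ->] K; [left; now apply (olt_le_trans a b)|exact K]. Qed.

Lemma olt_not_le a b : a < b -> ~ b <= a.
Proof. intros H K. apply (olt_irr _ a). now apply (olt_le_trans a b). Qed.

Lemma olt_asym a b : a < b -> ~ b < a.
Proof. intros H K. apply (olt_not_le _ _ H). now left. Qed.

Lemma olt_ne a b : a < b -> a <> b.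
Proof. intros H ->. exact (olt_irr _ _ H). Qed.

Lemma ole_or_lt a b : a <= b \/ b < a.
Proof. destruct (olt_total _ a b) as [H|[H|H]]; [left; now left|left; now right|now right]. Qed.

Lemma onot_lt a b : ~ a < b -> b <= a.
Proof. intros H. destruct (ole_or_lt b a); tauto. Qed.

Lemma ole_antisym a b : a <= b -> b <= a -> a = b.
Proof. intros [H|H] K; [|exact H]. destruct (olt_not_le _ _ H K). Qed.

Lemma olt_add2 a b c d : a < b -> c < d -> a + c < b + d.
Proof.
  intros H K. apply (olt_trans _ _ (b + c)).
  - now apply olt_add.
  - rewrite !(oaddC _ b). now apply olt_add.
Qed.

Lemma ole_add2 a b c d : a <= b -> c <= d -> a + c <= b + d.
Proof.
  intros [H| ->] [K| ->]; [left; now apply olt_add2| | |apply ole_refl]; left.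
  - now apply olt_add.
  - rewrite !(oaddC _ b). now apply olt_add.
Qed.

Lemma olt_le_add2 a b c d : a < b -> c <= d -> a + c < b + d.
Proof. intros H [K| ->]; [now apply olt_add2|now apply olt_add]. Qed.

Lemma osmul_pos n x : (0 < n)%Z -> 0 < x -> 0 < n *: x.
Proof.
  intros Hn Hx. replace n with (Z.of_nat (Z.to_nat n)) in * by lia.
  revert Hn. generalize (Z.to_nat n). intros k. induction k as [|k IH]; intros Hk; [lia|].
  rewrite Nat2Z.inj_succ, osmul_succ. destruct k as [|k].
  - simpl. now rewrite oadd0l.
  - rewrite <- (oadd0 _ 0). apply olt_add2; [apply IH; lia|exact Hx].
Qed.

Lemma osmul_lt n a b : (0 < n)%Z -> a < b -> n *: a < n *: b.
Proof.
  intros Hn H. apply (olt_of 0 (n *: (b - a))); [|omod].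
  apply osmul_pos; [exact Hn|]. apply (olt_of _ _ _ _ H). omod.
Qed.

Lemma osmul_le n a b : (0 <= n)%Z -> a <= b -> n *: a <= n *: b.
Proof.
  intros Hn [H| ->]; [|apply ole_refl].
  destruct (Z.eq_dec n 0) as [->|Hn']; [now right|].
  left. apply osmul_lt; [lia|exact H].
Qed.

Lemma osmul_lt_inv n a b : (0 < n)%Z -> n *: a < n *: b -> a < b.
Proof.
  intros Hn H. destruct (ole_or_lt b a) as [K|K]; [|exact K].
  destruct (olt_not_le _ _ H). apply osmul_le; [lia|exact K].
Qed.

Lemma osmul_le_inv n a b : (0 < n)%Z -> n *: a <= n *: b -> a <= b.
Proof.
  intros Hn H. destruct (ole_or_lt a b) as [K|K]; [exact K|].
  destruct (olt_not_le (n *: b) (n *: a)); [|exact H]. now apply osmul_lt.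
Qed.

Lemma osmul_inj n a b : (n <> 0)%Z -> n *: a = n *: b -> a = b.
Proof.
  assert (P : forall n, (0 < n)%Z -> n *: a = n *: b -> a = b).
  { intros k Hk H. apply ole_antisym; apply (osmul_le_inv k); try exact Hk; right; auto. }
  intros Hn H. destruct (Z.lt_ge_cases 0 n); [now apply (P n)|].
  apply (P (- n)%Z); [lia|]. now rewrite !osmulNl, H.
Qed.

Lemma osmul_le_l m n x : 0 <= x -> (m <= n)%Z -> m *: x <= n *: x.
Proof.
  intros Hx H. apply (ole_of ((n - m) *: 0) ((n - m) *: x)); [|omod].
  apply osmul_le; [lia|exact Hx].
Qed.

Lemma osmul_lt_l m n x : 0 < x -> (m < n)%Z -> m *: x < n *: x.
Proof.
  intros Hx H. apply (olt_of 0 ((n - m) *: x)); [|omod].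
  apply osmul_pos; [lia|exact Hx].
Qed.

Lemma osmul_lt_l_inv m n x : 0 < x -> m *: x < n *: x -> (m < n)%Z.
Proof.
  intros Hx H. destruct (Z.lt_ge_cases m n) as [K|K]; [exact K|].
  destruct (olt_not_le _ _ H). apply osmul_le_l; [now left|exact K].
Qed.

Lemma oopp_pos x : x < 0 <-> 0 < - x.
Proof. split; intros H; apply (olt_of _ _ _ _ H); omod. Qed.

Lemma osub_pos a b : 0 < b - a <-> a < b.
Proof. split; intros H; apply (olt_of _ _ _ _ H); omod. Qed.

End OrderLaws.

Arguments olt_of {U} [a b x y] _ _.
Arguments ole_of {U} [a b x y] _ _.
Arguments ole_refl {U} a.
Arguments ole_lt_trans {U} [a b c] _ _.
Arguments olt_le_trans {U} [a b c] _ _.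
Arguments ole_trans {U} [a b c] _ _.
Arguments olt_not_le {U} [a b] _ _.
Arguments olt_asym {U} [a b] _ _.
Arguments olt_ne {U} [a b] _ _.
Arguments ole_or_lt {U} a b.
Arguments onot_lt {U} [a b] _.
Arguments ole_antisym {U} [a b] _ _.
Arguments olt_add2 {U} [a b c d] _ _.
Arguments ole_add2 {U} [a b c d] _ _.
Arguments olt_le_add2 {U} [a b c d] _ _.
Arguments osmul_pos {U} [n x] _ _.
Arguments osmul_lt {U} n [a b] _ _.
Arguments osmul_le {U} n [a b] _ _.
Arguments osmul_lt_inv {U} n [a b] _ _.
Arguments osmul_le_inv {U} n [a b] _ _.
Arguments osmul_inj {U} n [a b] _ _.
Arguments osmul_le_l {U} [m n x] _ _.
Arguments osmul_lt_l {U} [m n x] _ _.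
Arguments osmul_lt_l_inv {U} [m n x] _ _.

(** * Cyclically ordered groups as wound-round ordered groups *)

Definition cyclic_pattern {U : oag} (a b c : U) : Prop :=
  ((a < b /\ b < c) \/ (b < c /\ c < a) \/ (c < a /\ a < b))%oag.

(* [p] identifies [M] with [U / Z z], the interval [0, z) being a set of
   representatives from which the cyclic order is read. *)
Record cover (U : oag) (z : U) (M : structure) (p : U -> M) : Prop := Cover {
  cov_pos : (0 < z)%oag;
  cov_0 : p 0%oag = zero;
  cov_add : forall a b, p (a + b)%oag = add (p a) (p b);
  cov_opp : forall a, p (- a)%oag = opp (p a);
  cov_ker : forall a b, p a = p b <-> exists q : Z, (a = b + q *: z)%oag;
  cov_surj : forall m, exists a, (0 <= a)%oag /\ (a < z)%oag /\ p a = m;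
  cov_cyc : forall a b c, (0 <= a)%oag -> (a < z)%oag -> (0 <= b)%oag ->
    (b < z)%oag -> (0 <= c)%oag -> (c < z)%oag ->
    (cyc (p a) (p b) (p c) <-> cyclic_pattern a b c)
}.

Ltac osat :=
  repeat match goal with
  | H : olt ?a ?b, K : olt ?b ?c |- _ =>
    lazymatch goal with
    | _ : olt a c |- _ => fail
    | _ => assert (olt a c) by exact (olt_trans _ _ _ _ H K)
    end
  end;
  try match goal with H : olt ?a ?a |- _ => destruct (olt_irr _ _ H) end.

Section CoverTheory.
Variables (U : oag) (z : U) (M : structure) (p : U -> M).
Hypothesis CV : cover U z M p.
Implicit Types (a b c : U).
Local Open Scope oag_scope.

Lemma cov_inj a b : 0 <= a -> a < z -> 0 <= b -> b < z -> p a = p b -> a = b.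
Proof.
  intros Ha Haz Hb Hbz H. apply (cov_ker _ _ _ _ CV) in H. destruct H as [q Hq].
  pose proof (cov_pos _ _ _ _ CV) as Hz.
  assert (H1 : q *: z < 1 *: z).
  { apply (olt_of (olt_le_add2 Haz Hb)). rewrite Hq. omod. }
  assert (H2 : (- 1) *: z < q *: z).
  { apply (olt_of (olt_le_add2 Hbz Ha)). rewrite Hq. omod. }
  apply osmul_lt_l_inv in H1; [|exact Hz]. apply osmul_lt_l_inv in H2; [|exact Hz].
  assert (q = 0%Z) by lia. subst q. rewrite Hq. omod.
Qed.

Lemma cov_period a : p (a - z) = p a.
Proof. apply (cov_ker _ _ _ _ CV). exists (-1)%Z. omod. Qed.

Lemma cov_nmul n a : nmul n (p a) = p (Z.of_nat n *: a).
Proof.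
  induction n as [|n IH].
  - symmetry. apply (cov_0 _ _ _ _ CV).
  - rewrite Nat2Z.inj_succ. cbn [nmul]. rewrite IH, <- (cov_add _ _ _ _ CV).
    f_equal. rewrite osmul_succ. apply oaddC.
Qed.

Lemma cov_rep a : exists q : Z, 0 <= a - q *: z /\ a - q *: z < z.
Proof.
  destruct (cov_surj _ _ _ _ CV (p a)) as [b [H1 [H2 H3]]].
  symmetry in H3. apply (cov_ker _ _ _ _ CV) in H3. destruct H3 as [q ->].
  exists q. replace (b + q *: z - q *: z) with b by omod. now split.
Qed.


Definition translate (u a a' : U) : Prop :=
  0 <= a /\ a < z /\ 0 <= a' /\ a' < z /\ (a' = a + u \/ a' = a + u - z).

Lemma cov_translate u a : 0 <= u -> u < z -> 0 <= a -> a < z ->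
  exists a', translate u a a' /\ p a' = add (p a) (p u).
Proof.
  intros Hu Huz Ha Haz. rewrite <- (cov_add _ _ _ _ CV).
  destruct (ole_or_lt z (a + u)) as [H|H].
  - exists (a + u - z). split; [|apply cov_period]. repeat split; auto.
    + apply (ole_of H). omod.
    + apply (olt_of (olt_add2 Haz Huz)). omod.
  - exists (a + u). split; [|reflexivity]. repeat split; auto.
    apply (ole_of (ole_add2 Ha Hu)). omod.
Qed.

(* The elements of [0, z) that wrap round under a translation are the
   largest ones, so the translation rotates increasing triples. *)
Lemma translate_increasing u a b c a' b' c' : a < b -> b < c ->
  translate u a a' -> translate u b b' -> translate u c c' ->
  cyclic_pattern a' b' c'.
Proof.
  assert (NN : forall x y, x < y -> x + u < y + u) by (intros; now apply olt_add).
  assert (NW : forall x y, 0 <= x -> y < z -> y + u - z < x + u).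
  { intros x y Hx Hy. apply (olt_of (olt_le_add2 Hy Hx)). omod. }
  assert (WN : forall x y, x < y -> 0 <= x + u - z -> y + u < z -> False).
  { intros x y H H1 H2. apply (olt_irr U z).
    apply (olt_of (olt_le_add2 (olt_add2 H H2) H1)). omod. }
  assert (WW : forall x y, x < y -> x + u - z < y + u - z).
  { intros x y H. apply (olt_of H). omod. }
  intros Hab Hbc [A1 [A2 [A3 [A4 A5]]]] [B1 [B2 [B3 [B4 B5]]]] [C1 [C2 [C3 [C4 C5]]]].
  unfold cyclic_pattern.
  (* [WN] refutes the four cases in which an element wraps and a larger one does not. The four that
     remain are: none wraps, only [c], then [b] and [c], and all three. *)
  destruct A5 as [-> | ->], B5 as [-> | ->], C5 as [-> | ->];
    try (exfalso; eauto; fail);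
    [left|right; right|right; left|left]; split; auto.
Qed.

Lemma cyclic_pattern_rotate a b c : cyclic_pattern a b c -> cyclic_pattern b c a.
Proof. unfold cyclic_pattern. tauto. Qed.

Lemma translate_cyclic u a b c a' b' c' : cyclic_pattern a b c ->
  translate u a a' -> translate u b b' -> translate u c c' ->
  cyclic_pattern a' b' c'.
Proof.
  intros [[H K]|[[H K]|[H K]]] A B C.
  - now apply (translate_increasing u a b c).
  - apply cyclic_pattern_rotate, cyclic_pattern_rotate.
    now apply (translate_increasing u b c a).
  - apply cyclic_pattern_rotate. now apply (translate_increasing u c a b).
Qed.

Ltac reps :=
  repeat match goal with
  | x : carrier M |- _ =>
    let r := fresh "r" in let H1 := fresh "H" in let H2 := fresh "H" in
    destruct (cov_surj _ _ _ _ CV x) as [r [H1 [H2 <-]]]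
  end.

Lemma cover_abelian_group : abelian_group M.
Proof.
  repeat split.
  - intros a b c. reps. rewrite <- !(cov_add _ _ _ _ CV). f_equal. apply oaddA.
  - intros a b. reps. rewrite <- !(cov_add _ _ _ _ CV). f_equal. apply oaddC.
  - intros a. reps. rewrite <- (cov_0 _ _ _ _ CV), <- (cov_add _ _ _ _ CV).
    f_equal. apply oadd0.
  - intros a. reps. rewrite <- (cov_0 _ _ _ _ CV), <- (cov_opp _ _ _ _ CV), <- (cov_add _ _ _ _ CV).
    f_equal. apply oaddN.
Qed.

(** Transports the axioms from the interval of representatives, so that they need not be verified on
    complex numbers for the subgroups of the circle. *)
Lemma cover_cyclically_ordered_group : cyclically_ordered_group M.
Proof.
  pose proof (cov_cyc _ _ _ _ CV) as CC.
  split; [exact cover_abelian_group|].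
  split; [|split; [|split; [intros c; split; [|split]|]]].
  - intros a b c. reps. rewrite CC by assumption. unfold cyclic_pattern.
    intros [[L1 L2]|[[L1 L2]|[L1 L2]]]; osat; repeat split; intros E;
      apply cov_inj in E; try assumption; subst; osat.
  - intros a b c. reps. rewrite !CC by assumption. apply cyclic_pattern_rotate.
  - intros a Ha. reps. rewrite CC by assumption.
    intros [[L1 L2]|[[L1 L2]|[L1 L2]]]; osat.
  - intros a b d _ _ _. reps. rewrite !CC by assumption. unfold cyclic_pattern.
    intros [[L1 L2]|[[L1 L2]|[L1 L2]]] [[L3 L4]|[[L3 L4]|[L3 L4]]]; osat; tauto.
  - intros a b. reps. rewrite !CC by assumption. intros Ha Hb Hab.
    match type of Hab with p ?a <> p ?b => match type of Ha with _ <> p ?c =>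
      destruct (olt_total U a b) as [?|[?|?]];
      destruct (olt_total U a c) as [?|[?|?]];
      destruct (olt_total U b c) as [?|[?|?]]; try congruence
    end end; unfold cyclic_pattern; tauto.
  - intros a b c u. reps. rewrite CC by assumption. intros Hp.
    match goal with |- cyc (add (p ?a) (p ?u)) (add (p ?b) _) (add (p ?c) _) =>
      destruct (cov_translate u a) as [a' [Ta <-]]; auto;
      destruct (cov_translate u b) as [b' [Tb <-]]; auto;
      destruct (cov_translate u c) as [c' [Tc <-]]; auto;
      pose proof (translate_cyclic _ _ _ _ _ _ _ Hp Ta Tb Tc) as Hp'
    end.
    unfold translate in *. apply CC; tauto.
Qed.

End CoverTheory.

(** * The unwound group of a cyclically ordered group *)

Section Unwinding.
Variable M : structure.
Hypothesis COG : cyclically_ordered_group M.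
Implicit Types (a b c q r s x y : M).

(** The circle cut open at [zero]: a linear order on all of [M] with [zero] as its least element. *)
Definition clt a b : Prop := (a = zero /\ b <> zero) \/ cyc zero a b.

Lemma cog_addA a b c : add a (add b c) = add (add a b) c.
Proof. apply COG. Qed.
Lemma cog_addC a b : add a b = add b a.
Proof. apply COG. Qed.
Lemma cog_add0 a : add a zero = a.
Proof. apply COG. Qed.
Lemma cog_addN a : add a (opp a) = zero.
Proof. apply COG. Qed.
Lemma cog_add0l a : add zero a = a.
Proof. now rewrite cog_addC, cog_add0. Qed.
Lemma cog_addKN a b : add (add a b) (opp b) = a.
Proof. now rewrite <- cog_addA, cog_addN, cog_add0. Qed.
Lemma cog_add_cancel a b c : add a c = add b c -> a = b.
Proof. intros H. now rewrite <- (cog_addKN a c), H, cog_addKN. Qed.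

Lemma cog_ne a b c : cyc a b c -> a <> b /\ b <> c /\ a <> c.
Proof. apply COG. Qed.
Lemma cog_rot a b c : cyc a b c -> cyc b c a.
Proof. apply COG. Qed.
Lemma cog_shift u a b c : cyc a b c -> cyc (add a u) (add b u) (add c u).
Proof. apply COG. Qed.
Lemma cog_trans c a b x : cyc c a b -> cyc c b x -> cyc c a x.
Proof.
  intros H K. destruct COG as [_ [_ [_ [L _]]]]. destruct (L c) as [_ [T _]].
  apply cog_ne in H as H'. apply cog_ne in K as K'.
  apply (T a b x); intuition congruence.
Qed.
Lemma cog_total c a b : a <> c -> b <> c -> a <> b -> cyc c a b \/ cyc c b a.
Proof. destruct COG as [_ [_ [_ [L _]]]]. apply (L c). Qed.
Lemma cog_asym a b c : cyc a b c -> ~ cyc a c b.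
Proof. intros H K. pose proof (cog_trans _ _ _ _ H K) as E. apply cog_ne in E. tauto. Qed.

Lemma clt_irr a : ~ clt a a.
Proof. intros [[? ?]|H]; [tauto|]. apply cog_ne in H. tauto. Qed.

Lemma clt_trans a b c : clt a b -> clt b c -> clt a c.
Proof.
  intros [[-> H]|H] [[-> K]|K]; unfold clt.
  - tauto.
  - apply cog_ne in K. left. split; auto. intuition congruence.
  - apply cog_ne in H. tauto.
  - right. now apply (cog_trans _ a b).
Qed.

Lemma clt_total a b : clt a b \/ a = b \/ clt b a.
Proof.
  unfold clt. destruct (classic (a = b)) as [|N]; [tauto|].
  destruct (classic (a = zero)) as [->|Na]; [left; left; split; auto|].
  destruct (classic (b = zero)) as [->|Nb]; [right; right; left; split; auto|].
  destruct (cog_total zero a b); auto.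
Qed.

Lemma clt_asym a b : clt a b -> ~ clt b a.
Proof. intros H K. exact (clt_irr _ (clt_trans _ _ _ H K)). Qed.

Lemma clt_zero a : ~ clt a zero.
Proof. intros [[? ?]|H]; [tauto|]. apply cog_ne in H. tauto. Qed.

Lemma clt_chain_cyc a b c : clt a b -> clt b c -> cyc a b c.
Proof.
  intros [[-> H]|H] [[-> K]|K]; auto.
  - tauto.
  - apply cog_ne in H. tauto.
  - apply cog_rot, cog_rot. apply (cog_trans _ _ zero).
    + now apply cog_rot.
    + apply cog_rot, cog_rot in H. exact H.
Qed.

Lemma cyc_clt a b c : cyc a b c <->
  (clt a b /\ clt b c) \/ (clt b c /\ clt c a) \/ (clt c a /\ clt a b).
Proof.
  split.
  - intros H. pose proof (cog_ne _ _ _ H) as N.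
    assert (A : ~ (clt a c /\ clt c b)).
    { intros [K1 K2]. apply (cog_asym _ _ _ H). now apply clt_chain_cyc. }
    assert (B : ~ (clt c b /\ clt b a)).
    { intros [K1 K2]. apply (cog_asym _ _ _ H). apply cog_rot, cog_rot. now apply clt_chain_cyc. }
    assert (C : ~ (clt b a /\ clt a c)).
    { intros [K1 K2]. apply (cog_asym _ _ _ H). apply cog_rot. now apply clt_chain_cyc. }
    destruct (clt_total a b) as [?|[?|?]], (clt_total b c) as [?|[?|?]], (clt_total a c) as [?|[?|?]];
      tauto.
  - intros [[H K]|[[H K]|[H K]]].
    + now apply clt_chain_cyc.
    + apply cog_rot, cog_rot. now apply clt_chain_cyc.
    + apply cog_rot. now apply clt_chain_cyc.
Qed.

(** Whether a sum passes [zero] can be read off from either summand. Otherwise [b < s < a] for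
    [s = a + b]; translating [0, s, a] by [-a] and [0, b, s] by [-b] yields the cyclic order
    [0, -a, -b], and translating this by [s] gives [s, b, a], against [s, a, b]. *)
Lemma clt_add_sym a b : clt (add a b) a -> clt (add a b) b.
Proof.
  intros H. destruct (clt_total (add a b) b) as [K|[K|K]]; [exact K|exfalso..].
  - assert (a = zero) by (apply (cog_add_cancel _ _ b); now rewrite K, cog_add0l).
    subst a. exact (clt_zero _ H).
  - remember (add a b) as s eqn:E.
    assert (Hb : b <> zero) by (intros ->; rewrite cog_add0 in E; subst s; exact (clt_irr _ H)).
    assert (H1 : cyc zero b s) by (destruct K as [[? ?]|K]; tauto).
    assert (Hs : s <> zero) by (apply cog_ne in H1; intuition congruence).
    assert (H2 : cyc zero s a) by (destruct H as [[? ?]|H]; tauto).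
    assert (Hba : cyc s a b) by (apply cog_rot, clt_chain_cyc; assumption).
    assert (E1 : cyc (opp a) b zero).
    { apply (cog_shift (opp a)) in H2. rewrite cog_add0l, cog_addN in H2.
      rewrite E, (cog_addC a b), cog_addKN in H2. exact H2. }
    assert (E2 : cyc (opp b) zero a).
    { apply (cog_shift (opp b)) in H1. rewrite cog_add0l, cog_addN in H1.
      rewrite E, cog_addKN in H1. exact H1. }
    assert (E3 : cyc zero (opp a) (opp b)).
    { apply (cog_trans _ _ a); [|now apply cog_rot].
      apply (cog_trans _ _ b); [now apply cog_rot, cog_rot|].
      now apply (cog_trans _ _ s). }
    apply (cog_shift s) in E3. rewrite cog_add0l in E3.
    rewrite (cog_addC (opp a)), (cog_addC (opp b)), E, cog_addKN in E3.
    rewrite (cog_addC a b), cog_addKN, (cog_addC b a), <- E in E3.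
    exact (cog_asym _ _ _ Hba E3).
Qed.

(* The carry of a sum of two representatives in the interval [0, z). *)
Definition carry a b : Z :=
  if excluded_middle_informative (clt (add a b) a) then 1%Z else 0%Z.

Lemma carry_cases a b :
  (carry a b = 1%Z /\ clt (add a b) a /\ clt (add a b) b) \/
  (carry a b = 0%Z /\ ~ clt (add a b) a /\ ~ clt (add a b) b).
Proof.
  unfold carry. destruct (excluded_middle_informative _) as [H|H].
  - left. repeat split; auto. now apply clt_add_sym.
  - right. repeat split; auto. intros K. apply H. rewrite cog_addC in K |- *.
    now apply clt_add_sym.
Qed.

Lemma carryC a b : carry a b = carry b a.
Proof.
  pose proof (carry_cases a b) as H. pose proof (carry_cases b a) as K.
  rewrite (cog_addC b a) in K. intuition congruence.
Qed.

Lemma carry0r a : carry a zero = 0%Z.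
Proof.
  destruct (carry_cases a zero) as [[_ [_ H]]|[H _]]; [|exact H].
  now apply clt_zero in H.
Qed.

Lemma carry0l a : carry zero a = 0%Z.
Proof. now rewrite carryC, carry0r. Qed.

(** Translation turns the cyclic triple [0, x, y] into [c, x + c, y + c]. Its three linear readings
    say that neither sum passes [zero], only the one from [y], or both. *)
Lemma carry_mono x y c : clt x y ->
  (carry x c = carry y c /\ clt (add x c) (add y c)) \/
  (carry x c = 0%Z /\ carry y c = 1%Z /\ clt (add y c) (add x c)).
Proof.
  intros H.
  assert (N : y <> x) by (intros ->; exact (clt_irr _ H)).
  destruct (classic (x = zero)) as [->|Nx].
  - rewrite cog_add0l, carry0l.
    destruct (carry_cases y c) as [[E [_ K]]|[E [_ K]]]; rewrite E; [tauto|].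
    left. split; auto. destruct (clt_total (add y c) c) as [L|[L|L]]; [tauto| |exact L].
    destruct N. apply (cog_add_cancel _ _ c). now rewrite cog_add0l.
  - assert (T : cyc zero x y) by (destruct H as [[? ?]|H]; tauto).
    apply (cog_shift c) in T. rewrite cog_add0l in T. apply cyc_clt in T.
    destruct (carry_cases x c) as [[Ex [_ Kx]]|[Ex [_ Kx]]], (carry_cases y c) as [[Ey [_ Ky]]|[Ey [_ Ky]]];
      rewrite Ex, Ey; destruct T as [[T1 T2]|[[T1 T2]|[T1 T2]]]; try tauto;
      try (right; repeat split; eapply clt_trans; eassumption);
      exfalso; eauto using clt_trans.
    all: match goal with H : clt ?a ?b, K : clt ?b ?a |- _ => exact (clt_asym _ _ H K) end.
Qed.

(** The 2-cocycle identity, which is the associativity of the extension of [M] by Z. The proof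
    compares [b] with [b + a] and applies [carry_mono] to their translates by [c]. *)
Lemma carryA a b c :
  (carry a b + carry (add a b) c = carry b c + carry a (add b c))%Z.
Proof.
  rewrite (cog_addC a b), (carryC a b), (carryC a (add b c)).
  assert (E : add (add b c) a = add (add b a) c).
  { rewrite <- !cog_addA. f_equal. apply cog_addC. }
  pose proof (carry_cases (add b c) a) as X. rewrite E in X.
  destruct (carry_cases b a) as [[Ec [K _]]|[Ec [K _]]]; rewrite Ec.
  - destruct (carry_mono _ _ c K) as [[F L]|[F [F' L]]].
    + rewrite F. intuition lia.
    + apply clt_asym in L. rewrite F, F'. intuition lia.
  - destruct (clt_total b (add b a)) as [L|[L|L]]; [| |tauto].
    + destruct (carry_mono _ _ c L) as [[F J]|[F [F' J]]].
      * apply clt_asym in J. rewrite F. intuition lia.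
      * rewrite F, F'. intuition lia.
    + assert (a = zero).
      { apply (cog_add_cancel _ _ b). now rewrite cog_add0l, cog_addC. }
      subst a. rewrite carry0r, cog_add0. lia.
Qed.

(** Rieger's construction: the extension of [M] by Z with cocycle [carry]. The pair [(k, a)] stands
    for [k z] plus the representative of [a] in [[0, z)], and the order is lexicographic. *)
Definition unwound_add (u v : Z * M) : Z * M :=
  ((fst u + fst v + carry (snd u) (snd v))%Z, add (snd u) (snd v)).
Definition unwound_opp (u : Z * M) : Z * M :=
  ((- fst u - carry (snd u) (opp (snd u)))%Z, opp (snd u)).
Definition unwound_lt (u v : Z * M) : Prop :=
  (fst u < fst v)%Z \/ (fst u = fst v /\ clt (snd u) (snd v)).

Lemma unwound_addA u v w :
  unwound_add u (unwound_add v w) = unwound_add (unwound_add u v) w.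
Proof.
  destruct u as [k a], v as [l b], w as [m c]. unfold unwound_add; simpl.
  pose proof (carryA a b c). f_equal; [lia|apply cog_addA].
Qed.

Lemma unwound_addC u v : unwound_add u v = unwound_add v u.
Proof. unfold unwound_add. rewrite cog_addC, carryC. f_equal. lia. Qed.

Lemma unwound_add0 u : unwound_add u (0%Z, zero) = u.
Proof.
  destruct u as [k a]. unfold unwound_add; simpl. rewrite carry0r, cog_add0. f_equal. lia.
Qed.

Lemma unwound_addN u : unwound_add u (unwound_opp u) = (0%Z, zero).
Proof. unfold unwound_add, unwound_opp; simpl. rewrite cog_addN. f_equal. lia. Qed.

Lemma unwound_lt_irr u : ~ unwound_lt u u.
Proof. intros [H|[_ H]]; [lia|exact (clt_irr _ H)]. Qed.

Lemma unwound_lt_trans u v w : unwound_lt u v -> unwound_lt v w -> unwound_lt u w.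
Proof.
  destruct u as [k a], v as [l b], w as [m c]. unfold unwound_lt; simpl.
  intros [H|[-> H]] [K|[-> K]]; try (left; lia).
  right. split; [reflexivity|]. eapply clt_trans; eassumption.
Qed.

Lemma unwound_lt_total u v : unwound_lt u v \/ u = v \/ unwound_lt v u.
Proof.
  destruct u as [k a], v as [l b]. unfold unwound_lt; simpl.
  destruct (Z.lt_trichotomy k l) as [H|[-> |H]]; [tauto| |tauto].
  destruct (clt_total a b) as [H|[-> |H]]; tauto.
Qed.

Lemma unwound_lt_add u v w :
  unwound_lt u v -> unwound_lt (unwound_add u w) (unwound_add v w).
Proof.
  destruct u as [k a], v as [l b], w as [m c]. unfold unwound_lt, unwound_add; simpl.
  intros [H|[-> H]].
  - destruct (carry_cases a c) as [[-> [_ K]]|[-> [_ K]]];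
      destruct (carry_cases b c) as [[-> [_ L]]|[-> [_ L]]]; try (left; lia).
    destruct (Z.eq_dec (k + 1) l) as [<-|N]; [right|left; lia]. split; [lia|].
    destruct (clt_total c (add b c)) as [J|[J|J]]; [|congruence|tauto].
    eapply clt_trans; eassumption.
  - destruct (carry_mono _ _ c H) as [[-> K]|[-> [-> K]]]; [tauto|left; lia].
Qed.

Definition unwound : oag :=
  Oag (Z * M) (0%Z, zero) unwound_add unwound_opp unwound_lt
    unwound_addA unwound_addC unwound_add0 unwound_addN
    unwound_lt_irr unwound_lt_trans unwound_lt_total unwound_lt_add.

Definition unwound_z : unwound := (1%Z, zero).

Lemma unwound_smul_z (q : Z) : osmul q unwound_z = ((q, zero) : unwound).
Proof.
  revert q. apply Z.peano_ind.
  - reflexivity.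
  - intros q IH. rewrite osmul_succ, IH. cbn. unfold unwound_add. cbn.
    rewrite carry0l, cog_add0. f_equal. lia.
  - intros q IH. rewrite osmul_pred, IH. unfold unwound_z. cbn [oadd oopp unwound]. unfold unwound_add, unwound_opp. cbn [fst snd].
    rewrite carry0l, cog_addN. f_equal. lia.
Qed.

Lemma unwound_interval (u : unwound) :
  (0 <= u)%oag /\ (u < unwound_z)%oag <-> fst u = 0%Z.
Proof.
  destruct u as [k m]. unfold ole, unwound_z. cbn. unfold unwound_lt. cbn. split.
  - intros [[[H|[H _]]|H] [K|[_ K]]]; try lia; try (now apply clt_zero in K).
    injection H as <- <-. lia.
  - intros ->. split; [|left; lia].
    destruct (clt_total zero m) as [H|[<-|H]]; [tauto|now right|now apply clt_zero in H].
Qed.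

Lemma unwound_cover : cover unwound unwound_z M snd.
Proof.
  split; try reflexivity.
  - left. cbn. lia.
  - intros [k a] [l b]. cbn. split.
    + intros ->. exists (k - l)%Z. rewrite unwound_smul_z. cbn. unfold unwound_add. cbn.
      rewrite carry0r, cog_add0. f_equal. lia.
    + intros [q Hq]. rewrite unwound_smul_z in Hq. cbn in Hq. unfold unwound_add in Hq.
      cbn in Hq. rewrite cog_add0 in Hq. congruence.
  - intros m. exists (0%Z, m).
    destruct (proj2 (unwound_interval (0%Z, m)) eq_refl) as [H K]. auto.
  - intros a b c Ha Haz Hb Hbz Hc Hcz.
    pose proof (proj1 (unwound_interval a) (conj Ha Haz)) as Ea.
    pose proof (proj1 (unwound_interval b) (conj Hb Hbz)) as Eb.
    pose proof (proj1 (unwound_interval c) (conj Hc Hcz)) as Ec.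
    rewrite cyc_clt. unfold cyclic_pattern. cbn. unfold unwound_lt. rewrite Ea, Eb, Ec.
    intuition lia.
Qed.

End Unwinding.

(** * A first-order axiomatization *)

Local Notation V0 := (Var 0).
Local Notation V1 := (Var 1).
Local Notation V2 := (Var 2).
Local Notation V3 := (Var 3).
Local Notation Ne s t := (Neg (Eq s t)).

(** Follows [cyclically_ordered_group] clause by clause, so that satisfaction unfolds to that
    definition by conversion. *)
Definition cog_formula : formula :=
  And
    (And (All (All (All (Eq (Add V2 (Add V1 V0)) (Add (Add V2 V1) V0)))))
    (And (All (All (Eq (Add V1 V0) (Add V0 V1))))
    (And (All (Eq (Add V0 Zero) V0))
         (All (Eq (Add V0 (Opp V0)) Zero)))))
  (And (All (All (All (Imp (Cyc V2 V1 V0) (And (Ne V2 V1) (And (Ne V1 V0) (Ne V2 V0)))))))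
  (And (All (All (All (Imp (Cyc V2 V1 V0) (Cyc V1 V0 V2)))))
  (And (All (And (All (Imp (Ne V0 V1) (Neg (Cyc V1 V0 V0))))
            (And (All (All (All (Imp (Ne V2 V3) (Imp (Ne V1 V3) (Imp (Ne V0 V3)
                   (Imp (Cyc V3 V2 V1) (Imp (Cyc V3 V1 V0) (Cyc V3 V2 V0)))))))))
                 (All (All (Imp (Ne V1 V2) (Imp (Ne V0 V2) (Imp (Ne V1 V0)
                   (Or (Cyc V2 V1 V0) (Cyc V2 V0 V1))))))))))
       (All (All (All (All (Imp (Cyc V3 V2 V1)
          (Cyc (Add V3 V0) (Add V2 V0) (Add V1 V0)))))))))).

Lemma sat_cog_formula (M : structure) v :
  sat M v cog_formula <-> cyclically_ordered_group M.
Proof. reflexivity. Qed.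

Lemma cog_formula_sentence : sentence cog_formula.
Proof. cbn. repeat split; lia. Qed.

Definition big_and {A} (f : A -> formula) (l : list A) : formula :=
  fold_right (fun a g => And (f a) g) (Eq Zero Zero) l.

Lemma sat_big_and {A} (f : A -> formula) l (M : structure) v :
  sat M v (big_and f l) <-> forall a, In a l -> sat M v (f a).
Proof.
  induction l as [|a l IH]; simpl; [split; [tauto|reflexivity]|].
  rewrite IH. split; [intros [H K] b [<-|Hb]; auto|auto].
Qed.

Lemma big_and_below {A} (f : A -> formula) l k :
  (forall a, In a l -> formula_below k (f a)) -> formula_below k (big_and f l).
Proof. induction l as [|a l IH]; simpl; [tauto|]. auto. Qed.

Definition Cyc_list (ts : list term) : formula :=
  let n := length ts in
  big_and (fun i => big_and (fun j => big_and (fun k =>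
    Cyc (nth i ts Zero) (nth j ts Zero) (nth k ts Zero))
    (seq (S j) (n - S j))) (seq (S i) (n - S i))) (seq 0 n).

Lemma sat_Cyc_list ts (M : structure) v :
  sat M v (Cyc_list ts) <-> cyc_list (map (eval M v) ts).
Proof.
  assert (E : forall i, nth i (map (eval M v) ts) zero = eval M v (nth i ts Zero)).
  { intros i. exact (map_nth (eval M v) ts Zero i). }
  unfold Cyc_list, cyc_list. cbv zeta. rewrite sat_big_and, length_map. split.
  - intros H i j k Hij Hjk Hk. rewrite !E.
    specialize (H i). rewrite sat_big_and in H. specialize (H ltac:(apply in_seq; lia) j).
    rewrite sat_big_and in H. specialize (H ltac:(apply in_seq; lia) k).
    apply H. apply in_seq; lia.
  - intros H i Hi. rewrite sat_big_and. intros j Hj. rewrite sat_big_and. intros k Hk.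
    rewrite in_seq in Hi, Hj, Hk. simpl. rewrite <- !E. apply H; lia.
Qed.

Lemma Cyc_list_below ts m : Forall (term_below m) ts -> formula_below m (Cyc_list ts).
Proof.
  intros H. assert (N : forall i, term_below m (nth i ts Zero)).
  { intros i. destruct (nth_in_or_default i ts Zero) as [K| ->]; [|exact I].
    rewrite Forall_forall in H. auto. }
  repeat (apply big_and_below; intros ? _). simpl. auto.
Qed.

(** New quantifiers go innermost, so that in the body the variable [i] denotes entry [i] of the list
    in [sat_Alls]. *)
Fixpoint Alls (n : nat) (f : formula) : formula :=
  match n with 0 => f | S n => Alls n (All f) end.

Fixpoint valuation_app {M : Type} (l : list M) (v : nat -> M) : nat -> M :=
  match l with [] => v | a :: l => valuation_cons a (valuation_app l v) end.

Lemma valuation_app_nth {M : Type} (l : list M) v d i : i < length l ->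
  valuation_app l v i = nth i l d.
Proof.
  revert i. induction l as [|a l IH]; intros [|i] H; simpl in *; try lia; [reflexivity|].
  apply IH. lia.
Qed.

Lemma sat_Alls n f (M : structure) v : sat M v (Alls n f) <->
  forall l : list M, length l = n -> sat M (valuation_app l v) f.
Proof.
  revert f. induction n as [|n IH]; intros f; simpl.
  - split; [intros H [|a l] E; [exact H|discriminate]|intros H; exact (H [] eq_refl)].
  - rewrite IH. split.
    + intros H [|a l] E; [discriminate|]. injection E as E. exact (H l E a).
    + intros H l E a. apply (H (a :: l)). simpl. congruence.
Qed.

Lemma Alls_below n f k : formula_below (n + k) f -> formula_below k (Alls n f).
Proof.
  revert f. induction n as [|n IH]; intros f H; simpl; [exact H|]. apply IH. exact H.
Qed.

Fixpoint term_nmul (n : nat) (t : term) : term :=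
  match n with 0 => Zero | S n => Add t (term_nmul n t) end.

Lemma eval_term_nmul n t (M : structure) v :
  eval M v (term_nmul n t) = nmul n (eval M v t).
Proof. induction n as [|n IH]; simpl; congruence. Qed.

Lemma term_nmul_below n t k : term_below k t -> term_below k (term_nmul n t).
Proof. induction n; simpl; auto. Qed.

(** In the premise [x_i] is the variable [i - 1]. Under the existential quantifier the indices
    shift: [x] is variable 0, and [x_1], [x_n] become variables 1 and [n]. *)
Definition regular_formula (n : nat) : formula :=
  let nx := term_nmul n (Var 0) in
  Alls n (Imp (Cyc_list (Zero :: map Var (seq 0 n)))
    (Ex (And (Or (Eq nx (Var 1)) (Or (Eq nx (Var n)) (Cyc (Var 1) nx (Var n))))
             (Cyc_list (map (fun k => term_nmul k (Var 0)) (seq 0 n) ++ [Var n]))))).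

Lemma regular_formula_sentence n : 2 <= n -> sentence (regular_formula n).
Proof.
  intros Hn. unfold sentence, regular_formula. cbv zeta. apply Alls_below. split.
  - apply Cyc_list_below. constructor; [exact I|]. apply Forall_forall.
    intros t Ht. apply in_map_iff in Ht. destruct Ht as [i [<- Hi]].
    apply in_seq in Hi. simpl. lia.
  - split.
    + simpl. repeat split; try lia; apply term_nmul_below; simpl; lia.
    + apply Cyc_list_below, Forall_app. split; [|constructor; [simpl; lia|constructor]].
      apply Forall_forall. intros t Ht. apply in_map_iff in Ht.
      destruct Ht as [i [<- Hi]]. apply term_nmul_below. simpl. lia.
Qed.

Lemma sat_regular_formula n (M : structure) v : 2 <= n ->
  (sat M v (regular_formula n) <-> c_n_regular n M).
Proof.
  intros Hn. unfold regular_formula, c_n_regular. cbv zeta. rewrite sat_Alls.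
  assert (E : forall l : list M, length l = n ->
    map (eval M (valuation_app l v)) (map Var (seq 0 n)) = l).
  { intros l Hl. rewrite map_map. apply (nth_ext _ _ zero zero).
    - rewrite length_map, length_seq. congruence.
    - intros i Hi. rewrite length_map, length_seq in Hi.
      rewrite (nth_indep _ _ (eval M (valuation_app l v) (Var 0))) by (rewrite length_map, length_seq; lia).
      rewrite (map_nth (fun j => eval M (valuation_app l v) (Var j)) _ 0).
      rewrite seq_nth by lia. simpl. apply valuation_app_nth. lia. }
  assert (F : forall (l : list M), length l = n ->
    (exists a, sat M (valuation_cons a (valuation_app l v))
      (And (Or (Eq (term_nmul n (Var 0)) (Var 1)) (Or (Eq (term_nmul n (Var 0)) (Var n))
             (Cyc (Var 1) (term_nmul n (Var 0)) (Var n))))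
           (Cyc_list (map (fun k => term_nmul k (Var 0)) (seq 0 n) ++ [Var n])))) <->
    (exists x, (nmul n x = nth 0 l zero \/ nmul n x = nth (n - 1) l zero \/
      cyc (nth 0 l zero) (nmul n x) (nth (n - 1) l zero)) /\
      cyc_list (map (fun k => nmul k x) (seq 0 n) ++ [nth (n - 1) l zero]))).
  { intros l Hl.
    assert (E1 : valuation_app l v 0 = nth 0 l zero) by (apply valuation_app_nth; lia).
    assert (En : forall a, valuation_cons a (valuation_app l v) n = nth (n - 1) l zero).
    { intros a. destruct n as [|n']; [lia|]. simpl. rewrite Nat.sub_0_r.
      apply valuation_app_nth. lia. }
    assert (G : forall a, sat M (valuation_cons a (valuation_app l v))
         (Cyc_list (map (fun k => term_nmul k (Var 0)) (seq 0 n) ++ [Var n])) <->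
         cyc_list (map (fun k => nmul k a) (seq 0 n) ++ [nth (n - 1) l zero])).
    { intros a. rewrite sat_Cyc_list, map_app, map_map. cbn [map eval]. rewrite En.
      rewrite (map_ext _ (fun k => nmul k a)); [reflexivity|].
      intros k. apply eval_term_nmul. }
    split; intros [a [H K]]; exists a; (split; [|now apply G]); revert H;
      cbn [sat eval]; rewrite !eval_term_nmul, En; cbn [eval valuation_cons];
      rewrite E1; exact (fun H => H). }
  split; intros H l Hl.
  - specialize (H l Hl). cbn [sat] in H. rewrite sat_Cyc_list in H.
    cbn [map eval] in H. rewrite (E l Hl) in H. intros K. apply F; [exact Hl|]. now apply H.
  - cbn [sat]. rewrite sat_Cyc_list. cbn [map eval]. rewrite (E l Hl). intros K.
    apply F; [exact Hl|]. now apply H.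
Qed.

Definition c_regular_theory (f : formula) : Prop :=
  f = cog_formula \/ exists n, 2 <= n /\ f = regular_formula n.

Lemma c_regular_model (M : structure) : c_regular M <-> model c_regular_theory M.
Proof.
  split.
  - intros [H R] f [-> | [n [Hn ->]]] v.
    + now apply sat_cog_formula.
    + apply sat_regular_formula; auto.
  - intros H. split.
    + apply (proj1 (sat_cog_formula M (fun _ => zero))). apply H. now left.
    + intros n Hn. apply (proj1 (sat_regular_formula n M (fun _ => zero) Hn)). apply H. right. eauto.
Qed.

Lemma c_regular_elementary : elementary_class c_regular.
Proof.
  exists c_regular_theory. split; [|exact c_regular_model].
  intros f [-> | [n [Hn ->]]].
  - exact cog_formula_sentence.
  - now apply regular_formula_sentence.
Qed.

(** * Subgroups of the reals and of the circle *)

(** Meant for full preimages of subgroups of the circle under [angle]; these contain the period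
    1. *)
Record real_subgroup (A : R -> Prop) : Prop := RealSubgroup {
  rsub_1 : A 1%R;
  rsub_sub : forall a b, A a -> A b -> A (a - b)%R
}.

Lemma pred_IZR (n : Z) : IZR (Z.pred n) = (IZR n - 1)%R.
Proof. rewrite <- Z.sub_1_r. apply minus_IZR. Qed.

Section RealSubgroup.
Variable A : R -> Prop.
Hypothesis HA : real_subgroup A.
Local Open Scope R_scope.

Lemma rsub_0 : A 0.
Proof. replace 0 with (1 - 1) by ring. apply HA; apply HA. Qed.

Lemma rsub_opp a : A a -> A (- a).
Proof. intros H. replace (- a) with (0 - a) by ring. apply HA; [apply rsub_0|exact H]. Qed.

Lemma rsub_add a b : A a -> A b -> A (a + b).
Proof.
  intros H K. replace (a + b) with (a - - b) by ring. apply HA; [exact H|].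
  now apply rsub_opp.
Qed.

Lemma real_sig_eq (a b : {r | A r}) : proj1_sig a = proj1_sig b -> a = b.
Proof. destruct a, b. apply subset_eq_compat. Qed.

Definition rcar : Type := {r | A r}.
Definition rzero : rcar := exist _ 0 rsub_0.
Definition radd (a b : rcar) : rcar :=
  exist _ _ (rsub_add _ _ (proj2_sig a) (proj2_sig b)).
Definition ropp (a : rcar) : rcar := exist _ _ (rsub_opp _ (proj2_sig a)).
Definition rlt (a b : rcar) : Prop := proj1_sig a < proj1_sig b.

Lemma raddA a b c : radd a (radd b c) = radd (radd a b) c.
Proof. apply real_sig_eq; simpl; ring. Qed.
Lemma raddC a b : radd a b = radd b a.
Proof. apply real_sig_eq; simpl; ring. Qed.
Lemma radd0 a : radd a rzero = a.
Proof. apply real_sig_eq; simpl; ring. Qed.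
Lemma raddN a : radd a (ropp a) = rzero.
Proof. apply real_sig_eq; simpl; ring. Qed.
Lemma rlt_irr a : ~ rlt a a.
Proof. apply Rlt_irrefl. Qed.
Lemma rlt_trans a b c : rlt a b -> rlt b c -> rlt a c.
Proof. apply Rlt_trans. Qed.
Lemma rlt_total a b : rlt a b \/ a = b \/ rlt b a.
Proof.
  destruct (Rtotal_order (proj1_sig a) (proj1_sig b)) as [H|[H|H]];
    [now left|right; left; now apply real_sig_eq|right; now right].
Qed.
Lemma rlt_add a b c : rlt a b -> rlt (radd a c) (radd b c).
Proof. unfold rlt; simpl; lra. Qed.

Definition real_oag : oag :=
  Oag rcar rzero radd ropp rlt raddA raddC radd0 raddN rlt_irr rlt_trans rlt_total rlt_add.

Definition rone : real_oag := exist _ 1 (rsub_1 A HA).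

Lemma proj1_smul (n : Z) (x : real_oag) :
  proj1_sig (osmul n x) = IZR n * proj1_sig x.
Proof.
  revert n. apply Z.peano_ind.
  - simpl. ring.
  - intros n IH. rewrite osmul_succ, succ_IZR. cbn [real_oag oadd radd proj1_sig].
    rewrite IH. ring.
  - intros n IH. rewrite osmul_pred, pred_IZR. cbn [real_oag oadd oopp radd ropp proj1_sig].
    rewrite IH. ring.
Qed.

Lemma rle_proj (x y : real_oag) : (x <= y)%oag <-> proj1_sig x <= proj1_sig y.
Proof.
  unfold ole. cbn. unfold rlt. split.
  - intros [H| ->]; lra.
  - intros [H|H]; [now left|right; now apply real_sig_eq].
Qed.

Lemma rsub_IZR (n : Z) a : A a -> A (IZR n * a).
Proof.
  intros H. pose proof (proj2_sig (osmul n (exist _ a H : real_oag))) as K. cbv beta in K.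
  now rewrite proj1_smul in K.
Qed.

Lemma floor_exists (x : R) : exists n : Z, IZR n <= x < IZR n + 1.
Proof. exists (up x - 1)%Z. rewrite minus_IZR. pose proof (archimed x). lra. Qed.

(** Let [g] be the infimum of the positive elements, obtained by [completeness] as minus the
    supremum of their opposites. If positive elements are at least [eps], the infimum is attained,
    since otherwise two elements just above [g] differ by less than [eps]. Division with remainder
    by [g] then shows that [g] generates. *)
Lemma real_subgroup_dichotomy :
  (forall eps, 0 < eps -> exists a, A a /\ 0 < a < eps) \/
  (exists g, 0 < g /\ A g /\ forall a, A a -> exists k : Z, a = IZR k * g).
Proof.
  destruct (classic (forall eps, 0 < eps -> exists a, A a /\ 0 < a < eps)) as [H|H]; [now left|].
  right. apply not_all_ex_not in H. destruct H as [eps H].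
  apply imply_to_and in H. destruct H as [He Hn].
  assert (Hn' : forall a, A a -> 0 < a -> eps <= a).
  { intros a Ha Hp. apply Rnot_lt_le. intros K. apply Hn. exists a. split; [exact Ha|lra]. }
  destruct (completeness (fun r => exists a, r = - a /\ A a /\ 0 < a)) as [s [Hs1 Hs2]].
  - exists 0. intros r [a [-> [_ Ha]]]. lra.
  - exists (- 1), 1. repeat split; [apply HA|lra].
  - set (g := - s).
    assert (G1 : forall a, A a -> 0 < a -> g <= a).
    { intros a Ha Hp. unfold g. specialize (Hs1 (- a)). enough (- a <= s) by lra.
      apply Hs1. exists a. auto. }
    assert (Hg : eps <= g).
    { unfold g. enough (s <= - eps) by lra. apply Hs2. intros r [a [-> [Ha Hp]]].
      specialize (Hn' a Ha Hp). lra. }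
    assert (G2 : forall d, 0 < d -> exists a, A a /\ 0 < a /\ a < g + d).
    { intros d Hd. apply NNPP. intros K. enough (s <= - (g + d)) by (unfold g in *; lra).
      apply Hs2. intros r [a [-> [Ha Hp]]]. apply Ropp_le_contravar, Rnot_lt_le.
      intros L. apply K. eauto. }
    assert (Ag : A g).
    { destruct (G2 eps He) as [a [Ha [Hp Hl]]].
      destruct (Rle_lt_or_eq_dec g a (G1 a Ha Hp)) as [L|<-]; [|exact Ha].
      destruct (G2 (a - g)) as [b [Hb [Hbp Hbl]]]; [lra|].
      pose proof (G1 b Hb Hbp).
      specialize (Hn' (a - b) (rsub_sub A HA _ _ Ha Hb)). lra. }
    exists g. repeat split; [lra|exact Ag|]. intros a Ha.
    destruct (floor_exists (a / g)) as [k [K1 K2]]. exists k.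
    assert (E : a = a / g * g) by (field; lra).
    assert (L1 : IZR k * g <= a) by (rewrite E at 1; apply Rmult_le_compat_r; lra).
    assert (L2 : a < (IZR k + 1) * g) by (rewrite E at 1; apply Rmult_lt_compat_r; lra).
    destruct (Rle_lt_or_eq_dec _ _ L1) as [L|L]; [|auto].
    specialize (G1 (a - IZR k * g) (rsub_sub A HA _ _ Ha (rsub_IZR k g Ag))). lra.
Qed.

End RealSubgroup.

(** * The circle as a quotient of the reals *)

Section Circle.
Local Open Scope R_scope.

Lemma cis_add a b : cis (a + b) = Cmult (cis a) (cis b).
Proof. unfold cis, Cmult. simpl. rewrite cos_plus, sin_plus. f_equal; ring. Qed.

Lemma cis_0 : cis 0 = RtoC 1.
Proof. unfold cis. now rewrite cos_0, sin_0. Qed.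

Lemma cis_mod a : Cmod (cis a) = 1.
Proof.
  unfold Cmod, cis. simpl. transitivity (sqrt 1); [f_equal|apply sqrt_1].
  pose proof (sin2_cos2 a). unfold Rsqr in *. lra.
Qed.

Lemma cis_opp a : cis (- a) = Cinv (cis a).
Proof.
  unfold cis, Cinv. simpl. rewrite cos_neg, sin_neg.
  replace (cos a * (cos a * 1) + sin a * (sin a * 1)) with 1.
  - f_equal; field.
  - pose proof (sin2_cos2 a). unfold Rsqr in *. lra.
Qed.

Definition angle (r : R) : circle := exist _ (cis (2 * PI * r)) (cis_mod _).

Lemma circle_eq (x y : circle) : proj1_sig x = proj1_sig y -> x = y.
Proof. destruct x, y. apply subset_eq_compat. Qed.

Lemma angle_add a b : angle (a + b) = @add unit_circle (angle a) (angle b).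
Proof. apply circle_eq. simpl. rewrite <- cis_add. f_equal. ring. Qed.

Lemma angle_opp a : angle (- a) = @opp unit_circle (angle a).
Proof. apply circle_eq. simpl. rewrite <- cis_opp. f_equal. ring. Qed.

Lemma angle_0 : angle 0 = @zero unit_circle.
Proof. apply circle_eq. simpl. rewrite <- cis_0. f_equal. ring. Qed.

Lemma angle_1 : angle 1 = @zero unit_circle.
Proof.
  apply circle_eq. simpl. unfold cis. rewrite Rmult_1_r, cos_2PI, sin_2PI. reflexivity.
Qed.

Lemma angle_IZR (q : Z) : angle (IZR q) = @zero unit_circle.
Proof.
  revert q. apply Z.peano_ind; [apply angle_0| |]; intros q IH.
  - rewrite succ_IZR, angle_add, IH, angle_1. apply circle_eq. simpl. apply Cmult_1_l.
  - rewrite pred_IZR. unfold Rminus. rewrite angle_add, angle_opp, IH, angle_1.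
    apply circle_eq. simpl. rewrite Cmult_1_l. unfold Cinv, RtoC. simpl. f_equal; field.
Qed.

Lemma angle_period a (q : Z) : angle (a + IZR q) = angle a.
Proof.
  rewrite angle_add, angle_IZR. apply circle_eq. simpl. apply Cmult_1_r.
Qed.

(** The real part gives [1 - 2 sin^2 (PI d) = 1], while [sin (PI d)] is positive for [0 < d < 1]. *)
Lemma angle_zero_unit d : 0 <= d < 1 -> angle d = @zero unit_circle -> d = 0.
Proof.
  intros Hd H. apply (f_equal (@proj1_sig _ _)) in H. simpl in H.
  apply (f_equal fst) in H. simpl in H.
  destruct (Rle_lt_or_eq_dec 0 d (proj1 Hd)) as [K|K]; [|auto]. exfalso.
  replace (2 * PI * d) with (2 * (PI * d)) in H by ring. rewrite cos_2a_sin in H.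
  pose proof PI_RGT_0.
  assert (0 < sin (PI * d)).
  { apply sin_gt_0; [now apply Rmult_lt_0_compat|].
    rewrite <- (Rmult_1_r PI) at 2. apply Rmult_lt_compat_l; lra. }
  assert (0 < sin (PI * d) * sin (PI * d)) by now apply Rmult_lt_0_compat.
  lra.
Qed.

Lemma angle_eq a b : angle a = angle b <-> exists q : Z, a = b + IZR q.
Proof.
  split; [|intros [q ->]; apply angle_period]. intros H.
  destruct (floor_exists (a - b)) as [q Hq]. exists q.
  enough (a - b - IZR q = 0) by lra. apply angle_zero_unit; [lra|].
  replace (a - b - IZR q) with (a + - b + IZR (- q)) by (rewrite opp_IZR; ring).
  rewrite angle_period, angle_add, H, angle_opp. apply circle_eq. simpl.
  apply Cinv_r. intros E. pose proof (cis_mod (2 * PI * b)) as K. rewrite E, Cmod_0 in K. lra.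
Qed.

Lemma angle_inj a b : 0 <= a < 1 -> 0 <= b < 1 -> angle a = angle b -> a = b.
Proof.
  intros Ha Hb H. apply angle_eq in H. destruct H as [q ->].
  assert (- 1 < IZR q < 1) as [H1 H2] by lra.
  change (-1) with (IZR (-1)) in H1. apply lt_IZR in H1. apply lt_IZR in H2.
  replace q with 0%Z by lia. ring.
Qed.

Lemma angle_surj (x : circle) : exists r, 0 <= r < 1 /\ angle r = x.
Proof.
  destruct x as [[x y] H].
  assert (E : x * x + y * y = 1).
  { unfold Cmod in H. simpl in H. apply (f_equal Rsqr) in H.
    rewrite Rsqr_sqrt in H.
    - unfold Rsqr in H. lra.
    - pose proof (pow2_ge_0 x). pose proof (pow2_ge_0 y). simpl in *. lra. }
  pose proof PI_RGT_0 as P.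
  assert (Hx : -1 <= x <= 1) by nra.
  pose proof (acos_bound x) as B.
  assert (S : sin (acos x) = Rabs y).
  { rewrite sin_acos by exact Hx. replace (1 - Rsqr x) with (Rsqr y) by (unfold Rsqr; lra).
    apply sqrt_Rsqr_abs. }
  assert (T : forall t, 0 <= t < 2 * PI -> cos t = x -> sin t = y ->
    exists r, 0 <= r < 1 /\ angle r = exist _ (x, y) H).
  { intros t Ht Hc Hs. exists (t / (2 * PI)). split.
    - split; [apply Rmult_le_pos; [lra|left; apply Rinv_0_lt_compat; lra]|].
      apply (Rmult_lt_reg_r (2 * PI)); [lra|]. unfold Rdiv.
      rewrite Rmult_assoc, Rinv_l by lra. lra.
    - apply circle_eq. simpl. replace (2 * PI * (t / (2 * PI))) with t by (field; lra).
      unfold cis. now rewrite Hc, Hs. }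
  destruct (Rle_or_lt 0 y) as [Hy|Hy].
  - apply (T (acos x)); [lra|now apply cos_acos|]. rewrite S. now apply Rabs_pos_eq.
  - rewrite Rabs_left in S by exact Hy.
    assert (acos x <> 0).
    { intros Z. rewrite Z, sin_0 in S. lra. }
    apply (T (- acos x + 2 * PI)); [lra| |].
    + replace (2 * PI) with (2 * INR 1 * PI) by (simpl; ring).
      rewrite cos_period, cos_neg. now apply cos_acos.
    + replace (2 * PI) with (2 * INR 1 * PI) by (simpl; ring).
      rewrite sin_period, sin_neg. lra.
Qed.

Lemma circle_cyc_angle a b c : 0 <= a < 1 -> 0 <= b < 1 -> 0 <= c < 1 ->
  (circle_cyc (angle a) (angle b) (angle c) <->
   (a < b < c \/ b < c < a \/ c < a < b)).
Proof.
  intros Ha Hb Hc. pose proof PI_RGT_0 as P.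
  assert (T : forall t a, 0 <= t < 2 * PI -> 0 <= a < 1 -> cis (2 * PI * a) = cis t ->
    t = 2 * PI * a).
  { intros t x Ht Hx H. rewrite (angle_inj x (t / (2 * PI))); [field; lra|exact Hx| |].
    - split; [apply Rmult_le_pos; [lra|left; apply Rinv_0_lt_compat; lra]|].
      apply (Rmult_lt_reg_r (2 * PI)); [lra|]. unfold Rdiv.
      rewrite Rmult_assoc, Rinv_l by lra. lra.
    - apply circle_eq. simpl. rewrite H. f_equal. field. lra. }
  assert (B : forall x, 0 <= x < 1 -> 0 <= 2 * PI * x < 2 * PI).
  { intros x Hx. split; [apply Rmult_le_pos; lra|].
    rewrite <- (Rmult_1_r (2 * PI)) at 2. apply Rmult_lt_compat_l; lra. }
  assert (L : forall x y, x < y <-> 2 * PI * x < 2 * PI * y).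
  { intros x y. split; intros H; [apply Rmult_lt_compat_l; lra|].
    apply (Rmult_lt_reg_l (2 * PI)); lra. }
  rewrite (L a b), (L b c), (L c a). split.
  - intros [t1 [t2 [t3 [[H1 [H2 H3]] [[E1 [E2 E3]] H]]]]].
    apply T in E1; auto. apply T in E2; auto. apply T in E3; auto. subst. exact H.
  - intros H. exists (2 * PI * a), (2 * PI * b), (2 * PI * c).
    repeat split; try apply B; auto.
Qed.

Section Substructure.
Variables (H : unit_circle -> Prop) (HH : subgroup unit_circle H).
Variables (A : R -> Prop) (HA : real_subgroup A).
Hypothesis AH : forall r, A r <-> H (angle r).

Definition sub_angle (a : real_oag A HA) : substructure unit_circle H HH :=
  exist _ (angle (proj1_sig a)) (proj1 (AH _) (proj2_sig a)).

Lemma sub_angle_cover :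
  cover (real_oag A HA) (rone A HA) (substructure unit_circle H HH) sub_angle.
Proof.
  assert (SE : forall x y : substructure unit_circle H HH, proj1_sig x = proj1_sig y -> x = y).
  { intros [x Hx] [y Hy]. apply subset_eq_compat. }
  split.
  - cbn. unfold rlt. simpl. lra.
  - apply SE. exact angle_0.
  - intros a b. apply SE. apply angle_add.
  - intros a. apply SE. apply angle_opp.
  - intros a b. transitivity (angle (proj1_sig a) = angle (proj1_sig b)).
    + split; intros E; [exact (f_equal (@proj1_sig _ _) E)|now apply SE].
    + rewrite angle_eq. split; intros [q Hq]; exists q.
      * apply real_sig_eq. cbn [real_oag oadd radd proj1_sig].
        rewrite proj1_smul. rewrite Rmult_1_r. exact Hq.
      * apply (f_equal (@proj1_sig _ _)) in Hq. cbn [real_oag oadd radd proj1_sig] in Hq.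
        rewrite proj1_smul in Hq. rewrite Rmult_1_r in Hq. exact Hq.
  - intros [x Hx]. destruct (angle_surj x) as [r [Hr <-]].
    exists (exist _ r (proj2 (AH r) Hx)). repeat split.
    + apply rle_proj. simpl. lra.
    + cbn. unfold rlt. simpl. lra.
    + now apply SE.
  - intros a b c Ha Ha' Hb Hb' Hc Hc'. apply rle_proj in Ha, Hb, Hc.
    cbn in Ha', Hb', Hc'. unfold rlt in *. simpl in *.
    rewrite circle_cyc_angle by lra. unfold cyclic_pattern. cbn. unfold rlt. tauto.
Qed.

End Substructure.
End Circle.

Lemma angle_preimage_subgroup (H : unit_circle -> Prop) :
  subgroup unit_circle H -> real_subgroup (fun r => H (angle r)).
Proof.
  intros [H0 [H1 H2]]. split.
  - rewrite angle_1. exact H0.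
  - intros a b Ha Hb. unfold Rminus. rewrite angle_add, angle_opp. auto.
Qed.

(* The angles of [A] form a subgroup of the circle whose full preimage is [A],
   because [A] contains the kernel Z of [angle]. *)
Lemma real_subgroup_circle (A : R -> Prop) : real_subgroup A ->
  exists H : unit_circle -> Prop, subgroup unit_circle H /\
    forall r, A r <-> H (angle r).
Proof.
  intros HA. exists (fun x => exists a, A a /\ x = angle a). split; [split; [|split]|].
  - exists 0%R. split; [now apply rsub_0|]. symmetry. apply angle_0.
  - intros x y [a [Ha ->]] [b [Hb ->]]. exists (a + b)%R.
    split; [now apply rsub_add|]. symmetry. apply angle_add.
  - intros x [a [Ha ->]]. exists (- a)%R. split; [now apply rsub_opp|].
    symmetry. apply angle_opp.
  - intros r. split; [eauto|]. intros [a [Ha E]]. apply angle_eq in E.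
    destruct E as [q ->]. apply rsub_add; auto.
    rewrite <- (Rmult_1_r (IZR q)). apply rsub_IZR; auto. apply HA.
Qed.

Lemma isomorphic_refl (M : structure) : isomorphic M M.
Proof. exists (fun x => x). repeat split; auto. exists (fun x => x). auto. Qed.

Lemma real_subgroup_c_archimedean (A : R -> Prop) (HA : real_subgroup A) :
  exists N p, c_archimedean N /\ cover (real_oag A HA) (rone A HA) N p.
Proof.
  destruct (real_subgroup_circle A HA) as [H [HH AH]].
  pose proof (sub_angle_cover H HH A HA AH) as CV.
  exists (substructure unit_circle H HH), (sub_angle H HH A HA AH). split; [|exact CV].
  split; [exact (cover_cyclically_ordered_group _ _ _ _ CV)|].
  exists H, HH. apply isomorphic_refl.
Qed.

Lemma cover_isomorphic U z (M N : structure) p :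
  isomorphic M N -> cover U z N p -> exists p', cover U z M p'.
Proof.
  intros [f [[g [gf fg]] [f0 [fa [fo fc]]]]] CV.
  assert (fi : forall x y, f x = f y -> x = y).
  { intros x y E. now rewrite <- (gf x), <- (gf y), E. }
  exists (fun u => g (p u)). split.
  - apply CV.
  - apply fi. rewrite fg, f0. apply CV.
  - intros a b. apply fi. rewrite fa, !fg. apply CV.
  - intros a. apply fi. rewrite fo, !fg. apply CV.
  - intros a b. rewrite <- (cov_ker _ _ _ _ CV). split; [|congruence].
    intros E. now rewrite <- (fg (p a)), E, fg.
  - intros m. destruct (cov_surj _ _ _ _ CV (f m)) as [a [H1 [H2 H3]]].
    exists a. repeat split; auto. now rewrite H3, gf.
  - intros a b c Ha Ha' Hb Hb' Hc Hc'. rewrite fc, !fg. now apply CV.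
Qed.

Lemma c_archimedean_cover M : c_archimedean M ->
  exists A (HA : real_subgroup A) p, cover (real_oag A HA) (rone A HA) M p.
Proof.
  intros [_ [H [HH I]]]. exists (fun r => H (angle r)), (angle_preimage_subgroup H HH).
  eapply cover_isomorphic; [exact I|].
  apply (sub_angle_cover H HH _ _ (fun r => iff_refl _)).
Qed.

(** * Regular ordered groups and c-regularity *)

Definition densely_ordered (U : oag) : Prop :=
  forall x : U, (0 < x)%oag -> exists y : U, (0 < y /\ y < x)%oag.

(** The regularly dense groups of Robinson and Zakon. The case [n = 1] contains the density of the
    order. *)
Definition regular_dense (U : oag) : Prop :=
  forall n : Z, (0 < n)%Z -> forall u v : U, (u < v)%oag ->
  exists y : U, (u < n *: y /\ n *: y < v)%oag.

Definition least_positive {U : oag} (e : U) : Prop :=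
  (0 < e)%oag /\ forall x : U, (0 < x)%oag -> (e <= x)%oag.

(** Regularly discrete groups, also called Z-groups: the second clause says that the quotient by the
    multiples of [e] is divisible. *)
Definition regular_discrete (U : oag) (e : U) : Prop :=
  least_positive e /\ forall n : Z, (0 < n)%Z -> forall u : U,
  exists (y : U) (j : Z), (u = n *: y + j *: e)%oag.

Lemma dense_or_least_positive (U : oag) :
  densely_ordered U \/ exists e : U, least_positive e.
Proof.
  destruct (classic (densely_ordered U)) as [H|H]; [now left|right].
  apply not_all_ex_not in H. destruct H as [e H]. apply imply_to_and in H.
  destruct H as [He H]. exists e. split; [exact He|]. intros x Hx.
  apply onot_lt. intros K. apply H. eauto.
Qed.

Definition increasing {U : oag} (xs : list U) : Prop :=
  forall i j, i < j -> j < length xs -> (nth i xs 0 < nth j xs 0)%oag.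

Section Regularity.
Variables (U : oag) (z : U) (M : structure) (p : U -> M).
Hypothesis CV : cover U z M p.
Local Open Scope oag_scope.

Definition in_interval (x : U) : Prop := 0 <= x /\ x < z.

Lemma nth_map_cover xs i : nth i (map p xs) zero = p (nth i xs 0).
Proof. rewrite <- (cov_0 _ _ _ _ CV). apply map_nth. Qed.

Lemma in_interval_0 : in_interval 0.
Proof. split; [apply ole_refl|apply CV]. Qed.

Lemma in_interval_nth xs i : Forall in_interval xs -> in_interval (nth i xs 0).
Proof.
  intros H. destruct (nth_in_or_default i xs 0) as [K| ->]; [|apply in_interval_0].
  rewrite Forall_forall in H. auto.
Qed.

Lemma cov_cyc_interval a b c : in_interval a -> in_interval b -> in_interval c ->
  (cyc (p a) (p b) (p c) <-> cyclic_pattern a b c).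
Proof. unfold in_interval. intros. apply CV; tauto. Qed.

Lemma increasing_cyc_list xs : Forall in_interval xs -> increasing xs ->
  cyc_list (map p xs).
Proof.
  intros HI H i j k Hij Hjk Hk. rewrite length_map in Hk. rewrite !nth_map_cover.
  apply cov_cyc_interval; try now apply in_interval_nth.
  left. split; apply H; lia.
Qed.

Lemma cyclic_pattern_0 b c : in_interval b -> in_interval c ->
  cyclic_pattern 0 b c -> 0 < b /\ b < c.
Proof.
  intros [Hb _] [Hc _] [[H K]|[[H K]|[H K]]]; [auto| |].
  - destruct (olt_not_le K Hc).
  - destruct (olt_not_le H Hc).
Qed.

Lemma cyc_list_increasing xs : Forall in_interval xs -> (2 <= length xs)%nat ->
  cyc_list (map p (0 :: xs)) -> increasing (0 :: xs).
Proof.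
  intros HI Hn H.
  assert (HI' : Forall in_interval (0 :: xs)) by (constructor; [apply in_interval_0|exact HI]).
  assert (S : forall i j, (i < j)%nat -> (j < length xs)%nat -> 0 < nth i xs 0 /\ nth i xs 0 < nth j xs 0).
  { intros i j Hi Hj. specialize (H 0%nat (S i) (S j)). rewrite length_map in H.
    rewrite !nth_map_cover in H.
    specialize (H ltac:(lia) ltac:(lia) ltac:(simpl; lia)).
    rewrite cov_cyc_interval in H by now apply in_interval_nth.
    apply cyclic_pattern_0 in H; [exact H|now apply in_interval_nth..]. }
  intros [|i] [|j] Hi Hj; simpl in *; try lia; [|apply S; lia].
  destruct j as [|j]; [apply (S 0%nat 1%nat); lia|].
  destruct (S 0%nat (Datatypes.S j)) as [H1 H2]; try lia. exact (olt_trans _ _ _ _ H1 H2).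
Qed.

Lemma map_cover_surj l : exists xs, map p xs = l /\ Forall in_interval xs.
Proof.
  induction l as [|m l [xs [<- H]]]; [exists []; split; constructor|].
  destruct (cov_surj _ _ _ _ CV m) as [a [H1 [H2 <-]]].
  exists (a :: xs). split; [reflexivity|]. constructor; [now split|exact H].
Qed.

Lemma discrete_succ (e x y : U) : least_positive e -> x < y -> x + e <= y.
Proof.
  intros [_ H] K. apply osub_pos in K. apply H in K. apply (ole_of K). omod.
Qed.

(** [U] may be non-archimedean, so an integer bound [m] is part of the data, and [e] is subtracted
    at most [m] times. *)
Lemma discrete_multiple (e d : U) m : least_positive e -> 0 <= d ->
  d <= Z.of_nat m *: e -> exists j : Z, (0 <= j <= Z.of_nat m)%Z /\ d = j *: e.
Proof.
  intros He. revert d. induction m as [|m IH]; intros d Hd Hm.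
  - exists 0%Z. split; [lia|]. now apply ole_antisym.
  - destruct Hd as [Hd| <-]; [|exists 0%Z; split; [lia|reflexivity]].
    destruct (IH (d - e)) as [j [Hj E]].
    + apply (discrete_succ e 0 d) in Hd; [|exact He]. apply (ole_of Hd). omod.
    + rewrite Nat2Z.inj_succ, osmul_succ in Hm. apply (ole_of Hm). omod.
    + exists (j + 1)%Z. split; [lia|].
      replace d with (d - e + e) by omod. rewrite E. omod.
Qed.

(** In the discrete case [n] increasing elements reach over at least [n - 1] steps of size [e], so
    the interval between the extreme ones contains [n] consecutive elements, one of each residue
    modulo [n]. *)
Lemma regular_multiple n (xs : list U) : (2 <= n)%nat ->
  (regular_dense U \/ exists e, regular_discrete U e) ->
  length xs = n -> increasing xs ->
  exists y, nth 0 xs 0 <= Z.of_nat n *: y /\ Z.of_nat n *: y <= nth (n - 1) xs 0.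
Proof.
  intros Hn [D|[e [He D]]] Hl I.
  - destruct (D (Z.of_nat n) ltac:(lia) (nth 0 xs 0) (nth (n - 1) xs 0)) as [y [H K]].
    + apply I; lia.
    + exists y. split; now left.
  - assert (G : forall i, (i < n)%nat -> nth 0 xs 0 + Z.of_nat i *: e <= nth i xs 0).
    { induction i as [|i IH]; intros Hi; [right; omod|].
      apply (ole_trans (b := nth i xs 0 + e)).
      - apply (ole_of (IH ltac:(lia))). rewrite Nat2Z.inj_succ, osmul_succ. omod.
      - apply discrete_succ; [exact He|]. apply I; lia. }
    specialize (G (n - 1)%nat ltac:(lia)).
    destruct (D (Z.of_nat n) ltac:(lia) (nth 0 xs 0)) as [y [j Ej]].
    set (N := Z.of_nat n) in *.
    (* [N * k] is the least multiple of [N] not below [j]. *)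
    set (k := ((j + N - 1) / N)%Z).
    assert (Hk : (j <= N * k <= j + N - 1)%Z).
    { pose proof (Z.div_mod (j + N - 1) N ltac:(lia)) as E.
      pose proof (Z.mod_pos_bound (j + N - 1) N ltac:(lia)). fold k in E. lia. }
    destruct He as [He _].
    exists (y + k *: e). split.
    + apply (ole_of (osmul_le_l (m := j) (n := N * k) (or_introl He) ltac:(lia))).
      rewrite Ej at 1. omod.
    + refine (ole_trans _ G).
      apply (ole_of (osmul_le_l (m := N * k) (n := j + Z.of_nat (n - 1)) (or_introl He) ltac:(lia))).
      rewrite Ej. omod.
Qed.

(** If [n y] lies between [x_1] and [x_n] in [U], then [0 < y] and all [k y] with [k <= n] stay
    below [z]. There is no winding, and the cyclic statements are linear ones. *)
Lemma regular_c_n_regular n : (2 <= n)%nat ->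
  (regular_dense U \/ exists e, regular_discrete U e) -> c_n_regular n M.
Proof.
  intros Hn HR l Hl HC. cbv zeta.
  destruct (map_cover_surj l) as [xs [<- HI]]. rewrite length_map in Hl.
  rewrite <- (cov_0 _ _ _ _ CV) in HC. change (p 0 :: map p xs) with (map p (0 :: xs)) in HC.
  apply cyc_list_increasing in HC; [|exact HI|lia].
  assert (I : increasing xs).
  { intros i j Hi Hj. apply (HC (S i) (S j)); simpl; lia. }
  assert (P0 : 0 < nth 0 xs 0) by (apply (HC 0%nat 1%nat); simpl; lia).
  rewrite !nth_map_cover.
  destruct (regular_multiple n xs Hn HR Hl I) as [y [H1 H2]].
  set (N := Z.of_nat n) in *.
  pose proof (in_interval_nth xs (n - 1) HI) as [_ HL].
  set (x1 := nth 0 xs 0) in *. set (xn := nth (n - 1) xs 0) in *.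
  assert (Hy : 0 < y).
  { apply (osmul_lt_inv N); [lia|]. rewrite osmul0r. exact (olt_le_trans P0 H1). }
  exists (p y). rewrite cov_nmul with (1 := CV). fold N. split.
  - destruct H1 as [H1|H1]; [|rewrite H1; auto].
    destruct H2 as [H2|H2]; [|rewrite H2; auto].
    right; right. apply cov_cyc_interval.
    + now apply in_interval_nth.
    + split; [left; exact (olt_trans _ _ _ _ P0 H1)|exact (olt_trans _ _ _ _ H2 HL)].
    + now apply in_interval_nth.
    + now left.
  - assert (HK : forall k, (k < n)%nat -> Z.of_nat k *: y < xn).
    { intros k Hk. refine (olt_le_trans _ H2). apply osmul_lt_l; [exact Hy|lia]. }
    assert (E : map (fun k => nmul k (p y)) (seq 0 n) ++ [p xn] =
      map p (map (fun k => Z.of_nat k *: y) (seq 0 n) ++ [xn])).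
    { rewrite map_app, map_map. f_equal. apply map_ext. intros k. now apply cov_nmul with (1 := CV). }
    rewrite E. apply increasing_cyc_list.
    + apply Forall_app. split; [|constructor; [now apply in_interval_nth|constructor]].
      apply Forall_forall. intros u Hu. apply in_map_iff in Hu. destruct Hu as [k [<- Hk]].
      apply in_seq in Hk. split.
      * rewrite <- (osmul0l _ y). apply osmul_le_l; [now left|lia].
      * refine (olt_trans _ _ _ _ (HK k _) HL). lia.
    + assert (NT : forall i, (i < n)%nat ->
        nth i (map (fun k => Z.of_nat k *: y) (seq 0 n) ++ [xn]) 0 = Z.of_nat i *: y).
      { intros i Hi. rewrite app_nth1 by (rewrite length_map, length_seq; exact Hi).
        rewrite (nth_indep _ _ (Z.of_nat 0 *: y)) by (rewrite length_map, length_seq; exact Hi).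
        rewrite (map_nth (fun k => Z.of_nat k *: y) (seq 0 n)).
        now rewrite seq_nth. }
      intros i j Hij Hj. rewrite length_app, length_map, length_seq in Hj. simpl in Hj.
      rewrite NT by lia. destruct (Nat.eq_dec j n) as [->|Hjn].
      * rewrite app_nth2; rewrite length_map, length_seq; [|lia].
        rewrite Nat.sub_diag. simpl. apply HK. lia.
      * rewrite NT by lia. apply osmul_lt_l; [exact Hy|lia].
Qed.

(* The definition of c-n-regularity does not prevent [n x] from winding once
   around the circle, whence the alternative [w = n x - z]. *)
Lemma c_n_regular_extract n a d : (2 <= n)%nat -> c_n_regular n M ->
  0 < a -> 0 < d -> a + (Z.of_nat n - 1) *: d < z ->
  exists x w, 0 < x /\ x < z /\ (w = Z.of_nat n *: x \/ w = Z.of_nat n *: x - z) /\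
    a <= w /\ w <= a + (Z.of_nat n - 1) *: d /\
    (Z.of_nat n - 1) *: x < a + (Z.of_nat n - 1) *: d.
Proof.
  intros Hn HR Ha Hd Hz.
  (* The hypothesis is tested on the arithmetic progression with first term [a], step [d] and [n]
     terms. *)
  set (xs := map (fun i => a + Z.of_nat i *: d) (seq 0 n)).
  assert (LX : length xs = n) by (unfold xs; now rewrite length_map, length_seq).
  assert (NX : forall i, (i < n)%nat -> nth i xs 0 = a + Z.of_nat i *: d).
  { intros i Hi. rewrite (nth_indep _ _ (a + Z.of_nat 0 *: d)) by lia.
    unfold xs. rewrite (map_nth (fun k => a + Z.of_nat k *: d) (seq 0 n)).
    now rewrite seq_nth. }
  assert (PX : forall i, 0 < a + Z.of_nat i *: d).
  { intros i. apply (olt_le_trans Ha).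
    apply (ole_of (osmul_le_l (m := 0) (n := Z.of_nat i) (or_introl Hd) ltac:(lia))). omod. }
  assert (LE : forall i, (i < n)%nat -> a + Z.of_nat i *: d <= a + (Z.of_nat n - 1) *: d).
  { intros i Hi.
    apply (ole_of (osmul_le_l (m := Z.of_nat i) (n := Z.of_nat n - 1) (or_introl Hd) ltac:(lia))). omod. }
  assert (IX : Forall in_interval xs).
  { apply Forall_forall. intros u Hu. apply in_map_iff in Hu. destruct Hu as [k [<- Hk]].
    apply in_seq in Hk. split; [left; apply PX|]. refine (ole_lt_trans (LE k _) Hz). lia. }
  assert (HC : cyc_list (zero :: map p xs)).
  { rewrite <- (cov_0 _ _ _ _ CV). apply (increasing_cyc_list (0 :: xs)).
    - constructor; [apply in_interval_0|exact IX].
    - intros [|i] [|j] Hij Hj; simpl in *; try lia; rewrite ?NX by lia; [apply PX|].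
      apply (olt_of (osmul_lt_l (m := Z.of_nat i) (n := Z.of_nat j) Hd ltac:(lia))). omod. }
  destruct (HR (map p xs)) as [m [Hm HL]]; [now rewrite length_map|exact HC|].
  rewrite !nth_map_cover in Hm. rewrite nth_map_cover in HL.
  rewrite !NX in Hm by lia. rewrite NX in HL by lia.
  replace (Z.of_nat (n - 1)) with (Z.of_nat n - 1)%Z in * by lia.
  set (N := Z.of_nat n) in *. set (xn := a + (N - 1) *: d) in *.
  assert (In : in_interval xn).
  { specialize (in_interval_nth xs (n - 1) IX). rewrite NX by lia.
    replace (Z.of_nat (n - 1)) with (N - 1)%Z by lia. auto. }
  destruct (cov_surj _ _ _ _ CV m) as [x [Hx [Hxz <-]]].
  rewrite cov_nmul with (1 := CV) in Hm. fold N in Hm.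
  assert (EL : map (fun k => nmul k (p x)) (seq 0 n) ++ [p xn] =
      map p (map (fun k => Z.of_nat k *: x) (seq 0 n) ++ [xn])).
  { rewrite map_app, map_map. f_equal. apply map_ext. intros k. now apply cov_nmul with (1 := CV). }
  rewrite EL in HL.
  set (L := map (fun k => Z.of_nat k *: x) (seq 0 n) ++ [xn]) in *.
  assert (LL : length L = S n).
  { unfold L. rewrite length_app, length_map, length_seq. simpl. lia. }
  assert (NL : forall i, (i < n)%nat -> nth i L 0 = Z.of_nat i *: x).
  { intros i Hi. unfold L. rewrite app_nth1 by (rewrite length_map, length_seq; exact Hi).
    rewrite (nth_indep _ _ (Z.of_nat 0 *: x)) by (rewrite length_map, length_seq; exact Hi).
    rewrite (map_nth (fun k => Z.of_nat k *: x) (seq 0 n)).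
    now rewrite seq_nth. }
  assert (NLn : nth n L 0 = xn).
  { unfold L. rewrite app_nth2; rewrite length_map, length_seq; [|lia].
    now rewrite Nat.sub_diag. }
  assert (CL : forall i j, (0 < i)%nat -> (i < j)%nat -> (j <= n)%nat ->
    cyc (p 0) (p (nth i L 0)) (p (nth j L 0))).
  { intros i j H1 H2 H3. specialize (HL 0%nat i j). rewrite length_map, LL, !nth_map_cover in HL.
    rewrite (NL 0%nat) in HL by lia. apply HL; lia. }
  (* The multiples [k x] with [k < n] do not wind: at a first passage of [z], the representative
     [(k + 1) x - z] would lie below [k x], against the prescribed cyclic order. Only the step to
     [n x] escapes this argument. *)
  assert (K : forall k, (1 <= k)%nat -> (k < n)%nat -> 0 < Z.of_nat k *: x /\ Z.of_nat k *: x < z).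
  { induction k as [|k IH]; intros H1 H2; [lia|].
    destruct (Nat.eq_dec k 0) as [->|Hk].
    - split; [|exact Hxz]. specialize (CL 1%nat n ltac:(lia) ltac:(lia) ltac:(lia)).
      rewrite NLn, NL in CL by lia.
      apply cov_cyc_interval in CL; [|apply in_interval_0|now split|exact In].
      apply cyclic_pattern_0 in CL; [apply CL|now split|exact In].
    - destruct IH as [IH1 IH2]; try lia.
      specialize (CL k (S k) ltac:(lia) ltac:(lia) ltac:(lia)).
      rewrite !NL in CL by lia. rewrite Nat2Z.inj_succ, osmul_succ in *.
      set (y := Z.of_nat k *: x) in *. split.
      + apply (olt_le_trans IH1). apply (ole_of Hx). omod.
      + destruct (ole_or_lt z (y + x)) as [W|W]; [exfalso|exact W].
        rewrite <- (cov_period _ _ _ _ CV (y + x)) in CL.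
        assert (I1 : in_interval y) by (split; [now left|exact IH2]).
        assert (I2 : in_interval (y + x - z)).
        { split; [apply (ole_of W); omod|]. apply (olt_of (olt_add2 IH2 Hxz)). omod. }
        apply cov_cyc_interval in CL; [|apply in_interval_0|exact I1|exact I2].
        apply cyclic_pattern_0 in CL; [|exact I1|exact I2]. destruct CL as [_ CL].
        apply (olt_asym CL). apply (olt_of Hxz). omod. }
  assert (K1 := K 1%nat ltac:(lia) ltac:(lia)). change (Z.of_nat 1 *: x) with x in K1.
  specialize (K (n - 1)%nat ltac:(lia) ltac:(lia)).
  specialize (CL (n - 1)%nat n ltac:(lia) ltac:(lia) ltac:(lia)).
  rewrite NLn, NL in CL by lia.
  replace (Z.of_nat (n - 1)) with (N - 1)%Z in * by lia.
  assert (IK : in_interval ((N - 1) *: x)) by (split; [left|]; apply K).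
  apply cov_cyc_interval in CL; [|apply in_interval_0|exact IK|exact In].
  apply cyclic_pattern_0 in CL; [|exact IK|exact In].
  assert (W : exists w, in_interval w /\ p w = p (N *: x) /\ (w = N *: x \/ w = N *: x - z)).
  { destruct (ole_or_lt z (N *: x)) as [W|W].
    - exists (N *: x - z). rewrite (cov_period _ _ _ _ CV). repeat split; auto.
      + apply (ole_of W). omod.
      + apply (olt_of (olt_add2 (proj2 K) Hxz)). omod.
    - exists (N *: x). repeat split; auto. apply (ole_of (osmul_le N (a := 0) (b := x) ltac:(lia) Hx)). omod. }
  destruct W as [w [Iw [Ew Hw]]]. rewrite <- Ew in Hm.
  assert (I0 : in_interval a).
  { specialize (in_interval_nth xs 0 IX). rewrite NX by lia.
    replace (a + Z.of_nat 0 *: d) with a by (change (Z.of_nat 0) with 0%Z; omod). auto. }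
  replace (a + Z.of_nat 0 *: d) with a in Hm by (change (Z.of_nat 0) with 0%Z; omod).
  assert (Hax : a < xn).
  { apply (olt_of (osmul_lt_l (m := 0) (n := N - 1) Hd ltac:(lia))). unfold xn. omod. }
  exists x, w. repeat split; try tauto.
  - destruct Hm as [Hm|[Hm|Hm]].
    + apply (cov_inj _ _ _ _ CV) in Hm; try apply Iw; try apply I0. rewrite Hm. apply ole_refl.
    + apply (cov_inj _ _ _ _ CV) in Hm; try apply Iw; try apply In. rewrite Hm. now left.
    + apply cov_cyc_interval in Hm; auto. destruct Hm as [[Y Z]|[[Y Z]|[Y Z]]].
      * now left.
      * destruct (olt_asym Z Hax).
      * destruct (olt_asym Y Hax).
  - destruct Hm as [Hm|[Hm|Hm]].
    + apply (cov_inj _ _ _ _ CV) in Hm; try apply Iw; try apply I0. rewrite Hm. now left.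
    + apply (cov_inj _ _ _ _ CV) in Hm; try apply Iw; try apply In. rewrite Hm. apply ole_refl.
    + apply cov_cyc_interval in Hm; auto. destruct Hm as [[Y Z]|[[Y Z]|[Y Z]]].
      * now left.
      * destruct (olt_asym Z Hax).
      * destruct (olt_asym Y Hax).
Qed.

(** [U] need not be divisible, so [d] is found inductively: from [n d < x] take [c] between 0 and
    [x - n d], and then the smaller of [c] and [d]. *)
Lemma dense_small (n : nat) (x : U) : densely_ordered U -> 0 < x ->
  exists d, 0 < d /\ d < x /\ Z.of_nat n *: d < x.
Proof.
  intros D Hx. induction n as [|n [d [H1 [H2 H3]]]].
  - destruct (D x Hx) as [d [H1 H2]]. exists d. auto.
  - apply osub_pos in H3. destruct (D _ H3) as [c [C1 C2]].
    assert (S : exists b, 0 < b /\ b <= d /\ b <= c).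
    { destruct (ole_or_lt d c) as [K|K].
      - exists d. auto using ole_refl.
      - exists c. repeat split; auto using ole_refl. now left. }
    destruct S as [b [B1 [B2 B3]]]. exists b. repeat split; auto.
    + exact (ole_lt_trans B2 H2).
    + rewrite Nat2Z.inj_succ, osmul_succ.
      apply (osmul_le (Z.of_nat n)) in B2; [|lia].
      apply (olt_of (olt_le_add2 (olt_le_add2 C2 B3) B2)). omod.
Qed.

Lemma two_small (x y : U) (n : nat) : densely_ordered U -> 0 < x -> 0 < y ->
  exists d, 0 < d /\ Z.of_nat n *: d < x /\ Z.of_nat n *: d < y.
Proof.
  intros D Hx Hy. destruct (ole_or_lt x y) as [K|K].
  - destruct (dense_small n x D Hx) as [d [H1 [_ H2]]]. exists d.
    repeat split; auto. exact (olt_le_trans H2 K).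
  - destruct (dense_small n y D Hy) as [d [H1 [_ H2]]]. exists d.
    repeat split; auto. exact (olt_trans _ _ _ _ H2 K).
Qed.

(** * Density of the multiples, from c-n-regularity *)

Section Dense.
Hypothesis D : densely_ordered U.
Variable n : nat.
Hypothesis Hn : (2 <= n)%nat.
Hypothesis HR : c_n_regular n M.

(* The closure of [n U] for the order topology. *)
Definition near_multiple (u : U) : Prop :=
  forall eps, 0 < eps -> exists y, u - Z.of_nat n *: y < eps /\ Z.of_nat n *: y - u < eps.

(** The progression starts at [r + d] with step [d], where [2 n d] is below both [eps] and [z - r].
    Without winding, [n x] is within [n d] of [r]. With winding, [n x - z >= r + d] and
    [(n - 1) x < r + n d] give [x > z + d - n d], whereas [x <= (n - 1) x < r + n d]; hence
    [z - r < 2 n d], against the choice of [d]. *)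
Lemma near_multiple_interval r : in_interval r -> near_multiple r.
Proof.
  intros [Hr Hrz] eps He. apply osub_pos in Hrz.
  destruct (two_small eps (z - r) (2 * n) D He Hrz) as [d [Hd [D1 D2]]].
  rewrite Nat2Z.inj_mul in D1, D2. change (Z.of_nat 2) with 2%Z in *.
  assert (HnZ : (2 <= Z.of_nat n)%Z) by lia.
  destruct (c_n_regular_extract n (r + d) d Hn HR) as [x [w [X1 [X2 [X3 [X4 [X5 X6]]]]]]].
  - apply (olt_of (olt_le_add2 Hd Hr)). omod.
  - exact Hd.
  - apply (olt_of (olt_le_add2 D2 (osmul_le_l (m := 0) (n := Z.of_nat n) (or_introl Hd) ltac:(lia)))). omod.
  - set (N := Z.of_nat n) in *. clearbody N.
    assert (DN : (N *: d < eps)%oag).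
    { apply (olt_of (olt_le_add2 D1 (osmul_le_l (m := 0) (n := N) (or_introl Hd) ltac:(lia)))). omod. }
    destruct X3 as [-> | ->].
    + exists x. split.
      * apply (ole_lt_trans (b := 0)); [|exact He].
        apply (ole_of (ole_add2 X4 (or_introl Hd))). omod.
      * refine (ole_lt_trans _ DN). apply (ole_of X5). omod.
    + exfalso.
      pose proof (osmul_le_l (m := 1) (n := N - 1) (or_introl X1) ltac:(lia)) as X7.
      apply (olt_irr U 0).
      pose proof (olt_le_add2 (olt_add2 (olt_add2 (olt_add2 D2 X6) X6) Hd) (ole_add2 X4 X7)) as F.
      apply (olt_of F). omod.
Qed.

Lemma near_multiple_add u v : near_multiple u -> near_multiple v -> near_multiple (u + v).
Proof.
  intros Hu Hv eps He. destruct (dense_small 2 eps D He) as [d [Hd [_ D2]]].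
  change (Z.of_nat 2) with 2%Z in D2.
  destruct (Hu d Hd) as [y [Y1 Y2]], (Hv d Hd) as [y' [Y3 Y4]].
  exists (y + y'). split.
  - apply (olt_of (olt_add2 D2 (olt_add2 Y1 Y3))). omod.
  - apply (olt_of (olt_add2 D2 (olt_add2 Y2 Y4))). omod.
Qed.

Lemma near_multiple_opp u : near_multiple u -> near_multiple (- u).
Proof.
  intros Hu eps He. destruct (Hu eps He) as [y [Y1 Y2]].
  exists (- y). split; [apply (olt_of Y2)|apply (olt_of Y1)]; omod.
Qed.

Lemma near_multiple_0 : near_multiple 0.
Proof. apply near_multiple_interval, in_interval_0. Qed.

(** [z] lies outside the half-open interval, so it is approached through [z - d]. *)
Lemma near_multiple_z : near_multiple z.
Proof.
  intros eps He.
  destruct (two_small eps z 2 D He (cov_pos _ _ _ _ CV)) as [d [Hd [D1 D2]]].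
  change (Z.of_nat 2) with 2%Z in *.
  destruct (near_multiple_interval (z - d)) with (eps := d) as [y [Y1 Y2]]; [|exact Hd|].
  - split.
    + left. apply (olt_of (olt_add2 D2 Hd)). omod.
    + apply (olt_of Hd). omod.
  - exists y. split.
    + apply (olt_of (olt_add2 D1 Y1)). omod.
    + apply (olt_of (olt_add2 D1 (olt_add2 (olt_add2 Hd Hd) Y2))). omod.
Qed.

Lemma near_multiple_smul_z (q : Z) : near_multiple (q *: z).
Proof.
  revert q. apply Z.peano_ind.
  - apply near_multiple_0.
  - intros q IH. rewrite osmul_succ. apply near_multiple_add; [exact IH|apply near_multiple_z].
  - intros q IH. rewrite osmul_pred. apply near_multiple_add; [exact IH|].
    apply near_multiple_opp, near_multiple_z.
Qed.

Lemma near_multiple_all u : near_multiple u.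
Proof.
  destruct (cov_rep _ _ _ _ CV u) as [q Hq].
  replace u with (u - q *: z + q *: z) by omod.
  apply near_multiple_add; [now apply near_multiple_interval|apply near_multiple_smul_z].
Qed.

End Dense.

(** With [2 d < v - u], a multiple of [N] within [d] of [u + d] lies strictly between [u] and [v].
    The case [N = 1] is density of the order, as c-n-regularity speaks only of [n >= 2]. *)
Lemma c_regular_regular_dense : densely_ordered U -> c_regular M -> regular_dense U.
Proof.
  intros D [_ HR] N HN u v Huv. apply osub_pos in Huv.
  destruct (Z.eq_dec N 1) as [->|N1].
  - destruct (D _ Huv) as [d [D1 D2]]. exists (u + d). split.
    + apply (olt_of D1). omod.
    + apply (olt_of D2). omod.
  - set (n := Z.to_nat N). assert (En : Z.of_nat n = N) by (unfold n; lia).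
    destruct (dense_small 2 _ D Huv) as [d [Hd [_ D2]]]. change (Z.of_nat 2) with 2%Z in D2.
    destruct (near_multiple_all D n ltac:(lia) (HR n ltac:(lia)) (u + d) d Hd) as [y [Y1 Y2]].
    rewrite En in *. exists y. split.
    + apply (olt_of Y1). omod.
    + apply (olt_of (olt_add2 D2 Y2)). omod.
Qed.

(** * Divisibility modulo the least positive element, from c-n-regularity *)

Section Discrete.
Variable e : U.
Hypothesis He : least_positive e.
Variable n : nat.
Hypothesis Hn : (2 <= n)%nat.
Hypothesis HR : c_n_regular n M.

Definition multiple_mod_e (u : U) : Prop :=
  exists (y : U) (j : Z), u = Z.of_nat n *: y + j *: e.

Lemma multiple_mod_e_e (j : Z) : multiple_mod_e (j *: e).
Proof. exists 0, j. omod. Qed.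

Lemma multiple_mod_e_add u v :
  multiple_mod_e u -> multiple_mod_e v -> multiple_mod_e (u + v).
Proof.
  intros [y [j ->]] [y' [j' ->]]. exists (y + y'), (j + j')%Z. omod.
Qed.

Lemma multiple_mod_e_smul (q : Z) u : multiple_mod_e u -> multiple_mod_e (q *: u).
Proof. intros [y [j ->]]. exists (q *: y), (q * j)%Z. omod. Qed.

(** Without winding, [n x] lies at most [n - 1] steps of [e] above [a]. With winding, the
    inequalities give [a < x], so [a + e <= x]; then [(n - 1)(a + e) <= (n - 1) x < a + (n - 1) e]
    forces [(n - 1) a < a], impossible for [a > 0]. *)
Lemma multiple_mod_e_extract a : 0 < a -> a + (Z.of_nat n - 1) *: e < z -> multiple_mod_e a.
Proof.
  intros Ha Haz. destruct He as [He0 _].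
  destruct (c_n_regular_extract n a e Hn HR Ha He0 Haz) as [x [w [X1 [X2 [X3 [X4 [X5 X6]]]]]]].
  destruct X3 as [-> | ->].
  - destruct (discrete_multiple e (Z.of_nat n *: x - a) (n - 1) He) as [j [_ Hj]].
    + apply (ole_of X4). omod.
    + replace (Z.of_nat (n - 1)) with (Z.of_nat n - 1)%Z by lia. apply (ole_of X5). omod.
    + exists x, (- j)%Z. replace a with (Z.of_nat n *: x - (Z.of_nat n *: x - a)) by omod.
      rewrite Hj. omod.
  - exfalso. assert (HnZ : (2 <= Z.of_nat n)%Z) by lia. set (N := Z.of_nat n) in *. clearbody N.
    assert (X7 : a < x).
    { apply (olt_of (olt_le_add2 (olt_add2 X6 Haz) X4)). omod. }
    apply (discrete_succ e) in X7; [|exact He].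
    apply (osmul_le (N - 1)) in X7; [|lia].
    pose proof (osmul_le_l (m := 1) (n := N - 1) (or_introl Ha) ltac:(lia)) as X8.
    apply (olt_irr U 0). apply (olt_of (olt_le_add2 X6 (ole_add2 X7 X8))). omod.
Qed.

Lemma multiple_mod_e_near r : 0 <= z - r -> z - r <= (Z.of_nat n - 1) *: e ->
  multiple_mod_e z -> multiple_mod_e r.
Proof.
  intros H1 H2 Hz. replace (Z.of_nat n - 1)%Z with (Z.of_nat (n - 1)) in H2 by lia.
  destruct (discrete_multiple e _ _ He H1 H2) as [j [_ Hj]].
  replace r with (z + (-1) *: (z - r)) by omod. rewrite Hj, osmulA.
  apply multiple_mod_e_add; [exact Hz|apply multiple_mod_e_e].
Qed.

Lemma multiple_mod_e_z : multiple_mod_e z.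
Proof.
  destruct (ole_or_lt z (Z.of_nat n *: e)) as [K|K].
  - destruct (discrete_multiple e z n He) as [j [_ ->]]; [left; apply CV|exact K|].
    apply multiple_mod_e_e.
  - replace z with ((z - Z.of_nat n *: e) + Z.of_nat n *: e) by omod.
    apply multiple_mod_e_add; [|apply multiple_mod_e_e].
    apply multiple_mod_e_extract.
    + now apply osub_pos.
    + destruct He as [He0 _]. apply (olt_of He0). omod.
Qed.

(** Extraction needs [n - 1] steps of room below [z]. A representative without that room differs
    from [z] by a multiple of [e], and [z] has been settled separately. *)
Lemma multiple_mod_e_all u : multiple_mod_e u.
Proof.
  destruct (cov_rep _ _ _ _ CV u) as [q [Q1 Q2]].
  replace u with (u - q *: z + q *: z) by omod.
  apply multiple_mod_e_add; [|apply multiple_mod_e_smul, multiple_mod_e_z].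
  set (r := u - q *: z) in *. clearbody r.
  destruct Q1 as [Q1| <-]; [|apply (multiple_mod_e_e 0)].
  destruct (ole_or_lt z (r + (Z.of_nat n - 1) *: e)) as [K|K].
  - apply multiple_mod_e_near; [| |apply multiple_mod_e_z].
    + left. now apply osub_pos.
    + apply (ole_of K). omod.
  - now apply multiple_mod_e_extract.
Qed.

End Discrete.

Lemma c_regular_regular_discrete e :
  least_positive e -> c_regular M -> regular_discrete U e.
Proof.
  intros He [_ HR]. split; [exact He|]. intros N HN u.
  destruct (Z.eq_dec N 1) as [->|N1]; [exists u, 0%Z; omod|].
  rewrite <- (Z2Nat.id N) by lia. apply multiple_mod_e_all; auto; try lia.
  apply HR. lia.
Qed.

End Regularity.

(** For [a] small enough, [b = n a] is shorter than the interval, so the first multiple of [b]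
    beyond [u] falls inside it. *)
Lemma small_elements_regular_dense A (HA : real_subgroup A) :
  (forall eps, (0 < eps)%R -> exists a, A a /\ (0 < a < eps)%R) ->
  regular_dense (real_oag A HA).
Proof.
  intros D n Hn [u Hu] [v Hv] Huv. cbn in Huv. unfold rlt in Huv. simpl in Huv.
  assert (Hn' : (0 < IZR n)%R) by now apply IZR_lt.
  destruct (D ((v - u) / 2 / IZR n)%R) as [a [Aa [a0 a1]]].
  { repeat apply Rdiv_lt_0_compat; lra. }
  assert (a2 : (IZR n * a < (v - u) / 2)%R).
  { apply (Rmult_lt_compat_l (IZR n)) in a1; [|exact Hn'].
    replace (IZR n * ((v - u) / 2 / IZR n))%R with ((v - u) / 2)%R in a1 by (field; lra).
    exact a1. }
  set (b := (IZR n * a)%R) in *.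
  assert (b0 : (0 < b)%R) by now apply Rmult_lt_0_compat.
  destruct (floor_exists (u / b)) as [k [K1 K2]].
  assert (E : u = (u / b * b)%R) by (field; lra).
  assert (L1 : (IZR k * b <= u)%R) by (rewrite E at 1; apply Rmult_le_compat_r; lra).
  assert (L2 : (u < (IZR k + 1) * b)%R) by (rewrite E at 1; apply Rmult_lt_compat_r; lra).
  exists ((k + 1)%Z *: (exist _ a Aa : real_oag A HA))%oag.
  cbn [olt real_oag]. unfold rlt. cbv beta. rewrite !proj1_smul, plus_IZR. cbn [proj1_sig].
  replace (IZR n * ((IZR k + 1) * a))%R with ((IZR k + 1) * b)%R by (unfold b; ring).
  split; [exact L2|lra].
Qed.

Lemma cyclic_regular_discrete (U : oag) (e : U) : (0 < e)%oag ->
  (forall x : U, exists k : Z, (x = k *: e)%oag) -> regular_discrete U e.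
Proof.
  intros He G. split; [split; [exact He|]|].
  - intros x Hx. destruct (G x) as [k ->].
    assert (0 < k)%Z by (apply (osmul_lt_l_inv (x := e) He); exact Hx).
    apply (osmul_le_l (m := 1) (n := k) (or_introl He)). lia.
  - intros n _ u. destruct (G u) as [k ->]. exists 0%oag, k.
    now rewrite osmul0r, oadd0l.
Qed.

Lemma real_subgroup_regular A (HA : real_subgroup A) :
  regular_dense (real_oag A HA) \/ exists e, regular_discrete (real_oag A HA) e.
Proof.
  destruct (real_subgroup_dichotomy A HA) as [D|[g [Hg [Ag G]]]].
  - left. now apply small_elements_regular_dense.
  - right. exists (exist _ g Ag). apply cyclic_regular_discrete; [exact Hg|].
    intros [x Ax]. destruct (G x Ax) as [k E]. exists k.
    apply real_sig_eq. rewrite proj1_smul. exact E.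
Qed.

Lemma c_archimedean_c_regular M : c_archimedean M -> c_regular M.
Proof.
  intros H. split; [apply H|]. intros n Hn.
  destruct (c_archimedean_cover M H) as [A [HA [p CV]]].
  eapply regular_c_n_regular; [exact CV|exact Hn|apply real_subgroup_regular].
Qed.

(** * Back and forth between regular groups *)

Definition same_sign {U V : oag} (x : U) (y : V) : Prop :=
  ((0 < x <-> 0 < y) /\ (x < 0 <-> y < 0))%oag.

(* [C D a b] says that [a] and [b] are congruent modulo [D], in a sense that
   identifies [U / D U] with [V / D V]. The unit [e] is the least positive
   element in the discrete case and 0 in the dense case. *)
Record half_congruence (U V : oag) (e : U) (e' : V) (C : Z -> U -> V -> Prop) : Prop :=
HalfCongruence {
  hc_0 : forall D, C D 0%oag 0%oag;
  hc_add : forall D a b a' b', C D a b -> C D a' b' -> C D (a + a')%oag (b + b')%oag;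
  hc_opp : forall D a b, C D a b -> C D (- a)%oag (- b)%oag;
  hc_shift : forall D a b v, C D a b -> C D a (b + D *: v)%oag;
  hc_total : forall D a, (0 < D)%Z -> exists b, C D a b;
  hc_div : forall c D a b, (0 < c)%Z -> (0 < D)%Z -> C (c * D)%Z (c *: a)%oag b ->
    exists b', b = (c *: b')%oag /\ C D a b';
  hc_weak : forall c D a b, C (c * D)%Z a b -> C D a b;
  hc_unit : forall D, C D e e';
  hc_fill : forall K a b a' b', (0 < K)%Z -> C K a b ->
    (forall j, (Z.abs j <= K)%Z -> same_sign (a' - a + j *: e)%oag (b' - b + j *: e')%oag) ->
    (a < 0)%oag -> (0 < a')%oag -> exists y, (b < K *: y /\ K *: y < b')%oag
}.

(** * Combinations with bounded coefficients *)

Section Span.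
Variables U V : oag.
Local Open Scope oag_scope.

(* [x] and [y] are the same linear combination, with coefficients of absolute
   value at most [B], of the two components of the list [l]. *)
Fixpoint span (B : Z) (l : list (U * V)) (x : U) (y : V) : Prop :=
  match l with
  | [] => x = 0 /\ y = 0
  | ab :: l => exists n x' y', (Z.abs n <= B)%Z /\ span B l x' y' /\
      x = n *: fst ab + x' /\ y = n *: snd ab + y'
  end.

Lemma span_0 B l : (0 <= B)%Z -> span B l 0 0.
Proof.
  intros HB. induction l as [|ab l IH]; simpl; [auto|].
  exists 0%Z, 0, 0. repeat split; [lia|exact IH|symmetry; apply oadd0..].
Qed.

Lemma span_mono B B' l x y : (B <= B')%Z -> span B l x y -> span B' l x y.
Proof.
  intros H. revert x y. induction l as [|ab l IH]; intros x y; simpl; [auto|].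
  intros [n [x' [y' [H1 [H2 [-> ->]]]]]]. exists n, x', y'. repeat split; auto. lia.
Qed.

Lemma span_linear B B' c c' l x y x' y' : span B l x y -> span B' l x' y' ->
  span (Z.abs c * B + Z.abs c' * B') l (c *: x + c' *: x') (c *: y + c' *: y').
Proof.
  revert x y x' y'. induction l as [|[a b] l IH]; intros x y x' y'; simpl.
  - intros [-> ->] [-> ->]. split; omod.
  - intros [n [x1 [y1 [H1 [H2 [-> ->]]]]]] [n' [x2 [y2 [H3 [H4 [-> ->]]]]]].
    exists (c * n + c' * n')%Z, (c *: x1 + c' *: x2), (c *: y1 + c' *: y2).
    repeat split; [|now apply IH|omod|omod].
    assert (Z.abs (c * n) <= Z.abs c * B)%Z by (rewrite Z.abs_mul; apply Z.mul_le_mono_nonneg_l; lia).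
    assert (Z.abs (c' * n') <= Z.abs c' * B')%Z by (rewrite Z.abs_mul; apply Z.mul_le_mono_nonneg_l; lia).
    lia.
Qed.

Lemma span_In B l a b : (1 <= B)%Z -> In (a, b) l -> span B l a b.
Proof.
  intros HB. induction l as [|ab l IH]; simpl; [tauto|]. intros [-> |H].
  - exists 1%Z, 0, 0. repeat split; [lia|apply span_0; lia|cbn [fst snd]; omod..].
  - exists 0%Z, a, b. repeat split; [lia|auto|omod..].
Qed.

(** Bounding the coefficients leaves finitely many constraints on a new element, so a tightest one
    exists. *)
Lemma span_finite B l : exists L, forall x y, span B l x y -> In (x, y) L.
Proof.
  induction l as [|ab l [L IH]].
  - exists [(0, 0)]. intros x y [-> ->]. now left.
  - exists (flat_map (fun n => map (fun xy => (n *: fst ab + fst xy, n *: snd ab + snd xy)) L)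
      (map (fun k => (Z.of_nat k - B)%Z) (seq 0 (Z.to_nat (2 * B + 1))))).
    intros x y [n [x' [y' [H1 [H2 [-> ->]]]]]]. apply in_flat_map. exists n. split.
    + apply in_map_iff. exists (Z.to_nat (n + B)). split; [lia|]. apply in_seq. lia.
    + apply in_map_iff. exists (x', y'). split; [reflexivity|auto].
Qed.

End Span.

Arguments span {U V} B l x y.

Lemma span_swap (U V : oag) B (l : list (U * V)) x y :
  span B l x y <-> span B (map (fun ab => (snd ab, fst ab)) l) y x.
Proof.
  revert x y. induction l as [|[a b] l IH]; intros x y; simpl; [tauto|].
  split; intros [n [x' [y' [H1 [H2 [-> ->]]]]]]; exists n, y', x'; repeat split; auto;
    now apply IH.
Qed.

(** The relation is controlled only on [P]: the comparison of cuts to which this is applied is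
    transitive only among constraints with positive coefficient. *)
Lemma extremum {T : Type} (P : T -> Prop) (R : T -> T -> Prop) (l : list T) :
  (forall x y, P x -> P y -> R x y \/ R y x) ->
  (forall x y t, P x -> P y -> P t -> R x y -> R y t -> R x t) ->
  (exists x, In x l /\ P x) ->
  exists m, P m /\ forall x, In x l -> P x -> R x m.
Proof.
  intros RT RR. assert (RF : forall x, P x -> R x x) by (intros x Hx; destruct (RT x x); auto).
  induction l as [|t l IH]; [intros [x [[] _]]|]. intros [x [Hx Px]].
  destruct (classic (exists y, In y l /\ P y)) as [H|H].
  - destruct (IH H) as [m [Pm Hm]]. destruct (classic (P t)) as [Pt|Pt].
    + destruct (RT t m Pt Pm) as [K|K].
      * exists m. split; [exact Pm|]. intros y [<-|Hy] Py; auto.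
      * exists t. split; [exact Pt|]. intros y [<-|Hy] Py; auto. apply (RR y m t); auto.
    + exists m. split; [exact Pm|]. intros y [<-|Hy] Py; [tauto|auto].
  - destruct Hx as [->|Hx]; [|destruct H; eauto]. exists x. split; [exact Px|].
    intros y [<-|Hy] Py; [auto|destruct H; eauto].
Qed.

Lemma common_multiple (B : Z) : (0 <= B)%Z ->
  exists F, (0 < F)%Z /\ forall c, (1 <= c <= B)%Z -> (c | F)%Z.
Proof.
  intros HB. rewrite <- (Z2Nat.id B HB). generalize (Z.to_nat B). clear. intros n.
  induction n as [|n [F [HF IH]]].
  - exists 1%Z. split; [lia|]. intros c Hc. lia.
  - exists (F * Z.of_nat (S n))%Z. split; [lia|]. intros c Hc.
    destruct (Z.eq_dec c (Z.of_nat (S n))) as [->|N].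
    + apply Z.divide_factor_r.
    + apply Z.divide_mul_l, IH. lia.
Qed.

(** * Extending a correspondence of tuples by one element *)

Section Extension.
Variables (U V : oag) (e : U) (e' : V) (C : Z -> U -> V -> Prop).
Hypothesis HC : half_congruence U V e e' C.
Local Open Scope oag_scope.

Lemma hc_smul D (n : Z) a b : C D a b -> C D (n *: a) (n *: b).
Proof.
  intros H. revert n. apply Z.peano_ind.
  - apply HC.
  - intros n IH. rewrite !osmul_succ. now apply HC.
  - intros n IH. rewrite !osmul_pred. apply HC; [exact IH|now apply HC].
Qed.

(** A position of the Ehrenfeucht-Fraisse game, remembered to precision [B] for signs and [D] for
    residues. Each move costs precision. *)
Definition equivalent_lists (B D : Z) (l : list (U * V)) : Prop :=
  (forall a b, In (a, b) l -> C D a b) /\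
  (forall x y, span B l x y -> same_sign x y).

Lemma span_congruent B D l x y :
  (forall a b, In (a, b) l -> C D a b) -> span B l x y -> C D x y.
Proof.
  revert x y. induction l as [|[a b] l IH]; intros x y H.
  - intros [-> ->]. apply HC.
  - intros [n [x' [y' [H1 [H2 [-> ->]]]]]]. apply (hc_add _ _ _ _ _ HC).
    + apply hc_smul, H. now left.
    + apply IH; [|exact H2]. intros ? ? ?. apply H. now right.
Qed.

Lemma same_sign_pos (x : U) (y : V) : same_sign x y -> 0 < x -> 0 < y.
Proof. unfold same_sign. tauto. Qed.
Lemma same_sign_neg (x : U) (y : V) : same_sign x y -> x < 0 -> y < 0.
Proof. unfold same_sign. tauto. Qed.
Lemma same_sign_zero (x : U) (y : V) : same_sign x y -> x = 0 -> y = 0.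
Proof.
  intros [H1 H2] ->. destruct (olt_total V y 0) as [K|[K|K]]; [|exact K|].
  - apply H2 in K. destruct (olt_irr _ _ K).
  - apply H1 in K. destruct (olt_irr _ _ K).
Qed.
Lemma same_sign_nonneg (x : U) (y : V) : same_sign x y -> 0 <= x -> 0 <= y.
Proof.
  intros H [K|K]; [left; now apply (same_sign_pos x)|right].
  symmetry. apply (same_sign_zero x); auto.
Qed.
Lemma same_sign_intro (x : U) (y : V) :
  (0 < x -> 0 < y) -> (x = 0 -> y = 0) -> (x < 0 -> y < 0) -> same_sign x y.
Proof.
  intros H1 H2 H3. destruct (olt_total U 0 x) as [K|[K|K]].
  - pose proof (H1 K). split; split; intros L; auto; exfalso.
    exact (olt_asym H L).
  - symmetry in K. rewrite (H2 K), K. split; split; intros L; destruct (olt_irr _ _ L).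
  - pose proof (H3 K). split; split; intros L; auto; exfalso.
    exact (olt_asym H L).
Qed.

Section OneStep.
Variables (B D F B' : Z) (z : U) (z' : V) (l : list (U * V)) (a : U).
Hypothesis HB : (1 <= B)%Z.
Hypothesis HD : (1 <= D)%Z.
Hypothesis HF : (0 < F)%Z.
Hypothesis HFd : forall c, (1 <= c <= B)%Z -> (c | F)%Z.
Hypothesis HB' : (2 * B * B + B * B * D <= B')%Z.
Hypothesis Hl : equivalent_lists B' (F * F * D) l.
Hypothesis Hz : In (z, z') l.
Hypothesis Hu : In (e, e') l.
Hypothesis Ha : 0 <= a.
Hypothesis Haz : a < z.

(** Constraints with negative coefficient on [a] are opposites of those with positive coefficient,
    and coefficient 0 is covered by the old list. *)
Lemma one_step_from (b : V) : C D a b ->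
  (forall c x y, (1 <= c <= B)%Z -> span B l x y -> same_sign (c *: a + x) (c *: b + y)) ->
  equivalent_lists B D ((a, b) :: l).
Proof.
  intros Hab H. split.
  - intros x y [E|K]; [now injection E as <- <-|].
    apply (hc_weak _ _ _ _ _ HC (F * F)). now apply Hl.
  - intros x y [n [x' [y' [H1 [H2 [-> ->]]]]]]. simpl.
    destruct (Z.lt_trichotomy n 0) as [K|[-> |K]].
    + destruct (H (- n)%Z ((-1) *: x' + 0 *: x') ((-1) *: y' + 0 *: y')) as [S1 S2]; [lia| |].
      { pose proof (span_linear U V B 0 (-1) 0 l x' y' _ _ H2 (span_0 U V 0 l ltac:(lia))) as S.
        apply (span_mono U V (Z.abs (-1) * B + Z.abs 0 * 0)); [lia|].
        replace ((-1) *: x' + 0 *: x') with ((-1) *: x' + 0 *: 0) by omod.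
        replace ((-1) *: y' + 0 *: y') with ((-1) *: y' + 0 *: 0) by omod. exact S. }
      assert (N : forall (G : oag) (g h : G), (- n)%Z *: g + ((-1) *: h + 0 *: h) = - (n *: g + h))
        by (intros; omod).
      rewrite !N in S1, S2. unfold same_sign.
      rewrite <- !oopp_pos, ?ooppK in S1.
      assert (O : forall (G : oag) (g : G), - g < 0 <-> 0 < g).
      { intros G g. rewrite oopp_pos, ooppK. tauto. }
      rewrite !O in S2. tauto.
    + rewrite !osmul0l, !oadd0l. apply Hl. apply (span_mono U V B); [nia|exact H2].
    + apply H; [lia|exact H2].
Qed.

(** Eliminating [a] from [c1 a + x1] and [c2 a + x2] leaves a combination with coefficients up to
    [2 B^2]. The slack [j e], needed for [hc_fill] with [K = c1 c2 D], adds up to [B^2 D]. Together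
    these give the bound on [B']. *)
Lemma span_diff c1 c2 x1 y1 x2 y2 j : (0 <= c1 <= B)%Z -> (0 <= c2 <= B)%Z ->
  (Z.abs j <= B * B * D)%Z -> span B l x1 y1 -> span B l x2 y2 ->
  same_sign (c2 *: x1 - c1 *: x2 + j *: e) (c2 *: y1 - c1 *: y2 + j *: e').
Proof.
  intros H1 H2 Hj S1 S2.
  pose proof (span_linear U V _ _ c2 (- c1) l _ _ _ _ S1 S2) as S.
  pose proof (span_linear U V _ _ 1 j l _ _ _ _ S (span_In U V 1 l e e' ltac:(lia) Hu)) as S'.
  apply (span_mono U V _ B') in S'; [|nia].
  apply Hl in S'. revert S'.
  replace (1 *: (c2 *: x1 + (- c1)%Z *: x2) + j *: e) with (c2 *: x1 - c1 *: x2 + j *: e) by omod.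
  replace (1 *: (c2 *: y1 + (- c1)%Z *: y2) + j *: e') with (c2 *: y1 - c1 *: y2 + j *: e') by omod.
  auto.
Qed.

Lemma span_diff0 c1 c2 x1 y1 x2 y2 : (0 <= c1 <= B)%Z -> (0 <= c2 <= B)%Z ->
  span B l x1 y1 -> span B l x2 y2 ->
  same_sign (c2 *: x1 - c1 *: x2) (c2 *: y1 - c1 *: y2).
Proof.
  intros H1 H2 S1 S2. pose proof (span_diff c1 c2 x1 y1 x2 y2 0 H1 H2 ltac:(nia) S1 S2) as S.
  now rewrite !osmul0l, !oadd0 in S.
Qed.

(** Here [a] is determined by [c a = -x], so its partner must solve [c b = -y]. Since [-y] is
    congruent to [c a] modulo a multiple of [c D], [hc_div] provides the solution together with its
    residue. The remaining signs follow after multiplication by [c], which eliminates [a] and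
    [b]. *)
Lemma one_step_algebraic c x y : (1 <= c <= B)%Z -> span B l x y ->
  c *: a + x = 0 -> exists b, equivalent_lists B D ((a, b) :: l).
Proof.
  intros Hc S E. destruct (HFd c Hc) as [f Hf].
  assert (K : C (c * (f * F * D))%Z (c *: a) (- y)).
  { replace (c * (f * F * D))%Z with (F * F * D)%Z by (rewrite Hf at 1; ring).
    replace (c *: a) with (- x).
    - apply HC. apply (span_congruent B _ l); [apply Hl|exact S].
    - apply (oadd_cancel _ x). rewrite E. omod. }
  assert (f0 : (0 < f)%Z) by nia.
  apply (hc_div _ _ _ _ _ HC) in K;
    [|lia|apply Z.mul_pos_pos; [now apply Z.mul_pos_pos|lia]].
  destruct K as [b [Eb K]]. exists b. apply one_step_from.
  - now apply (hc_weak _ _ _ _ _ HC (f * F)).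
  - intros c' x' y' Hc' S'.
    pose proof (span_diff0 c' c x' y' x y ltac:(lia) ltac:(lia) S' S) as Q.
    assert (EU : c *: (c' *: a + x') = c *: x' - c' *: x).
    { replace (c *: (c' *: a + x')) with (c' *: (c *: a + x) + (c *: x' - c' *: x)) by omod.
      rewrite E. omod. }
    assert (EV : c *: (c' *: b + y') = c *: y' - c' *: y).
    { replace (c *: (c' *: b + y')) with (c' *: (c *: b) + c *: y') by omod.
      rewrite <- Eb. omod. }
    rewrite <- EU, <- EV in Q. clear - Q Hc.
    assert (P : forall (G : oag) (g : G), 0 < c *: g <-> 0 < g).
    { intros G g. split; intros H; [apply (osmul_lt_inv c)|apply osmul_pos]; auto; try lia.
      now rewrite osmul0r. }
    assert (N : forall (G : oag) (g : G), c *: g < 0 <-> g < 0).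
    { intros G g. rewrite !oopp_pos, <- osmulNr. apply P. }
    unfold same_sign in *. rewrite !P, !N in Q. exact Q.
Qed.

(* Among the finitely many cuts determined by the constraints [c a + x > 0]
   and [c a + x < 0], one lower and one upper constraint imply all others. *)
Lemma one_step_cut :
  (forall c x y, (1 <= c <= B)%Z -> span B l x y -> c *: a + x <> 0) ->
  exists b, equivalent_lists B D ((a, b) :: l).
Proof.
  intros NE.
  set (T := (Z * (U * V))%type).
  destruct (span_finite U V B l) as [L HL].
  set (LT := list_prod (map Z.of_nat (seq 0 (Z.to_nat (B + 1)))) L : list T).
  assert (HLT : forall c x y, (1 <= c <= B)%Z -> span B l x y -> In (c, (x, y)) LT).
  { intros c x y Hc S. apply in_prod; [|auto]. apply in_map_iff. exists (Z.to_nat c).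
    split; [lia|]. apply in_seq. lia. }
  set (ok := fun t : T => (1 <= fst t <= B)%Z /\ span B l (fst (snd t)) (snd (snd t))).
  (* A constraint [(c, (x, y))] cuts at [-x / c]; with denominators cleared, [le s t] says that the
     cut of [s] is not above that of [t]. *)
  set (le := fun s t : T => fst s *: fst (snd t) <= fst t *: fst (snd s)).
  assert (TOT : forall s t, le s t \/ le t s).
  { intros s t. unfold le. destruct (ole_or_lt (fst s *: fst (snd t)) (fst t *: fst (snd s))).
    - now left.
    - right; now left. }
  assert (TR : forall s t r, ok s -> ok t -> ok r -> le s t -> le t r -> le s r).
  { intros [c1 [x1 y1]] [c2 [x2 y2]] [c3 [x3 y3]] [O1 _] [O2 _] [O3 _].
    unfold le; simpl in *. intros H K. apply (osmul_le_inv c2); [lia|].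
    apply (osmul_le c3) in H; [|lia]. apply (osmul_le c1) in K; [|lia].
    apply (ole_of (ole_add2 H K)). omod. }
  destruct (extremum (fun t => ok t /\ 0 < fst t *: a + fst (snd t)) le LT)
    as [[c1 [x1 y1]] [[[O1 S1] P1] M1]].
  { auto. }
  { intros s t r [? _] [? _] [? _]. eauto. }
  (* The constraint [a > 0] is a lower one, the value [a = 0] being excluded by [NE]. Below, [a < z]
     serves as an upper one. *)
  { exists (1%Z, (0, 0)). assert (span B l 0 0) by (apply span_0; lia).
    split; [apply HLT; [lia|auto]|]. split; [split; simpl; [lia|auto]|]. simpl.
    destruct Ha as [Ha'|Ha']; [now rewrite oadd0|].
    destruct (NE 1%Z 0 0); [lia|auto|]. rewrite <- Ha'. omod. }
  destruct (extremum (fun t => ok t /\ fst t *: a + fst (snd t) < 0) (fun s t => le t s) LT)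
    as [[c2 [x2 y2]] [[[O2 S2] P2] M2]].
  { intros s t _ _. destruct (TOT s t); auto. }
  { intros s t r [? _] [? _] [? _]. eauto. }
  { assert (SZ : span B l (- z) (- z')).
    { pose proof (span_linear U V 1 0 (-1) 0 l z z' 0 0
        (span_In U V 1 l z z' ltac:(lia) Hz) (span_0 U V 0 l ltac:(lia))) as S.
      apply (span_mono U V _ B) in S; [|lia].
      replace (- z) with ((-1) *: z + 0 *: 0) by omod.
      replace (- z') with ((-1) *: z' + 0 *: 0) by omod. exact S. }
    exists (1%Z, (- z, - z')).
    split; [apply HLT; [lia|exact SZ]|]. split; [split; simpl; [lia|exact SZ]|]. simpl.
    apply (olt_of Haz). omod. }
  cbn [fst snd ok] in *.
  destruct (HFd c1 O1) as [f1 F1], (HFd c2 O2) as [f2 F2].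
  (* The partner is sought as [b0 + D t] with [b0] in the residue class matching [a]. Multiplying
     [-y1 / c1 < b0 + D t < -y2 / c2] by [c1 c2] turns this into placing the multiple [K t] in an
     interval. The modulus [F F D] is divisible by every such [K]. *)
  set (K := (c1 * c2 * D)%Z).
  assert (HK : (0 < K <= B * B * D)%Z).
  { unfold K. split; [apply Z.mul_pos_pos; [apply Z.mul_pos_pos|]; lia|].
    apply Z.mul_le_mono_nonneg_r; [lia|]. apply Z.mul_le_mono_nonneg; lia. }
  destruct (hc_total _ _ _ _ _ HC (F * F * D)%Z a) as [b0 Hb0].
  { apply Z.mul_pos_pos; [apply Z.mul_pos_pos|]; lia. }
  assert (CK : forall x y, C (F * F * D)%Z x y -> C K x y).
  { intros x y H. apply (hc_weak _ _ _ _ _ HC (f1 * f2)).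
    replace (f1 * f2 * K)%Z with (F * F * D)%Z; [exact H|].
    unfold K. rewrite F1 at 1. rewrite F2. ring. }
  destruct (hc_fill _ _ _ _ _ HC K
     (- (c2 *: x1) - (c1 * c2) *: a) (- (c2 *: y1) - (c1 * c2) *: b0)
     (- (c1 *: x2) - (c1 * c2) *: a) (- (c1 *: y2) - (c1 * c2) *: b0)) as [t [T1 T2]].
  { lia. }
  { apply (hc_add _ _ _ _ _ HC); apply HC, hc_smul, CK; [|exact Hb0].
    apply (span_congruent B _ l); [apply Hl|exact S1]. }
  { intros j Hj.
    pose proof (span_diff c1 c2 x1 y1 x2 y2 j ltac:(lia) ltac:(lia) ltac:(lia) S1 S2) as S.
    match goal with |- same_sign ?g ?h =>
      replace g with (c2 *: x1 - c1 *: x2 + j *: e) by omod;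
      replace h with (c2 *: y1 - c1 *: y2 + j *: e') by omod end. exact S. }
  { apply (osmul_lt c2) in P1; [|lia]. apply (olt_of P1). omod. }
  { apply (osmul_lt c1) in P2; [|lia]. apply (olt_of P2). omod. }
  set (b := b0 + D *: t).
  assert (Q1 : 0 < c1 *: b + y1).
  { apply (osmul_lt_inv c2); [lia|]. apply (olt_of T1). unfold b, K. omod. }
  assert (Q2 : c2 *: b + y2 < 0).
  { apply (osmul_lt_inv c1); [lia|]. apply (olt_of T2). unfold b, K. omod. }
  exists b. apply one_step_from.
  - apply (hc_shift _ _ _ _ _ HC). now apply (hc_weak _ _ _ _ _ HC (F * F)).
  - intros c x y Hc S. specialize (HLT c x y Hc S). apply same_sign_intro.
    + intros P. specialize (M1 (c, (x, y)) HLT). unfold le, ok in M1. cbn [fst snd] in M1.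
      assert (M : 0 <= c1 *: x - c *: x1).
      { apply (ole_of (M1 (conj (conj Hc S) P))). omod. }
      apply (same_sign_nonneg _ (c1 *: y - c *: y1)) in M; [|apply span_diff0; auto; lia].
      apply (osmul_lt_inv c1); [lia|]. apply (osmul_lt c) in Q1; [|lia].
      apply (olt_of (olt_le_add2 Q1 M)). omod.
    + intros P. destruct (NE c x y Hc S P).
    + intros P. specialize (M2 (c, (x, y)) HLT). unfold le, ok in M2. cbn [fst snd] in M2.
      assert (M : 0 <= c *: x2 - c2 *: x).
      { apply (ole_of (M2 (conj (conj Hc S) P))). omod. }
      apply (same_sign_nonneg _ (c *: y2 - c2 *: y)) in M; [|apply span_diff0; auto; lia].
      apply (osmul_lt_inv c2); [lia|]. apply (osmul_lt c) in Q2; [|lia].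
      apply (olt_of (olt_le_add2 Q2 M)). omod.
Qed.

Lemma one_step : exists b, equivalent_lists B D ((a, b) :: l).
Proof.
  destruct (classic (exists c x y, (1 <= c <= B)%Z /\ span B l x y /\ c *: a + x = 0))
    as [[c [x [y [Hc [S E]]]]]|N].
  - now apply (one_step_algebraic c x y).
  - apply one_step_cut. intros c x y Hc S E. apply N. eauto 6.
Qed.

End OneStep.
End Extension.

Arguments equivalent_lists {U V} C B D l.

(** The new bounds depend on [B] and [D] alone and precede the groups, so they can be iterated along
    a formula. [F] is a common multiple of all coefficients up to [B], squared because two
    constraints are combined. *)
Lemma one_step_bounds (B D : Z) : (1 <= B)%Z -> (1 <= D)%Z ->
  exists B' D' : Z, (1 <= B')%Z /\ (1 <= D')%Z /\
  forall U V e e' C, half_congruence U V e e' C ->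
  forall z z' l a, equivalent_lists C B' D' l -> In (z, z') l -> In (e, e') l ->
  (0 <= a)%oag -> (a < z)%oag -> exists b, equivalent_lists C B D ((a, b) :: l).
Proof.
  intros HB HD. destruct (common_multiple B) as [F [HF HFd]]; [lia|].
  exists (2 * B * B + B * B * D)%Z, (F * F * D)%Z.
  split; [nia|]. split; [nia|].
  intros U V e e' C HC z z' l a Hl Hz Hu Ha Haz.
  eapply (one_step U V e e' C HC B D F (2 * B * B + B * B * D) z z'); eauto. lia.
Qed.

Lemma equivalent_lists_mono (U V : oag) e e' C B B' D D' (l : list (U * V)) :
  half_congruence U V e e' C -> (B <= B')%Z ->
  equivalent_lists C B' (D' * D) l -> equivalent_lists C B D l.
Proof.
  intros HC HB [H1 H2]. split.
  - intros a b H. apply (hc_weak _ _ _ _ _ HC D'). auto.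
  - intros x y S. apply H2. now apply (span_mono U V B).
Qed.

(** Holding half congruences in both directions makes the data symmetric: the back move is the forth
    move in [swap_setting]. *)
Record setting : Type := Setting {
  sU : oag; sV : oag; sM : structure; sN : structure;
  su : sU; sv : sV; sz : sU; sz' : sV;
  sp : sU -> sM; sq : sV -> sN;
  sC : Z -> sU -> sV -> Prop;
  s_cov : cover sU sz sM sp;
  s_cov' : cover sV sz' sN sq;
  s_half : half_congruence sU sV su sv sC;
  s_half' : half_congruence sV sU sv su (fun D b a => sC D a b)
}.

Definition swap_setting (S : setting) : setting :=
  Setting (sV S) (sU S) (sN S) (sM S) (sv S) (su S) (sz' S) (sz S) (sq S) (sp S)
    (fun D b a => sC S D a b) (s_cov' S) (s_cov S) (s_half' S) (s_half S).

Definition swap_list {U V : Type} (l : list (U * V)) : list (V * U) :=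
  map (fun ab => (snd ab, fst ab)) l.

Lemma equivalent_lists_swap (U V : oag) C B D (l : list (U * V)) :
  equivalent_lists C B D l -> equivalent_lists (fun D b a => C D a b) B D (swap_list l).
Proof.
  intros [H1 H2]. split.
  - intros b a H. apply in_map_iff in H. destruct H as [[a' b'] [E H]].
    injection E as <- <-. auto.
  - intros y x S. apply (span_swap U V B l x y) in S.
    apply H2 in S. unfold same_sign in *. tauto.
Qed.

(** * Transfer of satisfaction along the back and forth *)

Section Transfer.
Local Open Scope oag_scope.

(** [z] and the unit are constants of every position. They stand at the end so that entry [i] of [l]
    remains the value of variable [i]. *)
Definition full_list (S : setting) (l : list (sU S * sV S)) : list (sU S * sV S) :=
  l ++ [(sz S, sz' S); (su S, sv S)].

Definition represents (S : setting) (l : list (sU S * sV S))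
    (v : nat -> sM S) (w : nat -> sN S) (k : nat) : Prop :=
  forall i, (i < k)%nat -> exists a b, nth_error l i = Some (a, b) /\
    v i = sp S a /\ w i = sq S b /\
    in_interval (sU S) (sz S) a /\ in_interval (sV S) (sz' S) b.

Lemma full_list_z S l : In (sz S, sz' S) (full_list S l).
Proof. apply in_or_app. right. now left. Qed.

Lemma full_list_u S l : In (su S, sv S) (full_list S l).
Proof. apply in_or_app. right. right. now left. Qed.

(** Each operation on representatives corrects by at most one [z], so the value of a term is a
    combination with coefficients bounded in terms of the term. Whether a correction occurs depends
    on the sign of a combination, hence is the same on both sides. *)
Lemma term_representatives k t : term_below k t -> exists B : Z, (1 <= B)%Z /\
  forall S D l v w, represents S l v w k ->
  equivalent_lists (sC S) B D (full_list S l) ->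
  exists x y, span B (full_list S l) x y /\
    eval (sM S) v t = sp S x /\ eval (sN S) w t = sq S y /\
    in_interval (sU S) (sz S) x /\ in_interval (sV S) (sz' S) y.
Proof.
  induction t as [i| |s IHs t IHt|t IHt]; simpl; intros Hk.
  - exists 1%Z. split; [lia|]. intros S D l v w R _.
    destruct (R i Hk) as [a [b [H1 [H2 [H3 [H4 H5]]]]]]. exists a, b.
    repeat (split; [|auto]). apply span_In; [lia|].
    apply in_or_app. left. eapply nth_error_In. eassumption.
  - exists 1%Z. split; [lia|]. intros S D l v w _ _. exists 0, 0.
    split; [apply span_0; lia|].
    split; [symmetry; apply (cov_0 _ _ _ _ (s_cov S))|].
    split; [symmetry; apply (cov_0 _ _ _ _ (s_cov' S))|].
    split; eapply in_interval_0; [apply s_cov|apply s_cov'].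
  - destruct Hk as [Hs Ht]. destruct (IHs Hs) as [B1 [HB1 H1]], (IHt Ht) as [B2 [HB2 H2]].
    exists (B1 + B2 + 1)%Z. split; [lia|]. intros S D l v w R E.
    assert (E1 : equivalent_lists (sC S) B1 D (full_list S l)).
    { apply (equivalent_lists_mono _ _ _ _ _ _ (B1 + B2 + 1) D 1 _ (s_half S)); [lia|].
      now rewrite Z.mul_1_l. }
    assert (E2 : equivalent_lists (sC S) B2 D (full_list S l)).
    { apply (equivalent_lists_mono _ _ _ _ _ _ (B1 + B2 + 1) D 1 _ (s_half S)); [lia|].
      now rewrite Z.mul_1_l. }
    destruct (H1 S D l v w R E1) as [x1 [y1 [S1 [-> [-> [[X1 X1'] [Y1 Y1']]]]]]].
    destruct (H2 S D l v w R E2) as [x2 [y2 [S2 [-> [-> [[X2 X2'] [Y2 Y2']]]]]]].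
    pose proof (span_linear _ _ _ _ 1 1 _ _ _ _ _ S1 S2) as SS.
    pose proof (span_linear _ _ _ _ 1 (-1) _ _ _ _ _ SS
      (span_In _ _ 1 _ _ _ ltac:(lia) (full_list_z S l))) as SZ.
    apply (span_mono _ _ _ (B1 + B2 + 1)) in SS; [|lia].
    apply (span_mono _ _ _ (B1 + B2 + 1)) in SZ; [|lia].
    replace (1 *: x1 + 1 *: x2) with (x1 + x2) in SS by omod.
    replace (1 *: y1 + 1 *: y2) with (y1 + y2) in SS by omod.
    replace (1 *: (1 *: x1 + 1 *: x2) + (-1) *: sz S) with (x1 + x2 - sz S) in SZ by omod.
    replace (1 *: (1 *: y1 + 1 *: y2) + (-1) *: sz' S) with (y1 + y2 - sz' S) in SZ by omod.
    destruct E as [_ E]. pose proof (E _ _ SZ) as G.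
    rewrite <- (cov_add _ _ _ _ (s_cov S)), <- (cov_add _ _ _ _ (s_cov' S)).
    destruct (ole_or_lt 0 (x1 + x2 - sz S)) as [W|W].
    + exists (x1 + x2 - sz S), (y1 + y2 - sz' S).
      rewrite (cov_period _ _ _ _ (s_cov S)), (cov_period _ _ _ _ (s_cov' S)).
      split; [exact SZ|]. split; [reflexivity|]. split; [reflexivity|].
      split; split.
      * exact W.
      * apply (olt_of (olt_add2 X1' X2')). omod.
      * exact (same_sign_nonneg _ _ _ _ G W).
      * apply (olt_of (olt_add2 Y1' Y2')). omod.
    + exists (x1 + x2), (y1 + y2). split; [exact SS|]. split; [reflexivity|]. split; [reflexivity|].
      split; split.
      * apply (ole_of (ole_add2 X1 X2)). omod.
      * apply (olt_of W). omod.
      * apply (ole_of (ole_add2 Y1 Y2)). omod.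
      * apply (same_sign_neg _ _ _ _ G) in W. apply (olt_of W). omod.
  - destruct (IHt Hk) as [B [HB H]]. exists (B + 1)%Z. split; [lia|]. intros S D l v w R E.
    assert (E1 : equivalent_lists (sC S) B D (full_list S l)).
    { apply (equivalent_lists_mono _ _ _ _ _ _ (B + 1) D 1 _ (s_half S)); [lia|].
      now rewrite Z.mul_1_l. }
    destruct (H S D l v w R E1) as [x [y [S1 [-> [-> [[X1 X2] [Y1 Y2]]]]]]].
    destruct E1 as [_ E1]. pose proof (E1 _ _ S1) as G.
    rewrite <- (cov_opp _ _ _ _ (s_cov S)), <- (cov_opp _ _ _ _ (s_cov' S)).
    destruct X1 as [X1|X1].
    + pose proof (same_sign_pos _ _ _ _ G X1) as Y1'.
      exists (sz S - x), (sz' S - y). split; [|split; [|split; [|split; split]]].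
      * pose proof (span_linear _ _ _ _ (-1) 1 _ _ _ _ _ S1
          (span_In _ _ 1 _ _ _ ltac:(lia) (full_list_z S l))) as SZ.
        apply (span_mono _ _ _ (B + 1)) in SZ; [|lia].
        replace (sz S - x) with ((-1) *: x + 1 *: sz S) by omod.
        replace (sz' S - y) with ((-1) *: y + 1 *: sz' S) by omod. exact SZ.
      * rewrite <- (cov_period _ _ _ _ (s_cov S) (sz S - x)). f_equal. omod.
      * rewrite <- (cov_period _ _ _ _ (s_cov' S) (sz' S - y)). f_equal. omod.
      * left. now apply osub_pos.
      * apply (olt_of X1). omod.
      * left. now apply osub_pos.
      * apply (olt_of Y1'). omod.
    + assert (y = 0) as -> by (apply (same_sign_zero _ _ _ _ G); auto). subst x.
      rewrite !oopp0. exists 0, 0. split; [apply span_0; lia|].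
      repeat (split; [reflexivity|]).
      split; eapply in_interval_0; [apply s_cov|apply s_cov'].
Qed.

Lemma same_sign_lt (U V : oag) B (l : list (U * V)) x y x' y' :
  (forall x y, span (B + B) l x y -> same_sign x y) -> span B l x y -> span B l x' y' ->
  (x < x' <-> y < y').
Proof.
  intros E S S'. pose proof (span_linear _ _ _ _ (-1) 1 _ _ _ _ _ S S') as SS.
  apply (span_mono _ _ _ (B + B)) in SS; [|lia]. apply E in SS. destruct SS as [SS _].
  rewrite <- (osub_pos U), <- (osub_pos V).
  replace (x' - x) with ((-1) *: x + 1 *: x') by omod.
  replace (y' - y) with ((-1) *: y + 1 *: y') by omod. exact SS.
Qed.

Lemma represents_cons S l v w k a b :
  in_interval (sU S) (sz S) a -> in_interval (sV S) (sz' S) b ->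
  represents S l v w k ->
  represents S ((a, b) :: l) (valuation_cons (sp S a) v) (valuation_cons (sq S b) w) (Datatypes.S k).
Proof.
  intros Ha Hb R [|i] Hi.
  - exists a, b. auto.
  - apply (R i). lia.
Qed.

Lemma represents_swap S l v w k :
  represents S l v w k -> represents (swap_setting S) (swap_list l) w v k.
Proof.
  intros R i Hi. destruct (R i Hi) as [a [b [H1 [H2 [H3 [H4 H5]]]]]].
  exists b, a. repeat (split; [|auto]). unfold swap_list.
  rewrite nth_error_map, H1. reflexivity.
Qed.

Lemma swap_full_list S l : swap_list (full_list S l) = full_list (swap_setting S) (swap_list l).
Proof. unfold full_list, swap_list. now rewrite map_app. Qed.

(** That the partner lies in the interval is itself a sign condition. The bound is raised to
    [B + 1], at least 2, because [same_sign_lt] with bound 1 uses combinations with bound 2. *)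
Lemma one_step_interval B D : (1 <= B)%Z -> (1 <= D)%Z ->
  exists B' D' : Z, (1 <= B')%Z /\ (1 <= D')%Z /\ forall S l a,
  equivalent_lists (sC S) B' D' (full_list S l) -> in_interval (sU S) (sz S) a ->
  exists b, in_interval (sV S) (sz' S) b /\
    equivalent_lists (sC S) B D (full_list S ((a, b) :: l)).
Proof.
  intros HB HD. destruct (one_step_bounds (B + 1) D) as [B' [D' [HB' [HD' H]]]]; [lia|lia|].
  exists B', D'. split; [lia|]. split; [lia|]. intros S l a E [Ha Haz].
  destruct (H _ _ _ _ _ (s_half S) _ _ _ a E (full_list_z S l) (full_list_u S l) Ha Haz) as [b Hb].
  exists b. split.
  - destruct Hb as [_ Hb]. set (l' := (a, b) :: full_list S l) in *.
    assert (S1 : span 1 l' a b) by (apply span_In; [lia|now left]).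
    assert (S2 : span 1 l' (sz S) (sz' S)).
    { apply span_In; [lia|]. right. apply full_list_z. }
    assert (G : forall x y, span (1 + 1) l' x y -> same_sign x y).
    { intros x y K. apply Hb. apply (span_mono _ _ (1 + 1)); [lia|exact K]. }
    split.
    + eapply same_sign_nonneg; [|exact Ha]. apply Hb. apply (span_mono _ _ 1); [lia|exact S1].
    + now apply (same_sign_lt _ _ 1 l' a b (sz S) (sz' S) G).
  - change (full_list S ((a, b) :: l)) with ((a, b) :: full_list S l).
    apply (equivalent_lists_mono _ _ _ _ _ _ (B + 1) D 1 _ (s_half S)); [lia|].
    now rewrite Z.mul_1_l.
Qed.

Definition transfers (f : formula) (k : nat) (B D : Z) : Prop :=
  forall S l v w, represents S l v w k -> equivalent_lists (sC S) B D (full_list S l) ->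
  (sat (sM S) v f <-> sat (sN S) w f).

Lemma transfers_mono f k B B' D D' : transfers f k B D -> (B <= B')%Z ->
  transfers f k B' (D' * D).
Proof.
  intros H HB S l v w R E. apply (H S l v w R).
  exact (equivalent_lists_mono _ _ _ _ _ _ _ _ _ _ (s_half S) HB E).
Qed.

Lemma transfers_both f g k B1 D1 B2 D2 : (1 <= B1)%Z -> (1 <= D1)%Z ->
  (1 <= B2)%Z -> (1 <= D2)%Z -> transfers f k B1 D1 -> transfers g k B2 D2 ->
  exists B D : Z, (1 <= B)%Z /\ (1 <= D)%Z /\ transfers f k B D /\ transfers g k B D.
Proof.
  intros HB1 HD1 HB2 HD2 H1 H2. exists (B1 + B2)%Z, (D2 * D1)%Z.
  split; [lia|]. split; [nia|]. split; [apply (transfers_mono f k B1); auto; lia|].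
  rewrite Z.mul_comm. apply (transfers_mono g k B2); auto; lia.
Qed.

(** Matching elements in both directions is what either quantifier needs, so one statement serves
    [Ex] and [All]. *)
Lemma transfers_Ex f k B D : (1 <= B)%Z -> (1 <= D)%Z -> transfers f (Datatypes.S k) B D ->
  exists B' D' : Z, (1 <= B')%Z /\ (1 <= D')%Z /\
  forall S l v w, represents S l v w k -> equivalent_lists (sC S) B' D' (full_list S l) ->
  (forall m, exists n, sat (sM S) (valuation_cons m v) f <-> sat (sN S) (valuation_cons n w) f) /\
  (forall n, exists m, sat (sM S) (valuation_cons m v) f <-> sat (sN S) (valuation_cons n w) f).
Proof.
  intros HB HD H. destruct (one_step_interval B D HB HD) as [B' [D' [HB' [HD' X]]]].
  exists B', D'. split; [lia|]. split; [lia|]. intros S l v w R E. split.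
  - intros m. destruct (cov_surj _ _ _ _ (s_cov S) m) as [a [A1 [A2 <-]]].
    destruct (X S l a E (conj A1 A2)) as [b [Hb E']]. exists (sq S b).
    apply (H S ((a, b) :: l)); [|exact E']. now apply represents_cons.
  - intros n. destruct (cov_surj _ _ _ _ (s_cov' S) n) as [b [B1 [B2 <-]]].
    assert (E2 : equivalent_lists (sC (swap_setting S)) B' D' (full_list (swap_setting S) (swap_list l))).
    { rewrite <- swap_full_list. now apply equivalent_lists_swap. }
    destruct (X (swap_setting S) (swap_list l) b E2 (conj B1 B2)) as [a [Ha E']].
    exists (sp S a). apply iff_sym. apply (H (swap_setting S) ((b, a) :: swap_list l)); [|exact E'].
    apply (represents_cons (swap_setting S)); [now split|exact Ha|].
    now apply represents_swap.
Qed.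

(** [B] and [D] depend only on the formula and on [k]. Atomic formulas concern signs alone, whence
    [D = 1], and compare two representatives, whence the doubled bound; residues enter through the
    quantifiers. *)
Theorem transfer f k : formula_below k f ->
  exists B D : Z, (1 <= B)%Z /\ (1 <= D)%Z /\ transfers f k B D.
Proof.
  revert k. induction f as [s t|s t u|f IHf|f IHf g IHg|f IHf g IHg|f IHf g IHg|f IHf|f IHf];
    intros k Hk; simpl in Hk.
  - destruct Hk as [Hs Ht].
    destruct (term_representatives k s Hs) as [B1 [HB1 H1]],
             (term_representatives k t Ht) as [B2 [HB2 H2]].
    exists ((B1 + B2) + (B1 + B2))%Z, 1%Z. split; [lia|]. split; [lia|]. intros S l v w R E. simpl.
    destruct (H1 S 1%Z l v w R) as [x1 [y1 [S1 [-> [-> [[X1 X1'] [Y1 Y1']]]]]]].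
    { apply (equivalent_lists_mono _ _ _ _ _ _ (B1 + B2 + (B1 + B2)) 1 1 _ (s_half S)); [lia|exact E]. }
    destruct (H2 S 1%Z l v w R) as [x2 [y2 [S2 [-> [-> [[X2 X2'] [Y2 Y2']]]]]]].
    { apply (equivalent_lists_mono _ _ _ _ _ _ (B1 + B2 + (B1 + B2)) 1 1 _ (s_half S)); [lia|exact E]. }
    apply (span_mono _ _ _ (B1 + B2)) in S1; [|lia].
    apply (span_mono _ _ _ (B1 + B2)) in S2; [|lia].
    destruct E as [_ E].
    pose proof (same_sign_lt _ _ _ _ _ _ _ _ E S1 S2) as L1.
    pose proof (same_sign_lt _ _ _ _ _ _ _ _ E S2 S1) as L2.
    split; intros Q.
    + apply (cov_inj _ _ _ _ (s_cov S)) in Q; auto. subst x2. f_equal.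
      destruct (olt_total _ y1 y2) as [K|[K|K]]; [|exact K|]; exfalso.
      * apply L1 in K. exact (olt_irr _ _ K).
      * apply L2 in K. exact (olt_irr _ _ K).
    + apply (cov_inj _ _ _ _ (s_cov' S)) in Q; auto. subst y2. f_equal.
      destruct (olt_total _ x1 x2) as [K|[K|K]]; [|exact K|]; exfalso.
      * apply L1 in K. exact (olt_irr _ _ K).
      * apply L2 in K. exact (olt_irr _ _ K).
  - destruct Hk as [Hs [Ht Hu]].
    destruct (term_representatives k s Hs) as [B1 [HB1 H1]],
             (term_representatives k t Ht) as [B2 [HB2 H2]],
             (term_representatives k u Hu) as [B3 [HB3 H3]].
    set (B := (B1 + B2 + B3)%Z).
    exists (B + B)%Z, 1%Z. split; [lia|]. split; [lia|]. intros S l v w R E. simpl.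
    destruct (H1 S 1%Z l v w R) as [x1 [y1 [S1 [-> [-> [I1 J1]]]]]].
    { apply (equivalent_lists_mono _ _ _ _ _ _ (B + B) 1 1 _ (s_half S)); [lia|exact E]. }
    destruct (H2 S 1%Z l v w R) as [x2 [y2 [S2 [-> [-> [I2 J2]]]]]].
    { apply (equivalent_lists_mono _ _ _ _ _ _ (B + B) 1 1 _ (s_half S)); [lia|exact E]. }
    destruct (H3 S 1%Z l v w R) as [x3 [y3 [S3 [-> [-> [I3 J3]]]]]].
    { apply (equivalent_lists_mono _ _ _ _ _ _ (B + B) 1 1 _ (s_half S)); [lia|exact E]. }
    apply (span_mono _ _ _ B) in S1; [|lia].
    apply (span_mono _ _ _ B) in S2; [|lia].
    apply (span_mono _ _ _ B) in S3; [|lia].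
    destruct E as [_ E].
    rewrite (cov_cyc_interval _ _ _ _ (s_cov S) _ _ _ I1 I2 I3),
      (cov_cyc_interval _ _ _ _ (s_cov' S) _ _ _ J1 J2 J3).
    unfold cyclic_pattern.
    rewrite (same_sign_lt _ _ _ _ _ _ _ _ E S1 S2), (same_sign_lt _ _ _ _ _ _ _ _ E S2 S3),
      (same_sign_lt _ _ _ _ _ _ _ _ E S3 S1).
    reflexivity.
  - destruct (IHf k Hk) as [B [D [HB [HD H]]]]. exists B, D. split; [lia|]. split; [lia|].
    intros S l v w R E. simpl. now rewrite (H S l v w R E).
  - destruct Hk as [Hf Hg]. destruct (IHf k Hf) as [B1 [D1 [HB1 [HD1 H1]]]],
      (IHg k Hg) as [B2 [D2 [HB2 [HD2 H2]]]].
    destruct (transfers_both f g k B1 D1 B2 D2) as [B [D [HB [HD [K1 K2]]]]]; auto.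
    exists B, D. split; [lia|]. split; [lia|].
    intros S l v w R E. simpl. now rewrite (K1 S l v w R E), (K2 S l v w R E).
  - destruct Hk as [Hf Hg]. destruct (IHf k Hf) as [B1 [D1 [HB1 [HD1 H1]]]],
      (IHg k Hg) as [B2 [D2 [HB2 [HD2 H2]]]].
    destruct (transfers_both f g k B1 D1 B2 D2) as [B [D [HB [HD [K1 K2]]]]]; auto.
    exists B, D. split; [lia|]. split; [lia|].
    intros S l v w R E. simpl. now rewrite (K1 S l v w R E), (K2 S l v w R E).
  - destruct Hk as [Hf Hg]. destruct (IHf k Hf) as [B1 [D1 [HB1 [HD1 H1]]]],
      (IHg k Hg) as [B2 [D2 [HB2 [HD2 H2]]]].
    destruct (transfers_both f g k B1 D1 B2 D2) as [B [D [HB [HD [K1 K2]]]]]; auto.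
    exists B, D. split; [lia|]. split; [lia|].
    intros S l v w R E. simpl. now rewrite (K1 S l v w R E), (K2 S l v w R E).
  - destruct (IHf _ Hk) as [B [D [HB [HD H]]]].
    destruct (transfers_Ex f k B D HB HD H) as [B' [D' [HB' [HD' X]]]].
    exists B', D'. split; [lia|]. split; [lia|]. intros S l v w R E. simpl.
    destruct (X S l v w R E) as [X1 X2]. split; intros Y c.
    + destruct (X2 c) as [m Hm]. apply Hm, Y.
    + destruct (X1 c) as [n Hn]. apply Hn, Y.
  - destruct (IHf _ Hk) as [B [D [HB [HD H]]]].
    destruct (transfers_Ex f k B D HB HD H) as [B' [D' [HB' [HD' X]]]].
    exists B', D'. split; [lia|]. split; [lia|]. intros S l v w R E. simpl.
    destruct (X S l v w R E) as [X1 X2]. split; intros [c Hc].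
    + destruct (X1 c) as [n Hn]. exists n. now apply Hn.
    + destruct (X2 c) as [m Hm]. exists m. now apply Hm.
Qed.

End Transfer.

(** * Countable elementary substructures *)

Module FormulaCoding.
Import mathcomp.boot.choice.

Notation tree := (GenTree.tree nat).

Fixpoint encode_term (t : term) : tree :=
  match t with
  | Var i => GenTree.Leaf i
  | Zero => GenTree.Node 0 []
  | Add s t => GenTree.Node 1 [encode_term s; encode_term t]
  | Opp t => GenTree.Node 2 [encode_term t]
  end.

Fixpoint decode_term (t : tree) : term :=
  match t with
  | GenTree.Leaf i => Var i
  | GenTree.Node 1 [s; t] => Add (decode_term s) (decode_term t)
  | GenTree.Node 2 [t] => Opp (decode_term t)
  | _ => Zero
  end.

Fixpoint encode (f : formula) : tree :=
  match f with
  | Eq s t => GenTree.Node 0 [encode_term s; encode_term t]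
  | Cyc s t u => GenTree.Node 1 [encode_term s; encode_term t; encode_term u]
  | Neg f => GenTree.Node 2 [encode f]
  | And f g => GenTree.Node 3 [encode f; encode g]
  | Or f g => GenTree.Node 4 [encode f; encode g]
  | Imp f g => GenTree.Node 5 [encode f; encode g]
  | All f => GenTree.Node 6 [encode f]
  | Ex f => GenTree.Node 7 [encode f]
  end.

Fixpoint decode (t : tree) : formula :=
  match t with
  | GenTree.Node 0 [s; t] => Eq (decode_term s) (decode_term t)
  | GenTree.Node 1 [s; t; u] => Cyc (decode_term s) (decode_term t) (decode_term u)
  | GenTree.Node 2 [f] => Neg (decode f)
  | GenTree.Node 3 [f; g] => And (decode f) (decode g)
  | GenTree.Node 4 [f; g] => Or (decode f) (decode g)
  | GenTree.Node 5 [f; g] => Imp (decode f) (decode g)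
  | GenTree.Node 6 [f] => All (decode f)
  | GenTree.Node 7 [f] => Ex (decode f)
  | _ => Eq Zero Zero
  end.

Lemma encode_termK t : decode_term (encode_term t) = t.
Proof. induction t; simpl; congruence. Qed.

Lemma encodeK f : decode (encode f) = f.
Proof. induction f; simpl; rewrite ?encode_termK; congruence. Qed.

Lemma tree_surjection : exists c : nat -> tree, forall t, exists n, c n = t.
Proof.
  exists (fun n => match unpickle n with Some t => t | None => GenTree.Leaf 0 end).
  intros t. exists (pickle t). now rewrite pickleK.
Qed.

End FormulaCoding.

Lemma formula_surjection : exists c : nat -> formula, forall f, exists n, c n = f.
Proof.
  destruct FormulaCoding.tree_surjection as [c Hc].
  exists (fun n => FormulaCoding.decode (c n)). intros f.
  destruct (Hc (FormulaCoding.encode f)) as [n Hn]. exists n. rewrite Hn.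
  apply FormulaCoding.encodeK.
Qed.

Lemma eval_ext k t : term_below k t -> forall (M : structure) (v w : nat -> M),
  (forall i, i < k -> v i = w i) -> eval M v t = eval M w t.
Proof.
  intros H M v w E. induction t; simpl in *; auto; f_equal; tauto || auto.
Qed.

Lemma sat_ext k f : formula_below k f -> forall (M : structure) (v w : nat -> M),
  (forall i, i < k -> v i = w i) -> (sat M v f <-> sat M w f).
Proof.
  assert (C : forall k (M : structure) (v w : nat -> M) a,
    (forall i, i < k -> v i = w i) ->
    forall i, i < S k -> valuation_cons a v i = valuation_cons a w i).
  { intros k' M v w a E [|i] Hi; simpl; [reflexivity|]. apply E. lia. }
  revert k. induction f; intros k H M v w E; simpl in *.
  - rewrite (eval_ext k s (proj1 H) M v w E), (eval_ext k t (proj2 H) M v w E). reflexivity.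
  - destruct H as [Hs [Ht Hu]].
    rewrite (eval_ext k s Hs M v w E), (eval_ext k t Ht M v w E), (eval_ext k u Hu M v w E).
    reflexivity.
  - now rewrite (IHf k H M v w E).
  - now rewrite (IHf1 k (proj1 H) M v w E), (IHf2 k (proj2 H) M v w E).
  - now rewrite (IHf1 k (proj1 H) M v w E), (IHf2 k (proj2 H) M v w E).
  - now rewrite (IHf1 k (proj1 H) M v w E), (IHf2 k (proj2 H) M v w E).
  - split; intros K a; apply (IHf (S k) H M _ _ (C k M v w a E)), K.
  - split; intros [a K]; exists a; apply (IHf (S k) H M _ _ (C k M v w a E)), K.
Qed.

Lemma term_bound t : exists k, forall k', k <= k' -> term_below k' t.
Proof.
  induction t as [i| |s [k1 H1] t [k2 H2]|t [k H]].
  - exists (S i). simpl. lia.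
  - exists 0. now simpl.
  - exists (k1 + k2). intros k' Hk. split; [apply H1|apply H2]; lia.
  - exists k. exact H.
Qed.

Lemma formula_bound f : exists k, forall k', k <= k' -> formula_below k' f.
Proof.
  induction f as [s t|s t u|f [k H]|f [k1 H1] g [k2 H2]|f [k1 H1] g [k2 H2]
    |f [k1 H1] g [k2 H2]|f [k H]|f [k H]].
  - destruct (term_bound s) as [k1 H1], (term_bound t) as [k2 H2].
    exists (k1 + k2). intros k' Hk. split; [apply H1|apply H2]; lia.
  - destruct (term_bound s) as [k1 H1], (term_bound t) as [k2 H2], (term_bound u) as [k3 H3].
    exists (k1 + k2 + k3). intros k' Hk. split; [apply H1|split; [apply H2|apply H3]]; lia.
  - exists k. exact H.
  - exists (k1 + k2). intros k' Hk. split; [apply H1|apply H2]; lia.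
  - exists (k1 + k2). intros k' Hk. split; [apply H1|apply H2]; lia.
  - exists (k1 + k2). intros k' Hk. split; [apply H1|apply H2]; lia.
  - exists k. intros k' Hk. apply H. lia.
  - exists k. intros k' Hk. apply H. lia.
Qed.

(** * The Skolem hull of the empty set *)

Section SkolemHull.
Variable M : structure.
Variable code : nat -> formula.
Hypothesis code_surj : forall f, exists n, code n = f.

(* A tree names a chosen witness of a formula whose parameters are named by
   its subtrees. *)
Fixpoint hull (t : FormulaCoding.tree) : M :=
  match t with
  | choice.GenTree.Leaf _ => zero
  | choice.GenTree.Node n l => epsilon (inhabits zero)
      (fun a => sat M (valuation_cons a (valuation_app (map hull l) (fun _ => zero))) (code n))
  end.

Definition in_hull (a : M) : Prop := exists t, hull t = a.

(** A formula has finitely many parameters, so a finite list of trees names all of them and one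
    further node names the chosen witness. *)
Lemma hull_witness f (v : nat -> M) : (forall i, in_hull (v i)) ->
  (exists a, sat M (valuation_cons a v) f) ->
  exists a, in_hull a /\ sat M (valuation_cons a v) f.
Proof.
  intros Hv Ha. destruct (formula_bound f) as [k Hk].
  assert (L : exists l, length l = k /\ forall i, i < k -> nth i (map hull l) zero = v i).
  { clear - Hv. revert v Hv. induction k as [|k IH]; intros v Hv.
    - exists []. split; [reflexivity|lia].
    - destruct (IH (fun i => v (S i))) as [l [L1 L2]]; [intros i; apply Hv|].
      destruct (Hv 0) as [t Ht]. exists (t :: l). split; [simpl; congruence|].
      intros [|i] Hi; simpl; [exact Ht|]. apply L2. lia. }
  destruct L as [l [L1 L2]]. destruct (code_surj f) as [n Hn].
  assert (E : forall a, sat M (valuation_cons a (valuation_app (map hull l) (fun _ => zero))) f <->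
    sat M (valuation_cons a v) f).
  { intros a. apply (sat_ext (S k) f); [apply Hk; lia|]. intros [|i] Hi; simpl; [reflexivity|].
    rewrite (valuation_app_nth _ _ zero); [apply L2; lia|]. rewrite length_map. lia. }
  exists (hull (choice.GenTree.Node n l)). split; [now eexists|].
  apply E. cbn [hull]. rewrite Hn.
  apply (epsilon_spec (inhabits zero)
    (fun a => sat M (valuation_cons a (valuation_app (map hull l) (fun _ => zero))) f)).
  destruct Ha as [a Ha]. exists a. now apply E.
Qed.

(** Sums and opposites are the only witnesses of the equations defining them, so the chosen
    witnesses must be these elements. *)
Lemma in_hull_subgroup : subgroup M in_hull.
Proof.
  split; [|split].
  - now exists (choice.GenTree.Leaf 0).
  - intros a b Ha Hb.
    destruct (hull_witness (Eq (Var 0) (Add (Var 1) (Var 2)))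
      (fun i => if Nat.eqb i 0 then a else b)) as [c [Hc E]].
    + intros i. now destruct (Nat.eqb i 0).
    + now exists (add a b).
    + simpl in E. now subst c.
  - intros a Ha.
    destruct (hull_witness (Eq (Var 0) (Opp (Var 1))) (fun _ => a)) as [c [Hc E]].
    + auto.
    + now exists (opp a).
    + simpl in E. now subst c.
Qed.

Definition hull_structure : structure := substructure M in_hull in_hull_subgroup.

Lemma eval_hull (v : nat -> hull_structure) t :
  proj1_sig (eval hull_structure v t) = eval M (fun i => proj1_sig (v i)) t.
Proof. induction t; simpl; congruence. Qed.

Lemma valuation_cons_hull (v : nat -> hull_structure) (a : hull_structure) f :
  sat M (fun i => proj1_sig (valuation_cons a v i)) f <->
  sat M (valuation_cons (proj1_sig a) (fun i => proj1_sig (v i))) f.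
Proof.
  destruct (formula_bound f) as [k Hk]. apply (sat_ext k f); [apply Hk; lia|].
  intros [|i] _; reflexivity.
Qed.

(** The Tarski-Vaught test: existential witnesses are found in the hull by [W], and the universal
    case applies it to the negation. *)
Lemma hull_elementary f (v : nat -> hull_structure) :
  sat hull_structure v f <-> sat M (fun i => proj1_sig (v i)) f.
Proof.
  assert (W : forall f (v : nat -> hull_structure),
    (exists a, sat M (valuation_cons a (fun i => proj1_sig (v i))) f) ->
    exists a : hull_structure, sat M (valuation_cons (proj1_sig a) (fun i => proj1_sig (v i))) f).
  { intros g w H. destruct (hull_witness g (fun i => proj1_sig (w i))) as [a [Ha Hs]].
    - intros i. apply proj2_sig.
    - exact H.
    - now exists (exist _ a Ha). }
  revert v. induction f as [s t|s t u|f IHf|f IHf g IHg|f IHf g IHg|f IHf g IHg|f IHf|f IHf];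
    intros v; simpl.
  - rewrite <- !eval_hull. split; [congruence|].
    destruct (eval _ v s), (eval _ v t). apply subset_eq_compat.
  - now rewrite !eval_hull.
  - now rewrite IHf.
  - now rewrite IHf, IHg.
  - now rewrite IHf, IHg.
  - now rewrite IHf, IHg.
  - split.
    + intros H. apply NNPP. intros N. apply not_all_ex_not in N.
      destruct (W (Neg f) v N) as [a Ha]. apply Ha.
      apply valuation_cons_hull, IHf, H.
    + intros H a. apply IHf, valuation_cons_hull, H.
  - split.
    + intros [a Ha]. exists (proj1_sig a). now apply valuation_cons_hull, IHf.
    + intros H. apply W in H. destruct H as [a Ha]. exists a.
      now apply IHf, valuation_cons_hull.
Qed.

Lemma hull_countable : exists c : nat -> hull_structure, forall a, exists n, c n = a.
Proof.
  destruct FormulaCoding.tree_surjection as [c Hc].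
  exists (fun n => exist _ (hull (c n)) (ex_intro _ (c n) eq_refl)).
  intros [a [t Ht]]. destruct (Hc t) as [n Hn]. exists n.
  apply subset_eq_compat. now rewrite Hn.
Qed.

End SkolemHull.

Theorem downward_loewenheim_skolem (M : structure) : exists M0 : structure,
  (exists c : nat -> M0, forall a, exists n, c n = a) /\
  (forall f, sentence f -> forall v w, sat M0 v f <-> sat M w f).
Proof.
  destruct formula_surjection as [code Hc].
  exists (hull_structure M code Hc). split; [apply hull_countable|].
  intros f Hf v w. rewrite hull_elementary. apply (sat_ext 0 f Hf). lia.
Qed.

(** * Embedding a countable torsion-free group in the reals *)

Section Avoid.
Local Open Scope R_scope.

(** Cantor's nested intervals. The quarter kept is the outer one in the half away from [x], so that
    even the closed interval omits [x] and the limit of the left ends differs from every term. *)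
Definition avoid_step (I : R * R) (x : R) : R * R :=
  let (a, b) := I in
  if Rle_dec x ((a + b) / 2) then ((a + 3 * b) / 4, b) else (a, (3 * a + b) / 4).

Fixpoint avoid (s : nat -> R) (n : nat) : R * R :=
  match n with
  | O => (0, 1)
  | S n => avoid_step (avoid s n) (s n)
  end.

Lemma avoid_step_spec I x : fst I < snd I ->
  fst I <= fst (avoid_step I x) /\ fst (avoid_step I x) < snd (avoid_step I x) /\
  snd (avoid_step I x) <= snd I /\
  (x < fst (avoid_step I x) \/ snd (avoid_step I x) < x).
Proof.
  destruct I as [a b]. simpl. intros H. destruct (Rle_dec x ((a + b) / 2)); simpl; lra.
Qed.

Lemma exists_not_in_sequence (s : nat -> R) : exists r, forall n, s n <> r.
Proof.
  assert (L : forall n, fst (avoid s n) < snd (avoid s n)).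
  { induction n as [|n IH]; simpl; [lra|]. now apply avoid_step_spec. }
  assert (M1 : forall m n, fst (avoid s m) <= fst (avoid s (m + n))).
  { intros m n. induction n as [|n IH]; [rewrite Nat.add_0_r; lra|].
    rewrite Nat.add_succ_r. simpl.
    pose proof (avoid_step_spec _ (s (m + n)%nat) (L (m + n)%nat)). lra. }
  assert (M2 : forall m n, snd (avoid s (m + n)) <= snd (avoid s m)).
  { intros m n. induction n as [|n IH]; [rewrite Nat.add_0_r; lra|].
    rewrite Nat.add_succ_r. simpl.
    pose proof (avoid_step_spec _ (s (m + n)%nat) (L (m + n)%nat)). lra. }
  assert (MM : forall m n, fst (avoid s m) <= snd (avoid s n)).
  { intros m n. specialize (M1 m n). specialize (M2 n m). rewrite Nat.add_comm in M2.
    specialize (L (m + n)%nat). lra. }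
  destruct (completeness (fun r => exists n, r = fst (avoid s n))) as [r [R1 R2]].
  - exists 1. intros x [n ->]. apply (MM n 0%nat).
  - exists 0, 0%nat. reflexivity.
  - exists r. intros n E.
    assert (fst (avoid s (S n)) <= r) by (apply R1; eauto).
    assert (r <= snd (avoid s (S n))) by (apply R2; intros x [m ->]; apply MM).
    destruct (avoid_step_spec _ (s n) (L n)) as [_ [_ [_ H1]]]. simpl in *. lra.
Qed.

End Avoid.

Section Embedding.
Variable U : oag.
Variable c : nat -> U.
Hypothesis c_surj : forall u, exists n, c n = u.
Implicit Types (u h x : U) (r s t : R) (k : Z).

(* The graph of an injective homomorphism from a subgroup of [U] to [R]. *)
Record partial_embedding (G : U -> R -> Prop) : Prop := PartialEmbedding {
  pe_0 : G 0%oag 0%R;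
  pe_sub : forall u r u' r', G u r -> G u' r' -> G (u - u')%oag (r - r')%R;
  pe_inj : forall u, G u 0%R -> u = 0%oag;
  pe_fun : forall r, G 0%oag r -> r = 0%R
}.

Section Graph.
Variable G : U -> R -> Prop.
Hypothesis HG : partial_embedding G.

Lemma pe_opp u r : G u r -> G (- u)%oag (- r)%R.
Proof.
  intros H. replace (- u)%oag with (0 - u)%oag by omod.
  replace (- r)%R with (0 - r)%R by ring. apply HG; [apply HG|exact H].
Qed.

Lemma pe_add u r u' r' : G u r -> G u' r' -> G (u + u')%oag (r + r')%R.
Proof.
  intros H H'. replace (u + u')%oag with (u - - u')%oag by omod.
  replace (r + r')%R with (r - - r')%R by ring. apply HG; [exact H|now apply pe_opp].
Qed.

Lemma pe_smul k u r : G u r -> G (k *: u)%oag (IZR k * r)%R.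
Proof.
  intros H. revert k. apply Z.peano_ind.
  - rewrite Rmult_0_l. apply HG.
  - intros k IH. rewrite osmul_succ, succ_IZR, Rmult_plus_distr_r, Rmult_1_l.
    now apply pe_add.
  - intros k IH. rewrite osmul_pred, pred_IZR, Rmult_minus_distr_r, Rmult_1_l.
    now apply HG.
Qed.

Lemma pe_functional u r r' : G u r -> G u r' -> r = r'.
Proof.
  intros H H'. apply Rminus_diag_uniq. apply (pe_fun G HG).
  replace 0%oag with (u - u)%oag by omod. now apply HG.
Qed.

Definition extend x r : U -> R -> Prop := fun u s =>
  exists h t k, G h t /\ u = (h + k *: x)%oag /\ s = (t + IZR k * r)%R.

Lemma extend_embedding x r :
  (forall h t k, G h t -> ((h + k *: x)%oag = 0%oag <-> (t + IZR k * r)%R = 0%R)) ->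
  partial_embedding (extend x r).
Proof.
  intros H. split.
  - exists 0%oag, 0%R, 0%Z. split; [apply HG|]. split; [omod|ring].
  - intros u s u' s' [h [t [k [K [-> ->]]]]] [h' [t' [k' [K' [-> ->]]]]].
    exists (h - h')%oag, (t - t')%R, (k - k')%Z. split; [now apply HG|].
    split; [omod|]. rewrite minus_IZR. ring.
  - intros u [h [t [k [K [-> E]]]]]. apply (H h t k K). auto.
  - intros s [h [t [k [K [E ->]]]]]. apply (H h t k K). auto.
Qed.

(** If some [k x] with [k] nonzero already has an image [s], the image of [x] is forced to be
    [s / k], and this is consistent because [U] is torsion-free. Otherwise any real avoiding the
    countably many values [-t / k], with [t] in the image and [k] nonzero, keeps the extension
    injective. *)
Lemma extend_exists x : exists r, partial_embedding (extend x r).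
Proof.
  destruct (classic (exists k s, k <> 0%Z /\ G (k *: x)%oag s)) as [[k [s [Hk Hs]]]|N].
  - exists (s / IZR k)%R. apply extend_embedding. intros h t k' K.
    assert (k0 : IZR k <> 0%R) by now apply not_0_IZR.
    assert (Q : G (k *: (h + k' *: x))%oag (IZR k * (t + IZR k' * (s / IZR k)))%R).
    { replace (k *: (h + k' *: x))%oag with (k *: h + k' *: (k *: x))%oag by omod.
      replace (IZR k * (t + IZR k' * (s / IZR k)))%R with (IZR k * t + IZR k' * s)%R
        by (field; exact k0).
      apply pe_add; now apply pe_smul. }
    split; intros E.
    + rewrite E, osmul0r in Q. apply (pe_fun G HG), Rmult_integral in Q. tauto.
    + rewrite E, Rmult_0_r in Q. apply (pe_inj G HG) in Q.
      apply (osmul_inj k); [exact Hk|]. now rewrite osmul0r.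
  - set (val := fun u => epsilon (inhabits 0%R) (G u)).
    (* A Cantor pairing runs through the elements [c i] and the integers [a - b]. Terms with [a = b]
       divide by zero but are never consulted. *)
    destruct (exists_not_in_sequence (fun m =>
      let (i, j) := Cantor.of_nat m in let (a, b) := Cantor.of_nat j in
      (- val (c i) / IZR (Z.of_nat a - Z.of_nat b))%R)) as [r Hr].
    exists r. apply extend_embedding. intros h t k K.
    destruct (Z.eq_dec k 0) as [->|Hk].
    + replace (h + 0 *: x)%oag with h by omod. rewrite Rmult_0_l, Rplus_0_r.
      split; intros E.
      * apply (pe_fun G HG). now rewrite <- E.
      * apply (pe_inj G HG). now rewrite <- E.
    + split; intros E; exfalso.
      * apply N. exists k, (- t)%R. split; [exact Hk|].
        replace (k *: x)%oag with (- h)%oag; [now apply pe_opp|].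
        apply (oadd_cancel _ h). rewrite oaddNl, oaddC. auto.
      * destruct (c_surj h) as [i Hi].
        apply (Hr (Cantor.to_nat (i, Cantor.to_nat (Z.to_nat k, Z.to_nat (- k))))).
        rewrite !Cantor.cancel_of_to, Hi.
        replace (Z.of_nat (Z.to_nat k) - Z.of_nat (Z.to_nat (- k)))%Z with k by lia.
        assert (V : val h = t).
        { apply (pe_functional h); [|exact K]. apply (epsilon_spec (inhabits 0%R) (G h)). eauto. }
        rewrite V. assert (IZR k <> 0%R) by now apply not_0_IZR.
        replace t with (- (IZR k * r))%R by lra. field. assumption.
Qed.

End Graph.

Definition extend_chosen (G : U -> R -> Prop) x : U -> R -> Prop :=
  extend G x (epsilon (inhabits 0%R) (fun r => partial_embedding (extend G x r))).

Lemma extend_chosen_embedding G x :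
  partial_embedding G -> partial_embedding (extend_chosen G x).
Proof.
  intros HG. apply (epsilon_spec (inhabits 0%R) (fun r => partial_embedding (extend G x r))).
  now apply extend_exists.
Qed.

Variable z : U.
Hypothesis Hz : (0 < z)%oag.

(** The chain starts by sending [z] to 1, the period of the circle, and stage [n + 1] takes in
    [c n]. *)
Fixpoint embedding_chain (n : nat) : U -> R -> Prop :=
  match n with
  | O => fun u r => exists k, u = (k *: z)%oag /\ r = IZR k
  | S n => extend_chosen (embedding_chain n) (c n)
  end.

Lemma embedding_chain_partial n : partial_embedding (embedding_chain n).
Proof.
  induction n as [|n IH]; [|now apply extend_chosen_embedding]. split.
  - exists 0%Z. auto.
  - intros u r u' r' [k [-> ->]] [k' [-> ->]]. exists (k - k')%Z.
    split; [omod|]. now rewrite minus_IZR.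
  - intros u [k [-> E]]. apply eq_sym, eq_IZR in E. now subst k.
  - intros r [k [E ->]]. f_equal. destruct (Z.lt_trichotomy k 0) as [K|[K|K]]; [|exact K|].
    + apply (osmul_lt_l (x := z)) in K; [|exact Hz]. rewrite <- E in K.
      destruct (olt_irr _ _ K).
    + apply (osmul_lt_l (x := z)) in K; [|exact Hz]. rewrite <- E in K.
      destruct (olt_irr _ _ K).
Qed.

Lemma embedding_chain_mono m n u r :
  embedding_chain m u r -> embedding_chain (n + m) u r.
Proof.
  intros H. induction n as [|n IH]; simpl; [exact H|].
  exists u, r, 0%Z. split; [exact IH|]. split; [omod|ring].
Qed.

Theorem countable_embedding : exists f : U -> R, f z = 1%R /\
  (forall u v, f (u + v)%oag = (f u + f v)%R) /\ (forall u v, f u = f v -> u = v).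
Proof.
  set (G := fun u r => exists n, embedding_chain n u r).
  assert (T : forall u, exists r, G u r).
  { intros u. destruct (c_surj u) as [n Hn]. eexists. exists (S n).
    exists 0%oag, 0%R, 1%Z. split; [apply embedding_chain_partial|].
    split; [rewrite Hn; omod|reflexivity]. }
  assert (J : forall u r u' r', G u r -> G u' r' -> exists n, embedding_chain n u r /\
    embedding_chain n u' r').
  { intros u r u' r' [m H] [n K]. exists (m + n)%nat. split.
    - rewrite Nat.add_comm. now apply embedding_chain_mono.
    - now apply embedding_chain_mono. }
  assert (Fu : forall u r r', G u r -> G u r' -> r = r').
  { intros u r r' H K. destruct (J _ _ _ _ H K) as [n [H' K']].
    exact (pe_functional _ (embedding_chain_partial n) _ _ _ H' K'). }
  set (f := fun u => epsilon (inhabits 0%R) (G u)).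
  assert (Hf : forall u, G u (f u)) by (intros u; apply epsilon_spec, T).
  exists f. split; [|split].
  - apply (Fu z); [apply Hf|]. exists O, 1%Z. split; [omod|reflexivity].
  - intros u v. apply (Fu (u + v)%oag); [apply Hf|].
    destruct (J _ _ _ _ (Hf u) (Hf v)) as [n [H K]]. exists n.
    apply pe_add; auto. apply embedding_chain_partial.
  - intros u v E. destruct (J _ _ _ _ (Hf u) (Hf v)) as [n [H K]].
    apply (oadd_cancel _ (- v)%oag). rewrite oaddN.
    apply (pe_inj _ (embedding_chain_partial n)).
    replace 0%R with (f u - f v)%R by lra. now apply embedding_chain_partial.
Qed.

End Embedding.

(** * The two kinds of congruences *)

Section DenseCongruence.
Variables (U V : oag) (f : U -> V).
Hypothesis f_add : forall a b, f (a + b)%oag = (f a + f b)%oag.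
Hypothesis f_inj : forall a b, f a = f b -> a = b.
Hypothesis f_surj : forall b, exists a, f a = b.
Hypothesis HU : regular_dense U.
Hypothesis HV : regular_dense V.
Local Open Scope oag_scope.

(** The group isomorphism [f] induces the identification of residues modulo [D]; it need not respect
    the order. *)
Definition dense_congruence (D : Z) (a : U) (b : V) : Prop :=
  exists v, b = f a + D *: v.

Lemma additive_0 : f 0 = 0.
Proof. apply (oadd_cancel _ (f 0)). now rewrite <- f_add, oadd0, oadd0l. Qed.

Lemma additive_opp a : f (- a) = - f a.
Proof. apply oopp_unique. rewrite <- f_add, oaddN. apply additive_0. Qed.

Lemma additive_smul n a : f (n *: a) = n *: f a.
Proof.
  revert n. apply Z.peano_ind; [apply additive_0| |]; intros n IH.
  - now rewrite !osmul_succ, f_add, IH.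
  - now rewrite !osmul_pred, f_add, IH, additive_opp.
Qed.

(** The summand [0 *: 0] gives the hypothesis the shape of the instance [j = 0] of the sign
    condition in [hc_fill], the unit being 0. *)
Lemma regular_dense_fill (W : oag) (K : Z) (b b' : W) : regular_dense W -> (0 < K)%Z ->
  0 < b' - b + 0 *: 0 -> exists y, b < K *: y /\ K *: y < b'.
Proof.
  intros HW HK H. apply (HW K HK). apply (olt_of H). omod.
Qed.

Lemma dense_half_congruence : half_congruence U V 0 0 dense_congruence.
Proof.
  split.
  - intros D. exists 0. rewrite additive_0. omod.
  - intros D a b a' b' [v ->] [v' ->]. exists (v + v'). rewrite f_add. omod.
  - intros D a b [v ->]. exists (- v). rewrite additive_opp. omod.
  - intros D a b w [v ->]. exists (v + w). omod.
  - intros D a _. exists (f a), 0. omod.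
  - intros k D a b _ _ [v ->]. exists (f a + D *: v). split; [|now exists v].
    rewrite additive_smul. omod.
  - intros k D a b [v ->]. exists (k *: v). omod.
  - intros D. exists 0. rewrite additive_0. omod.
  - intros K a b a' b' HK _ S Ha Ha'. apply regular_dense_fill; [exact HV|exact HK|].
    apply (S 0%Z ltac:(lia)). apply (olt_of (olt_add2 Ha Ha')). omod.
Qed.

(** [dense_congruence] puts the multiple of [D] on the side of [V], so the converse direction has
    its own proof. There [hc_div] and [hc_total] pull elements back through [f]. *)
Lemma dense_half_congruence_flip :
  half_congruence V U 0 0 (fun D b a => dense_congruence D a b).
Proof.
  split.
  - intros D. exists 0. rewrite additive_0. omod.
  - intros D a b a' b' [v ->] [v' ->]. exists (v + v'). rewrite f_add. omod.
  - intros D a b [v ->]. exists (- v). rewrite additive_opp. omod.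
  - intros D b a u [v ->]. exists (v - f u). rewrite f_add, additive_smul. omod.
  - intros D b _. destruct (f_surj b) as [a <-]. exists a, 0. omod.
  - intros k D b a Hk _ [v E]. destruct (f_surj (b - D *: v)) as [a' Ha'].
    exists a'. split.
    + apply f_inj. rewrite additive_smul, Ha'. apply (oadd_cancel _ ((k * D) *: v)).
      rewrite <- E. omod.
    + exists v. rewrite Ha'. omod.
  - intros k D b a [v ->]. exists (k *: v). omod.
  - intros D. exists 0. rewrite additive_0. omod.
  - intros K a b a' b' HK _ S Ha Ha'. apply regular_dense_fill; [exact HU|exact HK|].
    apply (S 0%Z ltac:(lia)). apply (olt_of (olt_add2 Ha Ha')). omod.
Qed.

End DenseCongruence.

Section DiscreteCongruence.
Local Open Scope oag_scope.

(** In a regularly discrete group the quotient by [D U] is cyclic of order [D], generated by the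
    class of [e]. Classes are matched by the integer residue [j]. *)
Definition discrete_congruence {U V : oag} (e : U) (e' : V) (D : Z) (a : U) (b : V) : Prop :=
  exists j u v, a = j *: e + D *: u /\ b = j *: e' + D *: v.

Lemma discrete_congruence_flip (U V : oag) (e : U) (e' : V) :
  discrete_congruence e' e = fun D b a => discrete_congruence e e' D a b.
Proof.
  apply functional_extensionality; intros D. apply functional_extensionality; intros b.
  apply functional_extensionality; intros a. apply propositional_extensionality.
  split; intros [j [u [v [H K]]]]; exists j, v, u; auto.
Qed.

Lemma discrete_half_congruence (U V : oag) (e : U) (e' : V) :
  regular_discrete U e -> regular_discrete V e' ->
  half_congruence U V e e' (discrete_congruence e e').
Proof.
  intros [[He Hl] HU] [[He' _] _]. split.
  - intros D. exists 0%Z, 0, 0. split; omod.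
  - intros D a b a' b' [j [u [v [-> ->]]]] [j' [u' [v' [-> ->]]]].
    exists (j + j')%Z, (u + u'), (v + v'). split; omod.
  - intros D a b [j [u [v [-> ->]]]]. exists (- j)%Z, (- u), (- v). split; omod.
  - intros D a b w [j [u [v [-> ->]]]]. exists j, u, (v + w). split; omod.
  - intros D a HD. destruct (HU D HD a) as [y [j ->]].
    exists (j *: e'), j, y, 0. split; omod.
  - intros k D a b Hk HD [j [u [v [E ->]]]].
    pose proof (Z.div_mod j k ltac:(lia)) as J.
    pose proof (Z.mod_pos_bound j k Hk) as J'.
    set (q := (j / k)%Z) in *. set (r := (j mod k)%Z) in *. clearbody q r. subst j.
    (* The remainder [r] of [j] modulo [k] satisfies [r e = k w] with [0 <= w < e]. Minimality of
       [e] forces [w = 0], hence [r = 0]. *)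
    set (w := a - D *: u - q *: e).
    assert (W : k *: w = r *: e).
    { unfold w. replace (k *: (a - D *: u - q *: e))
        with (k *: a - ((k * D) *: u + (k * q) *: e)) by omod. rewrite E. omod. }
    assert (W0 : 0 <= w).
    { apply (osmul_le_inv k); [exact Hk|]. rewrite osmul0r, W, <- (osmul0l U e).
      apply osmul_le_l; [now left|lia]. }
    assert (W1 : w < e).
    { apply (osmul_lt_inv k); [exact Hk|]. rewrite W. apply osmul_lt_l; [exact He|lia]. }
    destruct W0 as [W0|W0]; [destruct (olt_not_le W1 (Hl w W0))|].
    assert (r = 0%Z).
    { destruct (Z.eq_dec r 0) as [|R]; [assumption|].
      assert (K : 0 *: e < r *: e) by (apply osmul_lt_l; [exact He|lia]).
      rewrite <- W, <- W0, osmul0r in K. destruct (olt_irr _ _ K). }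
    subst r. exists (q *: e' + D *: v). split; [omod|]. exists q, u, v. split; [|reflexivity].
    replace a with (w + (q *: e + D *: u)) by (unfold w; omod). rewrite <- W0. omod.
  - intros k D a b [j [u [v [-> ->]]]]. exists j, (k *: u), (k *: v). split; omod.
  - intros D. exists 1%Z, 0, 0. split; omod.
  - intros K a b a' b' HK [j [u [v [-> ->]]]] S Ha Ha'.
    pose proof (Z.div_mod j K ltac:(lia)) as J.
    pose proof (Z.mod_pos_bound j K HK) as J'.
    set (q := (j / K)%Z) in *. set (r := (j mod K)%Z) in *. clearbody q r. subst j.
    (* The next multiple of [K] above [a] is [K w = a + (K - r) e]. As [a < 0] and 0 is itself a
       multiple of [K], it is at most 0 and hence below [a']. This is the sign of
       [a' - a + (r - K) e], which transfers to [b] and [b'] because [|r - K| <= K]. *)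
    set (w := u + q *: e + e).
    assert (W : w <= 0).
    { apply onot_lt. intros W. apply Hl in W. apply (osmul_le K) in W; [|lia].
      apply (olt_not_le Ha).
      apply (ole_of (ole_add2 W (osmul_le_l (m := 0) (n := r) (or_introl He) ltac:(lia)))).
      unfold w. omod. }
    apply (osmul_le K) in W; [|lia].
    exists (v + q *: e' + e'). split.
    + apply (olt_of (osmul_lt_l (m := r) (n := K) He' ltac:(lia))). omod.
    + destruct (S (r - K)%Z ltac:(lia)) as [S1 _].
      assert (P : 0 < a' - ((K * q + r) *: e + K *: u) + (r - K) *: e).
      { apply (olt_of (olt_le_add2 Ha' W)). unfold w. omod. }
      apply S1 in P. apply (olt_of P). omod.
Qed.

End DiscreteCongruence.

(** * Approximation by c-archimedean groups *)

Section Approximation.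
Local Open Scope oag_scope.

Lemma osmul_pos_iff (U : oag) (x : U) n : 0 < x -> (0 < n *: x <-> (0 < n)%Z).
Proof.
  intros Hx. split; intros H; [|now apply osmul_pos].
  apply (osmul_lt_l_inv Hx). exact H.
Qed.

Lemma same_sign_sym_pos (U V : oag) (x : U) (y : V) :
  (0 < x <-> 0 < y) -> (0 < - x <-> 0 < - y) -> same_sign x y.
Proof. intros H K. split; [exact H|]. now rewrite !oopp_pos. Qed.

(** The initial position, with no variables and only the constants. Positivity suffices as
    hypothesis, since the set of admissible coefficients is symmetric. *)
Lemma equivalent_pair (U V : oag) C B D (e : U) (e' : V) (z : U) (z' : V) :
  C D z z' -> C D e e' ->
  (forall n j : Z, (Z.abs n <= B)%Z -> (Z.abs j <= B)%Z ->
    (0 < n *: z + j *: e <-> 0 < n *: z' + j *: e')) ->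
  equivalent_lists C B D [(z, z'); (e, e')].
Proof.
  intros H1 H2 H. split.
  - intros a b [E|[E|[]]]; injection E as <- <-; auto.
  - intros x y [n [x1 [y1 [Hn [[j [x2 [y2 [Hj [[-> ->] [-> ->]]]]]] [-> ->]]]]]].
    cbn [fst snd]. rewrite !oadd0. apply same_sign_sym_pos; [now apply H|].
    specialize (H (- n)%Z (- j)%Z ltac:(lia) ltac:(lia)).
    replace (- (n *: z + j *: e)) with ((- n)%Z *: z + (- j)%Z *: e) by omod.
    replace (- (n *: z' + j *: e')) with ((- n)%Z *: z' + (- j)%Z *: e') by omod.
    exact H.
Qed.

Lemma densely_ordered_not_cyclic (U : oag) (z u0 : U) : 0 < z -> densely_ordered U ->
  ~ (forall u, exists k : Z, u = k *: u0).
Proof.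
  intros Hz D G.
  assert (P : forall x : U, 0 < x -> ~ forall u, exists k : Z, u = k *: x).
  { intros x Hx H. destruct (D x Hx) as [y [Y1 Y2]]. destruct (H y) as [k ->].
    assert (0 < k)%Z by now apply (osmul_pos_iff U x k Hx).
    assert (k < 1)%Z by now apply (osmul_lt_l_inv Hx).
    lia. }
  destruct (olt_total U 0 u0) as [K|[K|K]].
  - exact (P u0 K G).
  - destruct (G z) as [k Hk]. rewrite <- K, osmul0r in Hk. subst z. exact (olt_irr _ _ Hz).
  - apply (P (- u0)); [now apply oopp_pos|]. intros u. destruct (G u) as [k ->].
    exists (- k)%Z. omod.
Qed.

(** An injective additive map would carry a generator of its image back to a generator of [U], but a
    nontrivial densely ordered group is not cyclic. The dichotomy for subgroups of the reals leaves
    the dense case. *)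
Lemma image_regular_dense (U : oag) (z : U) (f : U -> R) A (HA : real_subgroup A) :
  0 < z -> densely_ordered U -> (forall u v, f (u + v) = (f u + f v)%R) ->
  (forall u v, f u = f v -> u = v) -> (forall r, A r <-> exists u, f u = r) ->
  regular_dense (real_oag A HA).
Proof.
  intros Hz D f_add f_inj AE. apply small_elements_regular_dense.
  destruct (real_subgroup_dichotomy A HA) as [H|[g [Hg [Ag G]]]]; [exact H|exfalso].
  apply AE in Ag. destruct Ag as [u0 Hu0].
  apply (densely_ordered_not_cyclic U z u0 Hz D). intros u.
  destruct (G (f u)) as [k Hk]; [apply AE; eauto|]. exists k. apply f_inj. rewrite Hk.
  assert (f0 : f 0 = 0%R).
  { pose proof (f_add 0 0) as E. rewrite oadd0 in E. lra. }
  assert (fN : forall v, f (- v) = (- f v)%R).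
  { intros v. pose proof (f_add v (- v)) as E. rewrite oaddN in E. lra. }
  subst g. clear - f0 fN f_add. revert k. apply Z.peano_ind.
  - simpl. rewrite f0. ring.
  - intros k IH. rewrite succ_IZR, osmul_succ, f_add, <- IH. ring.
  - intros k IH. rewrite pred_IZR, osmul_pred, f_add, fN, <- IH. ring.
Qed.

(** The initial position compares signs only of multiples of [z] and of 1, the unit being 0. So the
    transfer applies although the map to the reals may disagree with the order elsewhere. *)
Lemma dense_approximation (U : oag) (z : U) M p f : cover U z M p ->
  (exists c : nat -> U, forall u, exists n, c n = u) ->
  densely_ordered U -> regular_dense U -> sentence f ->
  exists N, c_archimedean N /\ forall v w, sat M v f <-> sat N w f.
Proof.
  intros CV [c Hc] DU RU Hf. pose proof (cov_pos _ _ _ _ CV) as Hz.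
  destruct (countable_embedding U c Hc z Hz) as [g [g1 [g_add g_inj]]].
  set (A := fun r => exists u, g u = r).
  assert (HA : real_subgroup A).
  { split; [now exists z|]. intros a b [u <-] [v <-]. exists (u - v).
    pose proof (g_add (u - v) v) as E. replace (u - v + v) with u in E by omod. lra. }
  destruct (real_subgroup_c_archimedean A HA) as [N [q [HN CN]]].
  set (h := fun u => exist A (g u) (ex_intro _ u eq_refl) : real_oag A HA).
  assert (h_add : forall a b, h (a + b) = h a + h b).
  { intros a b. apply real_sig_eq. apply g_add. }
  assert (h_inj : forall a b, h a = h b -> a = b).
  { intros a b E. apply g_inj. exact (f_equal (@proj1_sig _ _) E). }
  assert (h_surj : forall b, exists a, h a = b).
  { intros [r [u Hu]]. exists u. apply real_sig_eq. exact Hu. }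
  assert (RV : regular_dense (real_oag A HA)).
  { apply (image_regular_dense U z g); auto. reflexivity. }
  set (S := Setting U (real_oag A HA) M N 0 0 z (rone A HA) p q
    (dense_congruence U (real_oag A HA) h) CV CN
    (dense_half_congruence U _ h h_add RV)
    (dense_half_congruence_flip U _ h h_add h_inj h_surj RU)).
  destruct (transfer f 0 Hf) as [B [D [_ [_ T]]]].
  exists N. split; [exact HN|]. intros v w. apply (T S []); [intros i Hi; lia|].
  apply equivalent_pair.
  - exists 0. apply real_sig_eq. rewrite osmul0r, oadd0. symmetry. exact g1.
  - apply (hc_0 _ _ _ _ _ (s_half S)).
  - intros n j _ _. cbn [S sU sV sz sz' su sv]. rewrite !osmul0r, !oadd0.
    rewrite (osmul_pos_iff U z n Hz).
    rewrite (osmul_pos_iff (real_oag A HA) (rone A HA) n (cov_pos _ _ _ _ CN)). reflexivity.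
Qed.

(** The integer [m] plays the role of [z] measured in units of [e]. If [z] is a multiple of [e], [m]
    is exact. Otherwise [z] exceeds [B e], and any [m > B] in the right class modulo [D] gives the
    same signs, because for nonzero [n] the sign of [n] decides on both sides. *)
Lemma discrete_modulus (U : oag) (z e : U) (B D : Z) : regular_discrete U e -> 0 < z ->
  (1 <= B)%Z -> (1 <= D)%Z -> exists m : Z, (1 <= m)%Z /\
  (exists u, z = m *: e + D *: u) /\
  forall n j, (Z.abs n <= B)%Z -> (Z.abs j <= B)%Z ->
    (0 < n *: z + j *: e <-> (0 < n * m + j)%Z).
Proof.
  intros [He HU] Hz HB HD. pose proof (proj1 He) as He0.
  destruct (classic (exists k : Z, z = k *: e)) as [[k ->]|N].
  - exists k. split; [|split].
    + assert (0 < k)%Z by now apply (osmul_pos_iff U e k He0). lia.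
    + exists 0. omod.
    + intros n j _ _. rewrite osmulA, <- osmulDl. now apply osmul_pos_iff.
  - destruct (HU D ltac:(lia) z) as [y [j0 E]].
    assert (Big : B *: e < z).
    { destruct (ole_or_lt z (B *: e)) as [K|K]; [|exact K]. exfalso.
      destruct (discrete_multiple U e z (Z.to_nat B) He) as [k [_ Hk]].
      - now left.
      - now rewrite Z2Nat.id by lia.
      - apply N. eauto. }
    (* As [D >= 1], this choice gives [m >= j0 + |j0| + B + 1 > B]. *)
    set (t := (Z.abs j0 + B + 1)%Z). set (m := (j0 + D * t)%Z).
    assert (Hm : (B < m)%Z) by (unfold m, t; nia).
    exists m. split; [lia|]. split.
    + exists (y - t *: e). rewrite E at 1. unfold m. omod.
    + assert (P : forall n j, (1 <= n)%Z -> (Z.abs j <= B)%Z -> 0 < n *: z + j *: e).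
      { intros n j Hn Hj.
        pose proof (osmul_le_l (m := 1) (n := n) (or_introl Hz) Hn) as K1.
        pose proof (osmul_le_l (m := - j) (n := B) (or_introl He0) ltac:(lia)) as K2.
        apply (olt_of (olt_le_add2 Big (ole_add2 K1 K2))). omod. }
      intros n j Hn Hj. destruct (Z.lt_trichotomy n 0) as [K|[-> |K]].
      * split; intros L; exfalso; [|nia].
        specialize (P (- n)%Z (- j)%Z ltac:(lia) ltac:(lia)).
        apply (olt_irr U 0). apply (olt_of (olt_add2 L P)). omod.
      * rewrite osmul0l, oadd0l, Z.mul_0_l, Z.add_0_l. now apply osmul_pos_iff.
      * split; intros _; [nia|]. apply P; lia.
Qed.

(** The approximating group is finite cyclic of order [m], with [1 / m] in the role of [e]. *)
Lemma discrete_approximation (U : oag) (z e : U) M p f : cover U z M p ->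
  regular_discrete U e -> sentence f ->
  exists N, c_archimedean N /\ forall v w, sat M v f <-> sat N w f.
Proof.
  intros CV RU Hf. pose proof (cov_pos _ _ _ _ CV) as Hz.
  destruct (transfer f 0 Hf) as [B [D [HB [HD T]]]].
  destruct (discrete_modulus U z e B D RU Hz HB HD) as [m [Hm [[u0 Hu0] Hs]]].
  assert (m0 : (0 < IZR m)%R) by (apply IZR_lt; lia).
  set (A := fun r => exists k : Z, r = (IZR k / IZR m)%R).
  assert (HA : real_subgroup A).
  { split; [exists m; field; lra|]. intros a b [k ->] [l ->]. exists (k - l)%Z.
    rewrite minus_IZR. field. lra. }
  destruct (real_subgroup_c_archimedean A HA) as [N [q [HN CN]]].
  assert (Ae : A (/ IZR m)%R) by (exists 1%Z; field; lra).
  set (e' := exist A _ Ae : real_oag A HA).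
  assert (He' : 0 < e') by (apply Rinv_0_lt_compat; exact m0).
  assert (E1 : rone A HA = m *: e').
  { apply real_sig_eq. rewrite proj1_smul. simpl. field. lra. }
  assert (RV : regular_discrete (real_oag A HA) e').
  { apply cyclic_regular_discrete; [exact He'|]. intros [r [k ->]]. exists k.
    apply real_sig_eq. rewrite proj1_smul. simpl. reflexivity. }
  assert (HF : half_congruence (real_oag A HA) U e' e
    (fun D b a => discrete_congruence e e' D a b)).
  { rewrite <- discrete_congruence_flip. now apply discrete_half_congruence. }
  set (S := Setting U (real_oag A HA) M N e e' z (rone A HA) p q
    (discrete_congruence e e') CV CN (discrete_half_congruence U _ e e' RU RV) HF).
  exists N. split; [exact HN|]. intros v w. apply (T S []); [intros i Hi; lia|].
  apply equivalent_pair.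
  - exists m, u0, 0. split; [exact Hu0|]. cbn [S sU sV sz sz' su sv]. rewrite E1. omod.
  - apply (hc_unit _ _ _ _ _ (s_half S)).
  - intros n j Hn Hj. cbn [S sU sV sz sz' su sv]. rewrite Hs by assumption.
    rewrite E1, osmulA, <- osmulDl. symmetry. now apply osmul_pos_iff.
Qed.

End Approximation.

(** Passing to a countable elementary substructure keeps c-regularity because c-regularity is
    axiomatized by sentences. The unwound group of a countable structure is again countable. *)
Lemma c_regular_approximation M f : c_regular M -> sentence f ->
  exists N, c_archimedean N /\ forall v w, sat M v f <-> sat N w f.
Proof.
  intros HM Hf. destruct (downward_loewenheim_skolem M) as [M0 [[c Hc] E]].
  assert (HM0 : c_regular M0).
  { destruct c_regular_elementary as [T [HT K]]. apply K. intros g Hg v.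
    apply (E g (HT g Hg) v (fun _ => zero)). now apply (proj1 (K M) HM). }
  assert (EM : forall N, (forall v w, sat M0 v f <-> sat N w f) ->
    forall v w, sat M v f <-> sat N w f).
  { intros N H v w. rewrite <- (E f Hf (fun _ => zero) v). apply H. }
  pose proof (unwound_cover M0 (proj1 HM0)) as CV.
  enough (exists N, c_archimedean N /\ forall v w, sat M0 v f <-> sat N w f)
    as [N [HN H]] by (exists N; split; auto).
  destruct (dense_or_least_positive (unwound M0 (proj1 HM0))) as [D|[e He]].
  - eapply dense_approximation; [exact CV| |exact D| |exact Hf].
    + exists (fun n => let (i, j) := Cantor.of_nat n in let (a, b) := Cantor.of_nat j in
        ((Z.of_nat a - Z.of_nat b)%Z, c i)).
      intros [k a]. destruct (Hc a) as [i Hi].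
      exists (Cantor.to_nat (i, Cantor.to_nat (Z.to_nat k, Z.to_nat (- k)))).
      rewrite !Cantor.cancel_of_to, Hi. f_equal. lia.
    + exact (c_regular_regular_dense _ _ _ _ CV D HM0).
  - eapply discrete_approximation; [exact CV| |exact Hf].
    exact (c_regular_regular_discrete _ _ _ _ CV e He HM0).
Qed.

Theorem mainTheorem1 :
  elementary_class c_regular /\
  (forall M : structure, c_archimedean M -> c_regular M) /\
  (forall K : structure -> Prop,
     elementary_class K ->
     (forall M : structure, c_archimedean M -> K M) ->
     forall M : structure, c_regular M -> K M).
Proof.
  split; [exact c_regular_elementary|].
  split; [exact c_archimedean_c_regular|].
  intros K [T [HT HK]] HA M HM. apply HK. intros f Hf v.
  destruct (c_regular_approximation M f HM (HT f Hf)) as [N [HN E]].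
  apply (E v (fun _ => zero)). apply (proj1 (HK N) (HA N HN) f Hf).
Qed.
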